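(* Let the probability density $f_0$ on $\mathbb R_+$, with $\int_{\mathbb R_+} vf_0(v)\,dv=1$, belong to $\mathcal M_\alpha(\mathbb R_+)$, where $\alpha=1+\delta$ for some $\delta>0$, and let the mixing parameters $p>q>0$ satisfy $$\frac{(p-1)^2}{q}=\lambda$$ for some $\lambda>0$ fixed. Let $g(v,t)$ be the weak solution of the scaled wealth Boltzmann equation (SW) (see context) with initial value $f_0$, and let $h_q(v,\tau)=g(v,t)$ with $\tau=qt$ be the scaled density. Then, as $q\to0$, for all $\phi\in\mathcal F_s(\mathbb R)$ with $s=1+\delta$, the weak solution $h_q(v,\tau)$ converges (that is, tested against $\phi$), up to extraction of a subsequence, to a probability density $h(v,\tau)$. This density is a weak solution of the Fokker–Planck equation $$\frac{\partial h}{\partial\tau}=\frac\lambda2\frac{\partial^2}{\partial v^2}(v^2h)+\frac{\partial}{\partial v}\big((v-1)h\big),$$ that is, with these test functions $\phi$, $$\frac d{d\tau}\int_{\mathbb R_+}\phi(v)h(v,\tau)\,dv+\int_{\mathbb R_+}\phi'(v)(v-1)h(v,\tau)\,dv=\frac\lambda2\int_{\mathbb R_+}h(v,\tau)\,v^2\phi''(v)\,dv .$$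
   Context: Probability measures on $\mathbb R_+=[0,\infty)$ are written as densities, extended by $0$ to $\mathbb R$. $\mathcal M_\alpha(\mathbb R_+)$ is the set of Borel probability measures on $\mathbb R_+$ with finite moment of order $\alpha$, with the topology of weak convergence. For $s>0$ write $s=m+\delta'$ with $m\ge0$ an integer and $0<\delta'\le1$. $\mathcal F_s(\mathbb R)$ is the class of real functions $\phi$ on $\mathbb R$ whose $m$-th derivative is Hölder continuous of order $\delta'$: $\sup_{v\ne w}\frac{|\phi^{(m)}(v)-\phi^{(m)}(w)|}{|v-w|^{\delta'}}<\infty$. A weak solution $f$ of the (unscaled) wealth Boltzmann equation with initial datum $f_0\in\mathcal M_\alpha(\mathbb R_+)$, $\alpha>1$, is a probability density $f$, of class $C^1$ in time with values in $\mathcal M_\alpha(\mathbb R_+)$, such that for all $t>0$ and all smooth functions $\phi$ $$\frac d{dt}\int_{\mathbb R_+}\phi(v)f(v,t)\,dv=\int_{\mathbb R_+^2}f(v,t)f(w,t)\big(\phi(pv+qw)-\phi(v)\big)\,dv\,dw,$$ and $\lim_{t\to0}\int\phi(v) f(v,t)\,dv=\int\phi(v) f_0(v)\,dv$ for all such $\phi$. When $f_0$ has mean $1$, $m(t)=\int vf(v,t)\,dv=\exp\{(p+q-1)t\}$. The weak solution of the scaled equation (SW) with initial value $f_0$ is $g(v,t)=m(t)f(m(t)v,t)$. The weak form of (SW) is $$\frac d{dt}\int_{\mathbb R_+}\phi(v) g(v,t)\,dv+(p+q-1)\int_{\mathbb R_+}\phi'(v)\,v\,g(v,t)\,dv=\int_{\mathbb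 R_+^2}g(v,t)g(w,t)\big(\phi(pv+qw)-\phi(v)\big)\,dv\,dw ,$$ so that $h_q(v,\tau)$ with $\tau=qt$ satisfies the same equation with $\frac{d}{d\tau}$ in place of $\frac d{dt}$ and the other two terms divided by $q$.
   Formalization: For δ<1 a function φ in F_{1+δ} need not have φ'', so the right-hand side is undefined; there the Fokker–Planck identity is stated only for φ with φ' locally Lipschitz on (0,∞) and |v²φ''| ≤ C(1+v^{1+δ}). Convergence is for all φ in F_{1+δ}. *)

(* Defs.v *)
From HB Require Import structures.
From mathcomp Require Import all_boot all_order all_algebra.
From mathcomp Require Import all_classical all_reals all_analysis.

Set Implicit Arguments.
Unset Strict Implicit.
Unset Printing Implicit Defensive.
Import Order.TTheory GRing.Theory Num.Theory.
Import numFieldNormedType.Exports.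
Local Open Scope classical_set_scope.
Local Open Scope ring_scope.

Definition Rplus (R : realType) : set R := `[0, +oo[.

(* A density on R_+ is a Borel function on R that vanishes on ]-oo, 0[. *)
Definition prob_density (R : realType) (f : R -> R) : Prop :=
  [/\ measurable_fun setT f,
      forall v, 0 <= f v,
      forall v, v < 0 -> f v = 0 &
      (\int[lebesgue_measure]_(v in @Rplus R) (f v)%:E = 1)%E].

Definition density_in_M (R : realType) (alpha : R) (f : R -> R) : Prop :=
  prob_density f /\
  (\int[lebesgue_measure]_(v in @Rplus R) (v `^ alpha * f v)%:E < +oo)%E.

Definition pairing (R : realType) (phi f : R -> R) : R :=
  \int[lebesgue_measure]_(v in @Rplus R) (phi v * f v).

Definition holder_class (R : realType) (s : R) (phi : R -> R) : Prop :=
  exists (m : nat) (d : R),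
    [/\ 0 < d <= 1, s = m%:R + d,
        forall k : nat, (k < m)%N -> forall x, derivable (derive1n k phi) x 1 &
        exists C : R, forall v w, v != w ->
          `|derive1n m phi v - derive1n m phi w| / (`|v - w| `^ d) <= C].

Definition smooth (R : realType) (phi : R -> R) : Prop :=
  forall (k : nat) (x : R), derivable (derive1n k phi) x 1.

(* For measurable phi this bound holds almost everywhere exactly when phi is
   integrable against every density with finite moment of order alpha. *)
Definition growth_le (R : realType) (alpha : R) (phi : R -> R) : Prop :=
  exists C : R, forall v, 0 < v -> `|phi v| <= C * (1 + v `^ alpha).

Definition collision (R : realType) (p q : R) (phi f : R -> R) : R :=
  \int[(lebesgue_measure \x lebesgue_measure)%E]_(z in @Rplus R `*` @Rplus R)
    (f z.1 * f z.2 * (phi (p * z.1 + q * z.2) - phi z.1)).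

(* [C1_weak f]: t |-> f t is C^1 on ]0, +oo[ for the weak topology, that is,
   when tested against bounded continuous functions. *)
Definition C1_weak (R : realType) (f : R -> R -> R) : Prop :=
  forall phi : R -> R, continuous phi ->
    (exists C : R, forall v, `|phi v| <= C) ->
    forall t : R, 0 < t ->
      derivable (fun t => pairing phi (f t)) t 1 /\
      {for t, continuous (derive1 (fun t => pairing phi (f t)))}.

(* Time comes first: [f t v] is f(v,t). The test functions are the smooth
   functions of growth at most v^alpha, since for other smooth functions the
   integrals in the equation need not converge. *)
Definition boltzmann_weak_solution (R : realType) (p q alpha : R)
    (f0 : R -> R) (f : R -> R -> R) : Prop :=
  [/\ forall t, 0 < t -> density_in_M alpha (f t),
      C1_weak f,
      forall phi : R -> R, smooth phi -> growth_le alpha phi ->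
        forall t : R, 0 < t ->
          is_derive t 1 (fun t => pairing phi (f t)) (collision p q phi (f t)) &
      forall phi : R -> R, smooth phi -> growth_le alpha phi ->
        pairing phi (f t) @[t --> 0^'+] --> pairing phi f0].

Definition mean (R : realType) (f : R -> R) : R := pairing id f.

Definition scaled_weak_solution (R : realType) (p q alpha : R)
    (f0 : R -> R) (g : R -> R -> R) : Prop :=
  exists2 f : R -> R -> R,
    boltzmann_weak_solution p q alpha f0 f &
    forall t v : R, 0 < t -> g t v = mean (f t) * f t (mean (f t) * v).

Definition slow_time (R : realType) (q : R) (g : R -> R -> R) : R -> R -> R :=
  fun tau v => g (tau / q) v.

(* A function in F_s with s < 2 need not have a second derivative, and then
   the second order term of the Fokker-Planck equation has no meaning. This
   condition makes phi'' exist almost everywhere on ]0, +oo[, determine phi'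
   there, and give a finite integral of v^2 phi'' against every density in
   M_s. Every function in F_s satisfies it when s >= 2. At the null set of
   points where phi' is not differentiable, [derive1n 2 phi] has an
   irrelevant default value. *)
Definition second_order_term_defined (R : realType) (s : R) (phi : R -> R) :
    Prop :=
  (forall a b : R, 0 < a -> [lipschitz derive1 phi x | x in `[a, b]]) /\
  growth_le s (fun v => v ^+ 2 * derive1n 2 phi v).

Definition fokker_planck_test (R : realType) (s : R) (phi : R -> R) : Prop :=
  holder_class s phi /\ (s < 2 -> second_order_term_defined s phi).

Definition fokker_planck_weak_solution (R : realType) (lambda s : R)
    (h : R -> R -> R) : Prop :=
  forall phi : R -> R, fokker_planck_test s phi ->
    forall tau : R, 0 < tau ->
      derivable (fun tau => pairing phi (h tau)) tau 1 /\
      derive1 (fun tau => pairing phi (h tau)) tau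
        + \int[lebesgue_measure]_(v in @Rplus R)
            (derive1 phi v * (v - 1) * h tau v)
      = lambda / 2 * \int[lebesgue_measure]_(v in @Rplus R)
                       (h tau v * v ^+ 2 * derive1n 2 phi v).

(* Main.v *)
(* Write W(v) = 1 + v^(1 + delta). Three facts about the scaled solutions, all
   uniform in q and in tau <= T, give the theorem.
   - Normalizing the mean removes the terms of order p - 1 from the evolution of
     a convex moment, so that after division by q a Gronwall argument controls
     the truncated moments (R^n + v^n)^((1 + delta)/n) - R^(1 + delta), and hence
     the tails of W(v) h_q(v) dv.
   - The loss term contracts and the gain term is a dilated convolution, so the
     bound <psi, f> <= K * <psi, 1> + y for 0 <= psi <= 1, valid for f_0 with y
     arbitrarily small, propagates with K growing by exp(C tau) only. With the
     tail bound, W(v) h_q(v) dv is uniformly absolutely continuous with respect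
     to exp(-v) dv.
   - A Taylor expansion shows that, tested against exp(-jv), the scaled equation
     is the Fokker-Planck equation up to an error that tends to 0 with q.
   By the third fact the integrals of exp(-jv) are equicontinuous in tau, and a
   diagonal subsequence of them converges. By the second fact polynomials in
   exp(-v) approximate every function of growth W in L^1(h_q dv), uniformly in
   q, so the convergence extends to all these functions, and the limit has a
   density by the Radon-Nikodym theorem. The limit satisfies the Fokker-Planck
   equation for affine functions and exponentials. For a general phi, whose
   derivative is locally Lipschitz on ]0, +oo[ and hence absolutely continuous
   there, approximate phi'' on an interval ]a, b] by exp(-v) P(exp(-v)) in L^1 of
   exp(-v) dv and of all h(., tau) at once, and integrate twice from v = 1. *)

Require Import Defs.
From HB Require Import structures.
From mathcomp Require Import all_boot all_order all_algebra.
From mathcomp Require Import all_classical all_reals all_analysis.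
From mathcomp Require Import measurable_realfun ring lra.

Set Implicit Arguments.
Unset Strict Implicit.
Unset Printing Implicit Defensive.
Import Order.TTheory GRing.Theory Num.Theory.
Import numFieldNormedType.Exports.
Local Open Scope classical_set_scope.
Local Open Scope ring_scope.

(** * Weighted pairings *)

(** Since (p - 1)^2 = lambda q, the number p - 1 is of order sqrt(q), and at time tau / q a term of
    first order in p - 1 is too large by the factor q^(-1/2). Every uniform bound therefore rests on
    a cancellation. For the domination bound it is this: the gain term makes K grow at the rate 1/p
    - 1, rescaling by the mean adds p + q - 1, and the sum is q + (p - 1)^2/p, of order q. Only
    moments of order 1 + delta exist, possibly below 2, and a test function may lack a second
    derivative. Expansions are therefore made on exponentials alone, where every power of v is
    absorbed by the decay. Weak convergence would neither exclude concentration nor reach tests that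
    grow like v^(1 + delta). Uniform absolute continuity of the weighted measures settles both
    points. The equation admits smooth tests only, so this bound has to be carried from smooth
    functions to measurable sets; for this, indicators are approximated by polynomials in exp(-v)
    with values in [0, 1]. *)

Section weights.
Context {R : realType}.
Local Notation mu := (@lebesgue_measure R).
Local Notation Rp := (@Rplus R).
Implicit Types (al c : R) (w phi psi : R -> R).

Lemma measurable_Rplus : measurable (Rp : set (measurableTypeR R)).
Proof. exact: measurable_itv. Qed.

Lemma RplusE (v : R) : Rp v = (0 <= v) :> Prop.
Proof. by rewrite /Rplus /= in_itv /= andbT. Qed.

Definition tame al phi := measurable_fun setT phi /\
  exists C, forall v, 0 <= v -> `|phi v| <= C * (1 + v `^ al).

(** Stated for weights rather than densities because exp(-v), products exp(-v) g(v) and sums of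
    these are paired with functions in the same way as the solutions. *)
Definition adm al w := [/\ measurable_fun setT w, forall v, 0 <= w v &
  mu.-integrable Rp (EFin \o (fun v => (1 + v `^ al) * w v))].

Lemma weight_ge1 al (v : R) : 1 <= 1 + v `^ al.
Proof. by rewrite lerDl powR_ge0. Qed.

Lemma weight_ge0 al (v : R) : 0 <= 1 + v `^ al.
Proof. by rewrite addr_ge0 ?powR_ge0. Qed.

Lemma measurable_weight al : measurable_fun setT (fun v : R => 1 + v `^ al).
Proof. by apply: measurable_funD => //; exact: measurable_powR. Qed.

Lemma tame_measurable al phi : tame al phi -> measurable_fun setT phi.
Proof. by case. Qed.

Lemma tame_bound al phi : tame al phi ->
  exists2 C, 0 <= C & forall v, 0 <= v -> `|phi v| <= C * (1 + v `^ al).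
Proof.
move=> [_ [C hC]]; exists (Num.max C 0); first by rewrite le_max lexx orbT.
move=> v v0; rewrite (le_trans (hC _ v0))// ler_wpM2r ?weight_ge0//.
by rewrite le_max lexx.
Qed.

Lemma tame_le al phi psi : measurable_fun setT phi -> tame al psi ->
  (forall v, 0 <= v -> `|phi v| <= `|psi v|) -> tame al phi.
Proof.
move=> mphi [_ [C hC]] h; split => //; exists C => v v0.
exact: le_trans (h _ v0) (hC _ v0).
Qed.

Lemma tame_bounded al phi M : measurable_fun setT phi ->
  (forall v, 0 <= v -> `|phi v| <= M) -> tame al phi.
Proof.
move=> mphi h; split => //; exists M => v v0.
have M0 : 0 <= M by exact: le_trans (normr_ge0 _) (h _ (lexx 0)).
by rewrite (le_trans (h _ v0))// ler_peMr// weight_ge1.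
Qed.

Lemma tame_cst al c : tame al (fun=> c).
Proof. by apply: (@tame_bounded _ _ `|c|). Qed.

Lemma tame_weight al : tame al (fun v => 1 + v `^ al).
Proof.
split; first exact: measurable_weight.
by exists 1 => v _; rewrite mul1r ger0_norm// weight_ge0.
Qed.

Lemma tameD al phi psi : tame al phi -> tame al psi ->
  tame al (fun v => phi v + psi v).
Proof.
move=> [m1 [C1 h1]] [m2 [C2 h2]]; split; first exact: measurable_funD.
exists (C1 + C2) => v v0; rewrite (le_trans (ler_normD _ _))// mulrDl.
by rewrite lerD ?h1 ?h2.
Qed.

Lemma tameZ al c phi : tame al phi -> tame al (fun v => c * phi v).
Proof.
move=> [m1 [C1 h1]]; split; first exact: measurable_funM.
exists (`|c| * C1) => v v0; rewrite normrM -mulrA ler_wpM2l//; exact: h1.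
Qed.

Lemma tameN al phi : tame al phi -> tame al (fun v => - phi v).
Proof.
move=> /(tameZ (-1)).
by under eq_fun do rewrite mulN1r.
Qed.

Lemma tameB al phi psi : tame al phi -> tame al psi ->
  tame al (fun v => phi v - psi v).
Proof. by move=> t1 /tameN; exact: tameD. Qed.

Lemma tame_norm al phi : tame al phi -> tame al (fun v => `|phi v|).
Proof.
move=> t; apply: (tame_le _ t); last by move=> v _; rewrite normr_id.
by apply: measurableT_comp => //; exact: tame_measurable t.
Qed.

Lemma tame_bM al phi psi M : tame al phi -> measurable_fun setT psi ->
  (forall v, 0 <= v -> `|psi v| <= M) -> tame al (fun v => psi v * phi v).
Proof.
move=> t1 m h; have M0 : 0 <= M by exact: le_trans (normr_ge0 _) (h _ (lexx 0)).
apply: (tame_le _ (tameZ M t1)).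
  by apply: measurable_funM => //; exact: tame_measurable t1.
by move=> v v0; rewrite !normrM ler_wpM2r// (le_trans (h _ v0))// ger0_norm.
Qed.

Lemma adm_measurable al w : adm al w -> measurable_fun setT w.
Proof. by case. Qed.

Lemma tame_integrable al w phi : adm al w -> tame al phi ->
  mu.-integrable Rp (EFin \o (fun v => phi v * w v)).
Proof.
move=> [mw w0 iw] [mphi [C hC]].
have iw' : mu.-integrable Rp (EFin \o (fun v => C * ((1 + v `^ al) * w v))).
  exact: (@integrableZl _ _ _ _ _ measurable_Rplus C _ iw).
apply: (le_integrable measurable_Rplus _ _ iw').
- by apply/measurable_EFinP; apply: measurable_funTS; exact: measurable_funM.
- move=> v; rewrite RplusE => v0 /=; rewrite lee_fin normrM.
  rewrite (@ger0_norm _ (w v))// mulrA (le_trans _ (ler_norm _))//.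
  by rewrite ler_wpM2r// hC.
Qed.

Lemma eq_pairing phi psi w : (forall v, 0 <= v -> phi v = psi v) ->
  pairing phi w = pairing psi w.
Proof.
move=> h; apply: eq_Rintegral => v /set_mem; rewrite RplusE => v0.
by rewrite h.
Qed.

Section adm_weight.
Context {al : R} {w : R -> R} (aw : adm al w).

Let w0 v : 0 <= w v. Proof. by case: aw. Qed.
Let mR := measurable_Rplus.

Lemma pairingD phi psi : tame al phi -> tame al psi ->
  pairing (fun v => phi v + psi v) w = pairing phi w + pairing psi w.
Proof.
move=> t1 t2; rewrite /pairing -RintegralD//; try exact: (tame_integrable aw).
by apply: eq_Rintegral => v _; rewrite mulrDl.
Qed.

Lemma pairingZ c phi : tame al phi ->
  pairing (fun v => c * phi v) w = c * pairing phi w.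
Proof.
move=> t1; rewrite /pairing -RintegralZl//; last exact: (tame_integrable aw).
by apply: eq_Rintegral => v _; rewrite mulrA.
Qed.

Lemma pairingN phi : tame al phi ->
  pairing (fun v => - phi v) w = - pairing phi w.
Proof.
move=> t1; rewrite -mulN1r -pairingZ//.
by apply: eq_pairing => v _; rewrite mulN1r.
Qed.

Lemma pairingB phi psi : tame al phi -> tame al psi ->
  pairing (fun v => phi v - psi v) w = pairing phi w - pairing psi w.
Proof.
by move=> t1 t2; rewrite (pairingD t1 (tameN t2)) pairingN.
Qed.

Lemma pairing_ge0 phi : (forall v, 0 <= v -> 0 <= phi v) -> 0 <= pairing phi w.
Proof.
move=> h; apply: Rintegral_ge0 => v; rewrite RplusE => v0.
by rewrite mulr_ge0 ?h.
Qed.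

Lemma pairing_le phi psi : tame al phi -> tame al psi ->
  (forall v, 0 <= v -> phi v <= psi v) -> pairing phi w <= pairing psi w.
Proof.
move=> t1 t2 h; apply: le_Rintegral => //; try exact: (tame_integrable aw).
by move=> v; rewrite RplusE => v0; rewrite ler_wpM2r// h.
Qed.

Lemma pairing_norm phi : tame al phi ->
  `|pairing phi w| <= pairing (fun v => `|phi v|) w.
Proof.
move=> t1; apply: (le_trans (le_normr_Rintegral _ _)) => //.
  exact: (tame_integrable aw).
rewrite /pairing le_eqVlt; apply/orP; left; apply/eqP.
by apply: eq_Rintegral => v _; rewrite normrM (ger0_norm (w0 v)).
Qed.

Lemma pairing_norm_le phi psi : tame al phi -> tame al psi ->
  (forall v, 0 <= v -> `|phi v| <= psi v) -> `|pairing phi w| <= pairing psi w.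
Proof.
move=> t1 t2 h; apply: (le_trans (pairing_norm t1)).
by apply: pairing_le => //; exact: tame_norm.
Qed.

Lemma pairing_cst c : pairing (fun=> c) w = c * pairing (fun=> 1) w.
Proof.
rewrite -pairingZ; last exact: tame_cst.
by apply: eq_pairing => v _; rewrite mulr1.
Qed.

Lemma pairing0 : pairing (fun=> 0) w = 0.
Proof. by rewrite pairing_cst mul0r. Qed.

(** Convergence is asked almost everywhere because the approximants used below may fail to converge
    at one point, the endpoint of a ray or the origin. *)
Lemma pairing_dct (F : nat -> R -> R) phi psi :
  (forall n, measurable_fun setT (F n)) -> measurable_fun setT phi ->
  tame al psi -> (forall n v, 0 <= v -> `|F n v| <= psi v) ->
  {ae mu, forall v, 0 <= v -> F n v @[n --> \oo] --> phi v} ->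
  pairing (F n) w @[n --> \oo] --> pairing phi w.
Proof.
move=> mF mphi tpsi dF [N [mN N0 cvF]].
have mw := adm_measurable aw.
case: (@dominated_convergence _ _ R mu Rp measurable_Rplus
  (fun n => EFin \o (fun v => F n v * w v)) (EFin \o (fun v => phi v * w v))
  (EFin \o (fun v => psi v * w v))).
- move=> n; apply/measurable_EFinP; apply: measurable_funTS.
  by apply: measurable_funM => //; exact: mF.
- by apply/measurable_EFinP; apply: measurable_funTS; exact: measurable_funM.
- exists N; split => // v /= nv; apply: cvF => /= v0; apply: nv.
  rewrite RplusE => v1; apply: cvg_EFin; first by near=> n.
  have h := v0 v1; exact: cvgMr_tmp h.
- exact: (tame_integrable aw).
- exists set0; split => //.
  move=> v; apply: contra_notP => _ n; rewrite RplusE => v0 /=.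
  by rewrite lee_fin normrM (ger0_norm (w0 v)) ler_wpM2r// dF.
- move=> ifi _ h; apply: fine_cvg; rewrite /Rintegral fineK//.
  exact: integrable_fin_num.
Unshelve. all: by end_near. Qed.

End adm_weight.

End weights.

(** * Polynomials in exp(-v) *)

Section approximation.
Context {R : realType}.
Local Notation mu := (@lebesgue_measure R).
Implicit Types (al c : R) (w phi psi : R -> R) (P Q : {poly R}).

Lemma bernoulli_ineq (t : R) n : 0 <= t <= 1 -> 1 - n%:R * t <= (1 - t) ^+ n.
Proof.
move=> /andP[t0 t1]; elim: n => [|n IH]; first by rewrite mul0r subr0 expr0.
rewrite exprS; have h : 0 <= 1 - t by rewrite subr_ge0.
apply: le_trans (ler_wpM2l h IH).
rewrite -subr_ge0 -natr1.
rewrite (_ : _ - _ = n%:R * (t * t)); last by ring.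
by rewrite mulr_ge0// mulr_ge0.
Qed.

Definition expoly P (v : R) := P.[expR (- v)].

Lemma expRN_itv (v : R) : 0 <= v -> 0 <= expR (- v) <= 1.
Proof. by move=> v0; rewrite expR_ge0 -expR0 ler_expR oppr_le0. Qed.

Lemma measurable_expoly P : measurable_fun setT (expoly P).
Proof.
apply: continuous_measurable_fun => v; rewrite /expoly.
apply: (@continuous_comp _ _ _ (fun v : R => expR (- v)) (fun x => P.[x])).
  apply: continuous_comp; first exact: opp_continuous.
  exact: continuous_expR.
exact: continuous_horner.
Qed.

Lemma expoly_bounded P : exists M, forall v, 0 <= v -> `|expoly P v| <= M.
Proof.
exists (\sum_(i < size P) `|P`_i|) => v v0.
rewrite /expoly horner_coef (le_trans (ler_norm_sum _ _ _))//.
apply: ler_sum => i _; rewrite normrM ler_piMr// normrX.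
have /andP[e0 e1] := expRN_itv v0.
by rewrite ger0_norm// exprn_ile1.
Qed.

Lemma tame_expoly al P : tame al (expoly P).
Proof.
have [M hM] := expoly_bounded P.
exact: tame_bounded (measurable_expoly P) hM.
Qed.

Lemma expolyXn k (v : R) : expoly ('X^k) v = expR (- (k%:R * v)).
Proof. by rewrite /expoly hornerXn -expRM_natl mulrN. Qed.

(** With t = exp(-kv) and n of order exp(kx), (1 - t)^n is about exp(-exp(k(x - v))), which tends to
    0 for v < x and to 1 for v > x. The exponent n is this integer. *)
Definition ray_deg (x : R) k := (Num.truncn (expR (k%:R * x))).+1.

Definition ray_poly (x : R) k : {poly R} := (1 - 'X^k) ^+ ray_deg x k.

Lemma ray_polyE x k v :
  expoly (ray_poly x k) v = (1 - expR (- (k%:R * v))) ^+ ray_deg x k.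
Proof. by rewrite /expoly hornerE !hornerE -/(expoly _ _) -expolyXn /expoly hornerXn. Qed.

Lemma exp_kv_itv k (v : R) : 0 <= v -> 0 <= expR (- (k%:R * v)) <= 1.
Proof. by move=> v0; apply: expRN_itv; rewrite mulr_ge0. Qed.

Lemma ray_poly_itv x k v : 0 <= v -> 0 <= expoly (ray_poly x k) v <= 1.
Proof.
move=> v0; rewrite ray_polyE; have /andP[t0 t1] := exp_kv_itv k v0.
by rewrite exprn_ge0 ?subr_ge0//= exprn_ile1 ?subr_ge0// lerBlDr lerDl.
Qed.

Lemma ray_poly_cvg x v : 0 <= x -> 0 <= v -> v != x ->
  expoly (ray_poly x k) v @[k --> \oo] --> (\1_(`]x, +oo[%classic) v : R).
Proof.
move=> x0 v0 vx.
(* Both cases converge at the geometric rate r^k; the factor 2 below absorbs the rounding in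
   [ray_deg]. *)
pose r := expR (- `|v - x|).
have r1 : `|r| < 1.
  by rewrite ger0_norm ?expR_ge0// -expR0 ltr_expR oppr_lt0 normr_gt0 subr_eq0.
have cvr : 2 * r ^+ k @[k --> \oo] --> (0 : R).
  by rewrite -(mulr0 2); apply: cvgMl_tmp; exact: cvg_expr.
apply/cvgrPdist_le => e e0.
have /cvgrPdist_le/(_ e e0) := cvr.
apply: filterS => k; rewrite sub0r normrN => /(le_trans (ler_norm _)) hk.
apply: le_trans hk.
have /andP[t0 t1] := exp_kv_itv k v0.
have /andP[p0 p1] := ray_poly_itv x k v0.
move: p0 p1; rewrite ray_polyE.
set t := expR (- (k%:R * v)) in t0 t1 *.
have /andP[Nle' /ltW Ngt] := truncn_itv (expR_ge0 (k%:R * x)).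
have Nle : (ray_deg x k)%:R <= 2 * expR (k%:R * x).
  have e1 : 1 <= expR (k%:R * x) by rewrite -expR0 ler_expR mulr_ge0.
  by rewrite /ray_deg -natr1; lra.
have rk : r ^+ k = expR (- (k%:R * `|v - x|)) by rewrite -expRM_natl mulrN.
have [vltx|xltv|vex] := ltgtP v x; last by rewrite vex eqxx in vx.
- rewrite indicE memNset ?mulr0n; last by rewrite /= in_itv/= andbT; apply/negP; rewrite -leNgt ltW.
  move=> p0 p1; rewrite sub0r normrN ger0_norm// rk.
  (* Left of x: 1 - t <= exp(-t), then n t >= exp(k|v - x|), and finally exp(-u) <= 1/u. *)
  have h1 : (1 - t) ^+ ray_deg x k <= expR (- (t * (ray_deg x k)%:R)).
    rewrite -mulNr mulrC expRM_natl lerXn2r ?nnegrE ?expR_ge0 ?subr_ge0//.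
    exact: expR_ge1Dx.
  apply: (le_trans h1).
  have h2 : expR (k%:R * `|v - x|) <= t * (ray_deg x k)%:R.
    rewrite ltr0_norm ?subr_lt0// opprB mulrBr expRD mulrC ler_wpM2l//.
  have u0 := expR_gt0 (k%:R * `|v - x|).
  rewrite !expRN; apply: (@le_trans _ _ (expR (k%:R * `|v - x|))^-1).
    rewrite lef_pV2 ?posrE ?expR_gt0//; apply: le_trans h2 _.
    by apply: le_trans (expR_ge1Dx _); rewrite lerDr.
  have : 0 <= (expR (k%:R * `|v - x|))^-1 by rewrite invr_ge0 ltW.
  by lra.
- rewrite indicE mem_set /=; last by rewrite in_itv/= andbT.
  move=> p0 p1; rewrite ger0_norm ?subr_ge0// rk.
  (* Right of x: Bernoulli's inequality gives 1 - (1 - t)^n <= n t. *)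
  have := @bernoulli_ineq t (ray_deg x k); rewrite t0 t1 => /(_ isT) h.
  apply: (@le_trans _ _ ((ray_deg x k)%:R * t)); first by lra.
  rewrite gtr0_norm ?subr_gt0// mulrBr opprB expRD mulrA.
  by rewrite ler_wpM2r// expR_ge0.
Qed.

(** The bounds 0 and 1 belong to the notion: they make it stable under unions, which are formed by
    products, and they turn P(exp(-v)) exp(-v) into an admissible test for [smooth_dominated]. *)
Definition approximable al w (A : set R) := forall e, 0 < e -> exists P,
  (forall v, 0 <= v -> 0 <= expoly P v <= 1) /\
  pairing (fun v => `|\1_A v - expoly P v|) w <= e.

Lemma measurable_ind (A : set R) : measurable A ->
  measurable_fun setT (\1_A : R -> R).
Proof. by move=> mA; exact: measurable_indic. Qed.

Lemma ind_itv (A : set R) v : 0 <= (\1_A v : R) <= 1.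
Proof. by rewrite indicE; case: (_ \in _); rewrite ?lexx ?ler01. Qed.

Lemma tame_ind al (A : set R) : measurable A -> tame al (\1_A : R -> R).
Proof.
move=> mA; apply: (@tame_bounded _ _ _ 1); first exact: measurable_ind.
by move=> v _; have /andP[h0 h1] := ind_itv A v; rewrite ger0_norm.
Qed.

Section approximable_sets.
Context {al : R} {w : R -> R} (aw : adm al w).

Lemma tame_dist (A : set R) P : measurable A ->
  tame al (fun v => `|\1_A v - expoly P v|).
Proof.
by move=> mA; apply: tame_norm; apply: tameB; [exact: tame_ind|exact: tame_expoly].
Qed.

Lemma approximable0 : approximable al w set0.
Proof.
move=> e e0; exists 0; split=> [v v0|]; first by rewrite /expoly horner0 lexx ler01.
rewrite (@eq_pairing _ _ (fun=> 0)) ?(pairing0 aw) ?ltW// => v _.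
by rewrite indic0 /expoly horner0 subr0 normr0.
Qed.

Lemma approximableC A : measurable A -> approximable al w A -> approximable al w (~` A).
Proof.
move=> mA hA e e0; have [P [P01 hP]] := hA e e0.
exists (1 - P); split => [v v0|].
  have /andP[h0 h1] := P01 v v0; rewrite /expoly !hornerE -/(expoly P v).
  by rewrite subr_ge0 h1 lerBlDr lerDl.
rewrite (@eq_pairing _ _ (fun v => `|\1_A v - expoly P v|))// => v _.
rewrite /expoly !hornerE -/(expoly P v) -[in RHS]normrN; congr `|_|.
by rewrite !indicE in_setC; case: (_ \in _) => /=; ring.
Qed.

Lemma approximableU A B : measurable A -> measurable B ->
  approximable al w A -> approximable al w B -> approximable al w (A `|` B).
Proof.
move=> mA mB hA hB e e0.
have e20 : 0 < e / 2 by rewrite divr_gt0.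
have [P [P01 hP]] := hA _ e20; have [Q [Q01 hQ]] := hB _ e20.
exists (1 - (1 - P) * (1 - Q)); split => [v v0|].
  have /andP[h0 h1] := P01 v v0; have /andP[k0 k1] := Q01 v v0.
  rewrite /expoly !hornerE -/(expoly P v) -/(expoly Q v).
  by apply/andP; split; nra.
rewrite (splitr e); apply: le_trans (lerD hP hQ).
rewrite -(pairingD aw) //; try exact: tame_dist.
apply: (pairing_le aw).
- by apply: tame_dist; exact: measurableU.
- by apply: tameD; exact: tame_dist.
move=> v v0; have /andP[h0 h1] := P01 v v0; have /andP[k0 k1] := Q01 v v0.
rewrite {1}/expoly !hornerE -/(expoly P v) -/(expoly Q v).
have -> : \1_(A `|` B) v = 1 - (1 - \1_A v) * (1 - \1_B v) :> R.
  by rewrite !indicE in_setU; case: (v \in A); case: (v \in B) => /=; ring.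
have /andP[a0 a1] := ind_itv A v.
set x := expoly P v in h0 h1 *; set y := expoly Q v in k0 k1 *.
(* A telescoped difference of products. The cofactors have absolute value at most 1, so the two
   errors simply add. *)
rewrite (_ : _ - _ = (\1_A v - x) * (1 - y) + (1 - \1_A v) * (\1_B v - y)); last by ring.
rewrite (le_trans (ler_normD _ _))// !normrM lerD//.
  by rewrite ler_piMr// ger0_norm ?subr_ge0// lerBlDr lerDl.
by rewrite ler_piMl// ger0_norm ?subr_ge0// lerBlDr lerDl.
Qed.

Lemma approximable_bigcup (F : nat -> set R) : (forall i, measurable (F i)) ->
  (forall i, approximable al w (F i)) -> approximable al w (\bigcup_i F i).
Proof.
move=> mF hF e e0.
pose G n := \big[setU/set0]_(i < n) F i.
have mG n : measurable (G n) by exact: bigsetU_measurable.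
have hG n : approximable al w (G n).
  elim: n => [|n IH]; first by rewrite /G big_ord0; exact: approximable0.
  by rewrite /G big_ord_recr; apply: approximableU => //; exact: mG.
have mU : measurable (\bigcup_i F i) by exact: bigcup_measurable.
have cv : pairing (fun v => `|\1_(\bigcup_i F i) v - \1_(G n) v|) w @[n --> \oo] --> pairing (fun=> 0) w.
  apply: (@pairing_dct _ _ _ aw _ _ (fun=> 1)).
  - move=> n; apply: measurableT_comp => //.
    by apply: measurable_funB; exact: measurable_ind.
  - exact: measurable_cst.
  - exact: tame_cst.
  - move=> n v _; rewrite normr_id ler_norml.
    by have /andP[? ?] := ind_itv (\bigcup_i F i) v; have /andP[? ?] := ind_itv (G n) v; apply/andP; split; lra.
  - apply: aeW => v _.
    have [[i _ Fi]|nF] := pselect ((\bigcup_i F i) v); last first.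
      rewrite (_ : (fun n => _) = fun=> 0); first exact: cvg_cst.
      apply/funext => n; rewrite !indicE !memNset ?subr0 ?normr0//.
      by apply: contra_not nF; rewrite /G -bigcup_mkord => -[i _ Fi]; exists i.
    apply/cvgrPdist_le => d d0; exists i.+1 => // n /= ni.
    rewrite !indicE !mem_set ?subrr ?normr0 ?subr0 ?normr0 ?ltW//; last by exists i.
    by rewrite /G -bigcup_mkord; exists i.
have e20 : 0 < e / 2 by rewrite divr_gt0.
move/cvgrPdist_le : cv => /(_ _ e20) [n _ /(_ n (leqnn n))] hn.
have [P [P01 hP]] := hG n _ e20.
exists P; split => //; rewrite (splitr e).
rewrite (pairing0 aw) sub0r normrN in hn.
apply: le_trans (lerD (le_trans (ler_norm _) hn) hP).
rewrite -(pairingD aw); last 2 first.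
- by apply: tame_norm; apply: tameB; exact: tame_ind.
- exact: tame_dist.
apply: (pairing_le aw).
- exact: tame_dist.
- by apply: tameD; [apply: tame_norm; apply: tameB; exact: tame_ind|exact: tame_dist].
by move=> v _; rewrite (le_trans _ (ler_normD _ _))// addrA subrK.
Qed.

Lemma approximable_ray x : approximable al w `]x, +oo[.
Proof.
have [x0|x0] := ltP x 0.
  move=> e e0; exists 1; split=> [v v0|]; first by rewrite /expoly hornerE lexx ler01.
  rewrite (@eq_pairing _ _ (fun=> 0)) ?(pairing0 aw) ?ltW// => v v0.
  rewrite /expoly hornerE indicE mem_set ?subrr ?normr0//=.
  by rewrite in_itv/= andbT (lt_le_trans x0).
have cv : pairing (fun v => `|\1_`]x, +oo[%classic v - expoly (ray_poly x n) v|) w @[n --> \oo] --> pairing (fun=> 0) w.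
  apply: (@pairing_dct _ _ _ aw _ _ (fun=> 1)).
  - move=> n; apply: measurableT_comp => //; apply: measurable_funB; last exact: measurable_expoly.
    exact: measurable_ind.
  - exact: measurable_cst.
  - exact: tame_cst.
  - move=> n v v0; rewrite normr_id ler_norml.
    have /andP[? ?] := ind_itv `]x, +oo[%classic v.
    by have /andP[? ?] := ray_poly_itv x n v0; apply/andP; split; lra.
  (* At v = x the polynomials need not tend to the indicator; this point is a null set. *)
  - exists [set x]; split => //; first exact: lebesgue_measure_set1.
    move=> v /=; apply: contra_notP => /eqP vx v0.
    have := ray_poly_cvg x0 v0 vx => /cvgrPdist_le h.
    apply/cvgrPdist_le => d d0; have := h d d0; apply: filterS => n.
    by rewrite sub0r normrN normr_id.
move=> e e0; move/cvgrPdist_le : cv => /(_ _ e0) [n _ /(_ n (leqnn n))].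
rewrite (pairing0 aw) sub0r normrN => hn.
exists (ray_poly x n); split; last exact: le_trans (ler_norm _) hn.
by move=> v; exact: ray_poly_itv.
Qed.

(* Sets whose indicator is an L^1 limit of polynomials in [exp (- v)] with
   values in [0, 1] form a sigma-algebra, which contains the rays. *)
Lemma approx_set (A : set R) : measurable A -> approximable al w A.
Proof.
move=> mA; have : (measurable `&` approximable al w) A; last by case.
have : (RGenOInfty.G (R := R)).-sigma.-measurable A by rewrite -RGenOInfty.measurableE.
apply: smallest_sub => //; last first.
  by move=> _ [x ->]; split; [exact: measurable_itv|exact: approximable_ray].
split.
- by split => //; exact: approximable0.
- move=> B [mB hB]; rewrite setTD; split; first exact: measurableC.
  exact: approximableC.
- move=> F hF; split; first by apply: bigcup_measurable => i _; have [] := hF i.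
  by apply: approximable_bigcup => i; have [] := hF i.
Qed.

End approximable_sets.

End approximation.

(** * Calculus and smooth functions *)

Section calculus.
Context {R : realType}.
Implicit Types (F f phi psi : R -> R) (a b c d e r s t u v x y z C K : R).

Lemma is_derive_derivable f x d : is_derive x 1 f d -> derivable f x 1.
Proof. by case. Qed.

Lemma is_derive_derive1 f x d : is_derive x 1 f d -> derive1 f x = d.
Proof. by move=> h; rewrite derive1E; exact: (@derive_val _ _ _ _ _ _ _ h). Qed.

Lemma derivable_is_derive f x : derivable f x 1 -> is_derive x 1 f (derive1 f x).
Proof. by move=> h; rewrite derive1E; exact/derivableP. Qed.

Lemma is_derive_continuous f x d : is_derive x 1 f d -> {for x, continuous f}.
Proof. by move=> [h _]; apply: differentiable_continuous; exact/derivable1_diffP. Qed.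

(** Linear approximation without division. For each fixed y it is a plain inequality, so it survives
    limits and perturbations of f. *)
Lemma is_derive1P f x d : is_derive x 1 f d <->
  forall e, 0 < e -> exists2 r, 0 < r & forall y, `|y - x| < r ->
    `|f y - f x - (y - x) * d| <= e * `|y - x|.
Proof.
split=> [[df dfE] e e0|h].
  have /cvgrPdist_le/(_ e e0) : h^-1 *: (f (h *: 1 + x) - f x) @[h --> 0^'] --> d.
    by rewrite -dfE; exact: df.
  rewrite near_withinE => /nbhs_ballP[r /= r0 hr].
  exists r => // y yx; have [->|yx0] := eqVneq y x.
    by rewrite !subrr mul0r subr0 normr0 mulr0.
  have yx1 : y - x != 0 by rewrite subr_eq0.
  have /= := hr (y - x); rewrite /ball/= sub0r normrN => /(_ yx yx1).
  rewrite /GRing.scale /= mulr1 subrK => hh.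
  have -> : f y - f x - (y - x) * d = - ((y - x) * (d - (y - x)^-1 * (f y - f x))).
    by rewrite mulrBr mulrA divff// mul1r opprB.
  by rewrite normrN normrM mulrC ler_wpM2r.
have cv : h^-1 *: (f (h *: 1 + x) - f x) @[h --> 0^'] --> d.
  apply/cvgrPdist_le => e e0; have [r r0 hr] := h e e0.
  rewrite near_withinE; apply/nbhs_ballP; exists r => //= k.
  rewrite /ball /= sub0r normrN => kr k0.
  have := hr (k + x); rewrite addrK => /(_ kr).
  have nk : 0 < `|k| by rewrite normr_gt0.
  rewrite /GRing.scale /= mulr1 => hh.
  rewrite -(ler_pM2r nk) -normrM mulrBl mulrAC mulVf// mul1r -normrN opprB (mulrC d).
  exact: hh.
have df : derivable f x 1 by apply/cvg_ex; exists d.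
by split => //; exact: cvg_lim.
Qed.

Lemma MVT_eq f : (forall x, derivable f x 1) -> forall a b,
  exists2 c, Num.min a b <= c <= Num.max a b & f b - f a = derive1 f c * (b - a).
Proof.
move=> df a b; wlog ab : a b / a <= b => [hw|].
  have [ab|ba] : a <= b \/ b <= a by apply/orP; exact: le_total.
    exact: hw.
  have [c hc E] := hw _ _ ba.
  exists c; first by rewrite minC maxC.
  by rewrite -opprB E -mulrN opprB.
have [c cab E] := @MVT_segment R f (derive1 f) a b ab
  (fun x _ => derivable_is_derive (df x))
  (derivable_within_continuous (fun x _ => df x)).
exists c => //; rewrite min_l// max_r//.
Qed.

Lemma between_dist (a b c : R) : Num.min a b <= c <= Num.max a b -> `|c - a| <= `|b - a|.
Proof.
move=> /andP[]; have [ab|/ltW ba] := leP a b => h1 h2.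
  by rewrite !ger0_norm ?subr_ge0// lerD2r.
by rewrite !ler0_norm ?subr_le0// !opprB lerD2l lerN2.
Qed.

(* Two mean value theorems give this remainder, with the constant 1 instead of 1/2. *)
Lemma taylor2 f : (forall x, derivable f x 1) -> (forall x, derivable (derive1 f) x 1) ->
  forall a b, exists c, [/\ Num.min a b <= c <= Num.max a b &
    `|f b - f a - (b - a) * derive1 f a| <= (b - a) ^+ 2 * `|derive1 (derive1 f) c| ].
Proof.
move=> df ddf a b; have [c hc E] := MVT_eq df a b.
have [c' hc' E'] := MVT_eq ddf a c.
have [h1 h2] : `|c - a| <= `|b - a| /\ Num.min a b <= c' <= Num.max a b.
  move: hc hc'; rewrite !minEle !maxEle; case: (lerP a b) => ab.
    move=> /andP[ac cb]; rewrite ac => /andP[? ?]; split; last lra.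
    by rewrite !ger0_norm ?subr_ge0//; lra.
  move=> /andP[bc ca]; case: (lerP a c) => ac /andP[? ?]; (split; last lra).
    by rewrite (_ : c = a) ?subrr ?normr0//; lra.
  by lra.
exists c'; split => //.
have -> : f b - f a - (b - a) * derive1 f a = (b - a) * ((c - a) * derive1 (derive1 f) c').
  by rewrite (mulrC (c - a)) -E' E; ring.
rewrite -[(b - a) ^+ 2]real_normK ?num_real// expr2 !normrM -mulrA.
by rewrite ler_wpM2l// ler_wpM2r.
Qed.

(** Derivatives are asked at positive times only and the initial value is a right limit, as in the
    weak formulation. The integrating factor makes exp(-Cs) y(s) nonincreasing on ]0, t]; then s
    tends to 0. *)
Lemma gronwall (y : R -> R) C y0 t : 0 < t -> (forall s, 0 < s <= t -> derivable y s 1) ->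
  (forall s, 0 < s <= t -> derive1 y s <= C * y s) ->
  y s @[s --> 0^'+] --> y0 -> y t <= expR (C * t) * y0.
Proof.
move=> t0 dy hy cy.
pose z s := expR (- C * s) * y s.
have dz (s : R) : 0 < s <= t -> is_derive s 1 z (expR (- C * s) * (derive1 y s - C * y s)).
  move=> s0; have h1 := derivable_is_derive (dy _ s0).
  apply: is_derive_eq; rewrite /GRing.scale /= ?mulr1; ring.
have zle s s' : 0 < s -> s <= s' -> s' <= t -> z s' <= z s.
  move=> s0 ss' s't.
  have ds x : x \in `]s, s'[ -> is_derive x 1 z (derive1 z x).
    rewrite in_itv/= => /andP[sx xs']; apply: derivable_is_derive.
    by have [|] := dz x; first by rewrite (lt_trans s0 sx) (le_trans (ltW xs')).
  have cs : {within `[s, s'], continuous z}.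
    apply: derivable_within_continuous => x; rewrite in_itv/= => /andP[sx xs'].
    by have [|] := dz x; first by rewrite (lt_le_trans s0 sx) (le_trans xs').
  have [c] := MVT_segment ss' ds cs.
  rewrite in_itv/= => /andP[sc cs'] E.
  have c0t : 0 < c <= t by rewrite (lt_le_trans s0 sc) (le_trans cs').
  rewrite -subr_le0 E mulr_le0_ge0 ?subr_ge0//.
  rewrite (is_derive_derive1 (dz c c0t)).
  by rewrite mulr_ge0_le0 ?expR_ge0// subr_le0 hy.
have cz : z s @[s --> 0^'+] --> y0.
  rewrite -[y0]mul1r; apply: cvgM => //.
  rewrite (_ : 1 = expR (- C * 0)); last by rewrite mulr0 expR0.
  apply: cvg_at_right_filter.
  apply: (@continuous_comp R R R (fun s : R => - C * s) expR);
    [exact: mulrl_continuous|exact: continuous_expR].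
have : z t <= y0.
  apply: (cvgr_to_ge cz); near=> s; apply: zle => //.
  by near: s; exact: nbhs_right_le.
rewrite /z -(ler_pM2l (expR_gt0 (C * t))) mulrA -expRD mulNr subrr expR0 mul1r//.
Unshelve. all: by end_near. Qed.

Unset Implicit Arguments.

Lemma smooth_derivable {phi} : smooth phi -> forall x, derivable phi x 1.
Proof. by move=> h x; exact: (h 0%N x). Qed.

Lemma smooth_derive1 {phi} : smooth phi -> smooth (derive1 phi).
Proof. by move=> h k x; rewrite -derive1Sn; exact: (h k.+1). Qed.

(** Smoothness by coinduction: it suffices to exhibit a class of differentiable functions stable
    under derivation, so formulas for higher derivatives are avoided. *)
Lemma smooth_coind (S : (R -> R) -> Prop) : (forall phi, S phi ->
    (forall x, derivable phi x 1) /\ S (derive1 phi)) ->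
  forall phi, S phi -> smooth phi.
Proof.
move=> hS phi Sphi k; elim: k phi Sphi => [|k IH] phi /hS[d Sd] x; first exact: d.
by rewrite derive1Sn; exact: IH.
Qed.

Lemma smooth_ext {phi} {psi} : phi =1 psi -> smooth phi -> smooth psi.
Proof. by move=> /funext ->. Qed.

Lemma smooth_continuous {phi} : smooth phi -> continuous phi.
Proof.
by move=> h x; have := is_derive_continuous (derivable_is_derive (smooth_derivable h x)).
Qed.

Lemma smooth_measurable {phi} : smooth phi -> measurable_fun setT phi.
Proof. by move=> h; apply: continuous_measurable_fun; exact: smooth_continuous. Qed.

(** By the Leibniz rule, the derivative of a product is a sum of two products, so finite sums have
    to be included to obtain a class fit for [smooth_coind]. *)
Inductive sum_of_products : (R -> R) -> Prop :=
| Sprod phi psi : smooth phi -> smooth psi -> sum_of_products (fun x => phi x * psi x)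
| Ssum phi psi : sum_of_products phi -> sum_of_products psi ->
    sum_of_products (fun x => phi x + psi x).

Lemma is_deriveM1 {phi psi x a b} : is_derive x 1 phi a -> is_derive x 1 psi b ->
  is_derive x 1 (fun x => phi x * psi x) (a * psi x + phi x * b).
Proof.
by move=> h1 h2; apply: is_derive_eq; rewrite /GRing.scale /=; ring.
Qed.

Lemma is_deriveD1 {phi psi x a b} : is_derive x 1 phi a -> is_derive x 1 psi b ->
  is_derive x 1 (fun x => phi x + psi x) (a + b).
Proof. by move=> h1 h2; exact: is_deriveD. Qed.

Lemma sum_of_products_smooth {phi} : sum_of_products phi -> smooth phi.
Proof.
apply: smooth_coind => {}phi; elim => {phi}.
  move=> phi psi h1 h2.
  have h x := is_deriveM1 (derivable_is_derive (smooth_derivable h1 x))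
    (derivable_is_derive (smooth_derivable h2 x)).
  split; first by move=> x; exact: is_derive_derivable (h x).
  rewrite (_ : derive1 _ = fun x => derive1 phi x * psi x + phi x * derive1 psi x).
    exact: (Ssum _ _ (Sprod _ _ (smooth_derive1 h1) h2) (Sprod _ _ h1 (smooth_derive1 h2))).
  by apply/funext => x; rewrite (is_derive_derive1 (h x)).
move=> phi psi _ [d1 S1] _ [d2 S2].
have h x := is_deriveD1 (derivable_is_derive (d1 x)) (derivable_is_derive (d2 x)).
split; first by move=> x; exact: is_derive_derivable (h x).
rewrite (_ : derive1 _ = fun x => derive1 phi x + derive1 psi x); first exact: (Ssum _ _ S1 S2).
by apply/funext => x; rewrite (is_derive_derive1 (h x)).
Qed.

Lemma smoothM {phi} {psi} : smooth phi -> smooth psi -> smooth (fun x => phi x * psi x).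
Proof. by move=> h1 h2; apply: sum_of_products_smooth; exact: (Sprod _ _ h1 h2). Qed.

Lemma smooth_cst c : smooth (fun=> c).
Proof.
apply: (@smooth_coind (fun f => exists c, f = fun=> c)); last by exists c.
move=> _ [{}c ->]; split; first by move=> x; exact: derivable_cst.
by exists 0; apply/funext => x; rewrite derive1_cst.
Qed.

Lemma smoothZ c {phi} : smooth phi -> smooth (fun x => c * phi x).
Proof. by move=> h; exact: smoothM (smooth_cst c) h. Qed.

Lemma smoothD {phi} {psi} : smooth phi -> smooth psi -> smooth (fun x => phi x + psi x).
Proof.
move=> h1 h2; apply: sum_of_products_smooth.
have -> : (fun x => phi x + psi x) = fun x => 1 * phi x + 1 * psi x.
  by apply/funext => x; rewrite !mul1r.
exact: (Ssum _ _ (Sprod _ _ (smooth_cst 1) h1) (Sprod _ _ (smooth_cst 1) h2)).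
Qed.

Lemma smoothN {phi} : smooth phi -> smooth (fun x => - phi x).
Proof.
by move=> /(smoothZ (-1)); apply: smooth_ext => x; rewrite mulN1r.
Qed.

Lemma smoothB {phi} {psi} : smooth phi -> smooth psi -> smooth (fun x => phi x - psi x).
Proof. by move=> h1 /smoothN; exact: smoothD. Qed.

Lemma smooth_id : smooth (@idfun R).
Proof.
move=> [|k] x; first exact: derivable_id.
rewrite derive1Sn (_ : derive1 _ = fun=> 1 : R); first exact: smooth_cst.
by apply/funext => y; rewrite derive1_id.
Qed.

Lemma smoothX n : smooth (fun x => x ^+ n).
Proof.
elim: n => [|n IH]; first by apply: (smooth_ext _ (smooth_cst 1)) => x; rewrite expr0.
apply: (smooth_ext _ (smoothM smooth_id IH)) => x.
by rewrite exprS.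
Qed.

Lemma is_derive_affine {phi a b x d} : is_derive (a * x + b) 1 phi d ->
  is_derive x 1 (fun x => phi (a * x + b)) (a * d).
Proof.
move=> h; have h2 : is_derive x 1 (fun x => a * x + b) a.
  by apply: is_derive_eq; rewrite /GRing.scale /= mulr1 addr0.
have := @is_derive1_comp R phi (fun x => a * x + b) x d a h h2.
by rewrite mulrC.
Qed.

Lemma smooth_affine {phi} a b : smooth phi -> smooth (fun x => phi (a * x + b)).
Proof.
move=> h.
apply: (@smooth_coind (fun f => exists c psi, smooth psi /\
    f = fun x => c * psi (a * x + b))); last first.
  by exists 1, phi; split => //; apply/funext => x; rewrite mul1r.
move=> _ [c [psi [spsi ->]]].
have hd x : is_derive x 1 (fun x => c * psi (a * x + b)) (c * a * derive1 psi (a * x + b)).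
  have h1 := is_derive_affine (derivable_is_derive (smooth_derivable spsi (a * x + b))).
  by have := is_deriveZ c h1; rewrite /GRing.scale /= mulrA.
split; first by move=> x; exact: is_derive_derivable (hd x).
exists (c * a), (derive1 psi); split; first exact: smooth_derive1.
by apply/funext => x; rewrite (is_derive_derive1 (hd x)).
Qed.

Lemma smooth_scale {phi} a : smooth phi -> smooth (fun x => phi (a * x)).
Proof.
by move=> /(smooth_affine a 0); apply: smooth_ext => x; rewrite addr0.
Qed.

Lemma is_derive_expRM c x : is_derive x 1 (fun x => expR (c * x)) (c * expR (c * x)).
Proof.
have := @is_derive_affine expR c 0 x (expR (c * x + 0)) (is_derive_expR _).
by under eq_fun do rewrite addr0; rewrite addr0.
Qed.

Lemma smooth_expRM c : smooth (fun x => expR (c * x)).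
Proof.
apply: smooth_scale; apply: (@smooth_coind (fun f => f = expR)) => // _ ->.
split; first by move=> x; exact: is_derive_derivable (is_derive_expR x).
by apply/funext => x; rewrite (is_derive_derive1 (is_derive_expR x)).
Qed.

Lemma smooth_sum {n} (F : 'I_n -> R -> R) : (forall i, smooth (F i)) ->
  smooth (fun x => \sum_i F i x).
Proof.
move=> hF; elim: n F hF => [|n IH] F hF.
  by apply: (smooth_ext _ (smooth_cst 0)) => x; rewrite big_ord0.
apply: (smooth_ext _ (smoothD (IH (fun i => F (widen_ord (leqnSn n) i)) _) (hF ord_max))) => // x.
by rewrite big_ord_recr.
Qed.

(* Products [phi * u^a] with [phi] smooth are stable under derivation. *)
Lemma smooth_powR (u : R -> R) b : smooth u -> (forall x, 0 < u x) ->
  smooth (fun x => u x `^ b).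
Proof.
move=> su u0.
have dp x a : is_derive x 1 (fun x => u x `^ a) (a * u x `^ (a - 1) * derive1 u x).
  have h1 := derivable_is_derive (smooth_derivable su x).
  have h2 := is_derive1_powR a (u0 x).
  have h3 := @is_derive1_comp R (fun y => y `^ a) u x _ _ h2 h1.
  exact: h3.
apply: (@smooth_coind (fun f => exists phi a, smooth phi /\
  f = fun x => phi x * u x `^ a)); last first.
  exists (fun=> 1), b; split; first exact: smooth_cst.
  by apply/funext => x; rewrite mul1r.
move=> _ [phi [a [sphi ->]]].
have hd x := is_deriveM1 (derivable_is_derive (smooth_derivable sphi x)) (dp x a).
split; first by move=> x; exact: is_derive_derivable (hd x).
exists (fun x => derive1 phi x * u x + a * (phi x * derive1 u x)), (a - 1); split.
  apply: smoothD; first exact: smoothM (smooth_derive1 sphi) su.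
  exact: smoothZ (smoothM sphi (smooth_derive1 su)).
apply/funext => x; rewrite (is_derive_derive1 (hd x)).
have -> : u x `^ a = u x * u x `^ (a - 1).
  rewrite -{2}[u x]powRr1 ?ltW// -powRD; first by rewrite addrC subrK.
  by rewrite (gt_eqF (u0 x)) implybT.
set U := _ `^ _; set V := derive1 u x; set W := derive1 phi x.
by ring.
Qed.

End calculus.
Set Implicit Arguments.

(** * Densities and changes of variables *)

Section scaling.
Context {R : realType}.
Local Notation mu := (@lebesgue_measure R).
Local Notation Rp := (@Rplus R).

(** The measure is given by an existential because the structure on [pushforward] depends on a
    measurability proof; later lemmas see only the two equations. *)
Lemma pushforward_affine (a b : R) : exists2 PM : {measure set (measurableTypeR R) -> \bar R},
  forall A, PM A = mu ((fun v : R => a * v + b) @^-1` A) &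
  forall (D : set R) (G : R -> R), measurable (D : set (measurableTypeR R)) ->
    measurable_fun setT G -> (forall u, 0 <= G u) ->
    (\int[PM]_(u in D) (G u)%:E =
     \int[mu]_(v in (fun v : R => (a * v + b)%R) @^-1` D) (G (a * v + b))%:E)%E.
Proof.
have mT : measurable_fun setT ((fun v : R => a * v + b) : measurableTypeR R -> measurableTypeR R).
  by apply: measurable_funD => //; exact: measurable_funM.
pose T : measurableTypeR R -> measurableTypeR R := fun v => a * v + b.
have [PM PME] : exists PM : {measure set (measurableTypeR R) -> \bar R},
    forall A, PM A = pushforward mu T A.
  by unshelve (eexists; move=> A; reflexivity); exact: mT.
exists PM; first by move=> A; rewrite PME.
move=> D G mD mG G0.
have -> : (\int[PM]_(u in D) (G u)%:E = \int[pushforward mu T]_(u in D) (G u)%:E)%E.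
  by apply: eq_measure_integral => A _ _.
rewrite ge0_integral_pushforward//; last by move=> y _; rewrite lee_fin.
by apply/measurable_EFinP; exact: measurable_funTS.
Qed.

(** The right-hand side is a measure that gives half-open intervals their length, and this
    determines Lebesgue measure. *)
Lemma lebesgue_measure_affine (a b : R) (A : set R) : 0 < a -> measurable A ->
  mu A = (a%:E * mu ((fun v : R => a * v + b)%R @^-1` A))%E.
Proof.
move=> a0 mA; have [PM PME _] := pushforward_affine a b.
rewrite -PME -[RHS]/(mscale (NngNum (ltW a0)) PM A).
apply: lebesgue_measure_unique mA => _ [[x y]] _ <-.
rewrite /= /mscale /= PME.
have -> : (fun v : R => a * v + b) @^-1` `]x, y]%classic = `](x - b) / a, (y - b) / a]%classic.
  apply/seteqP; split => v /=; rewrite !in_itv/= ltr_pdivrMr// ler_pdivlMr// (mulrC v).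
    by move=> /andP[? ?]; apply/andP; split; lra.
  by move=> /andP[? ?]; apply/andP; split; lra.
rewrite !lebesgue_measure_itv /= !lte_fin ltr_pM2r ?invr_gt0// ltrD2r.
case: ifP => _; last by rewrite mule0.
rewrite -!EFinB -EFinM; congr EFin.
by field; rewrite gt_eqF.
Qed.

Lemma ge0_integral_affine (a b : R) (G : R -> R) : 0 < a -> measurable_fun setT G ->
  (forall u, 0 <= G u) ->
  (\int[mu]_(v in Rp) (a * G (a * v + b))%:E = \int[mu]_(u in `[b, +oo[) (G u)%:E)%E.
Proof.
move=> a0 mG G0; have [PM PME PMi] := pushforward_affine a b.
pose m := mscale (NngNum (ltW a0)) PM.
rewrite (@eq_measure_integral _ _ _ _ m mu (EFin \o G)); last first.
  move=> A mA _; rewrite -[RHS]/(a%:E * PM A)%E PME.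
  exact: (lebesgue_measure_affine b a0 mA).
rewrite ge0_integral_mscale//=; last 2 first.
- by apply/measurable_EFinP; exact: measurable_funTS.
- by move=> x _; rewrite lee_fin.
rewrite PMi//.
have -> : (fun v : R => a * v + b) @^-1` `[b, +oo[%classic = Rp.
  by apply/seteqP; split => v /=; rewrite in_itv/= andbT RplusE -lerBlDr subrr pmulr_rge0.
under eq_integral do rewrite EFinM.
rewrite ge0_integralZl//.
- exact: measurable_Rplus.
- apply/measurable_EFinP; apply: measurable_funTS.
  apply: measurableT_comp => //; apply: measurable_funD => //; exact: measurable_funM.
- by move=> v _; rewrite lee_fin.
- by rewrite lee_fin ltW.
Qed.

Lemma pairing_scale (c : R) (phi f : R -> R) : 0 < c ->
  measurable_fun setT phi -> measurable_fun setT f ->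
  pairing phi (fun v => c * f (c * v)) = pairing (fun v => phi (c^-1 * v)) f.
Proof.
move=> c0 mphi mf; rewrite /pairing /Rintegral; congr fine.
pose H u := phi (c^-1 * u) * f u.
have mH : measurable_fun setT H.
  by apply: measurable_funM => //; apply: measurableT_comp => //; exact: measurable_funM.
have e1 v : phi v * (c * f (c * v)) = c * H (c * v).
  by rewrite /H mulKf ?gt_eqF// mulrCA.
under eq_integral do rewrite e1.
(* Positive and negative parts are transformed separately, so the identity is available before
   anything is known about the integrability of phi f. *)
rewrite [LHS]integralE [RHS]integralE; congr (_ - _)%E.
- transitivity (\int[mu]_(v in Rp) (c * (H^\+ (c * v + 0)))%:E)%E.
    apply: eq_integral => v _; rewrite addr0 funeposE /funrpos/=.
    by rewrite -EFin_max maxr_pMr ?ltW// mulr0.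
  rewrite ge0_integral_affine//; first by apply: eq_integral => v _; rewrite funeposE -EFin_max.
  exact: measurable_funrpos.
- transitivity (\int[mu]_(v in Rp) (c * (H^\- (c * v + 0)))%:E)%E.
    apply: eq_integral => v _; rewrite addr0 funenegE /funrneg/=.
    by rewrite -EFin_max maxr_pMr ?ltW// mulr0 mulrN.
  rewrite ge0_integral_affine//; first by apply: eq_integral => v _; rewrite funenegE -EFinN -EFin_max.
  exact: measurable_funrneg.
Qed.

End scaling.

Section densities.
Context {R : realType}.
Local Notation mu := (@lebesgue_measure R).
Local Notation Rp := (@Rplus R).
Implicit Types (al c : R) (f phi psi : R -> R).

Definition dens al f := [/\ adm al f, forall v, v < 0 -> f v = 0 &
  pairing (fun=> 1) f = 1].

Lemma density_in_M_dens al f : density_in_M al f <-> dens al f.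
Proof.
split=> [[[mf f0 fN f1] fal]|[[mf f0 fi] fN f1]].
- split => //; last first.
    by rewrite /pairing /Rintegral; under eq_integral do rewrite mul1r; rewrite f1.
  split => //.
  have mpf : measurable_fun setT (fun v => v `^ al * f v).
    by apply: measurable_funM => //; exact: measurable_powR.
  apply/integrableP; split.
    apply/measurable_EFinP; apply: measurable_funTS; apply: measurable_funM => //.
    exact: measurable_weight.
  under eq_integral => v _.
    rewrite /= ger0_norm ?mulr_ge0 ?weight_ge0// mulrDl mul1r EFinD; over.
  rewrite ge0_integralD//.
  + by rewrite f1 lte_add_pinfty// ltry.
  + exact: measurable_Rplus.
  + by move=> v _; rewrite lee_fin.
  + by apply/measurable_EFinP; exact: measurable_funTS.
  + by move=> v _; rewrite lee_fin mulr_ge0 ?powR_ge0.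
  + by apply/measurable_EFinP; exact: measurable_funTS.
- have i1 : mu.-integrable Rp (EFin \o f).
    have := tame_integrable (And3 mf f0 fi) (tame_cst al 1).
    by apply: eq_integrable; [exact: measurable_Rplus|move=> v _ /=; rewrite mul1r].
  split.
    split => //; move: f1; rewrite /pairing /Rintegral.
    under eq_integral do rewrite mul1r.
    by move=> h; rewrite -[LHS]fineK ?h//; apply: integrable_fin_num => //; exact: measurable_Rplus.
  have tp : tame al (fun v => v `^ al).
    split; first exact: measurable_powR.
    by exists 1 => v _; rewrite mul1r ger0_norm ?powR_ge0// lerDr.
  have := tame_integrable (And3 mf f0 fi) tp => /integrableP[_].
  by under eq_integral do rewrite /= ger0_norm ?mulr_ge0 ?powR_ge0//.
Qed.

Lemma dens_adm al f : dens al f -> adm al f.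
Proof. by case. Qed.

Lemma dens_ge0 al f : dens al f -> forall v, 0 <= f v.
Proof. by case=> -[]. Qed.

Lemma dens_neg al f : dens al f -> forall v, v < 0 -> f v = 0.
Proof. by case. Qed.

Lemma dens_measurable al f : dens al f -> measurable_fun setT f.
Proof. by case=> -[]. Qed.

Lemma dens1 al f : dens al f -> pairing (fun=> 1) f = 1.
Proof. by case. Qed.

Lemma dens_cst al f c : dens al f -> pairing (fun=> c) f = c.
Proof. by move=> df; rewrite (pairing_cst (dens_adm df)) (dens1 df) mulr1. Qed.

Lemma integral_densT (f H : R -> R) : (forall v, v < 0 -> f v = 0) ->
  (\int[mu]_(v in Rp) (H v * f v)%:E = \int[mu]_v (H v * f v)%:E)%E.
Proof.
move=> fN; rewrite integral_mkcond; apply: eq_integral => v _.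
rewrite /patch; case: ifPn => //; rewrite notin_setE RplusE => /negP.
by rewrite -ltNge => /fN ->; rewrite mulr0.
Qed.

Lemma pairing_densT al f phi : dens al f ->
  pairing phi f = \int[mu]_v (phi v * f v).
Proof.
by move=> df; have fN := dens_neg df; rewrite /pairing /Rintegral integral_densT.
Qed.

Lemma scale_dens al c f : 0 < c -> dens al f -> dens al (fun v => c * f (c * v)).
Proof.
move=> c0 df; have mf := dens_measurable df; have f0 := dens_ge0 df.
have mcf : measurable_fun setT (fun v => c * f (c * v)).
  by apply: measurable_funM => //; apply: measurableT_comp => //; exact: measurable_funM.
split.
- split => //; first by move=> v; rewrite mulr_ge0// ltW.
  pose G u := (1 + (c^-1 * u) `^ al) * f u.
  have mW : measurable_fun setT (fun u : R => 1 + (c^-1 * u) `^ al).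
    apply: measurable_funD => //.
    apply: (@measurableT_comp _ _ _ _ _ _ (fun x : R => x `^ al)); first exact: measurable_powR.
    exact: measurable_funM.
  have mG : measurable_fun setT G by exact: measurable_funM.
  apply/integrableP; split.
    apply/measurable_EFinP; apply: measurable_funTS; apply: measurable_funM => //.
    exact: measurable_weight.
  rewrite (_ : (\int[mu]_(v in Rp) _)%E = (\int[mu]_(v in Rp) (c * G (c * v + 0))%:E)%E); last first.
    apply: eq_integral => v _; rewrite /= ger0_norm; last first.
      by rewrite !mulr_ge0 ?weight_ge0// ltW.
    by rewrite addr0 /G mulKf ?gt_eqF// mulrCA.
  rewrite ge0_integral_affine//; last by move=> u; rewrite mulr_ge0 ?weight_ge0.
  have tW : tame al (fun u : R => 1 + (c^-1 * u) `^ al).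
    split => //; exists (1 + c^-1 `^ al) => v v0.
    rewrite ger0_norm ?weight_ge0// powRM ?invr_ge0 ?(ltW c0)//.
    by have := powR_ge0 v al; have := powR_ge0 c^-1 al; nra.
  have /integrableP[_] := tame_integrable (dens_adm df) tW.
  apply: le_lt_trans; apply: ge0_le_integral => //.
  + by move=> v _; rewrite lee_fin mulr_ge0 ?weight_ge0.
  + by apply/measurable_EFinP; exact: measurable_funTS.
  + by apply: measurableT_comp => //; apply/measurable_EFinP; exact: measurable_funTS.
  + by move=> v _; rewrite lee_fin ler_norm.
- by move=> v v0; rewrite (dens_neg df) ?mulr0// pmulr_rlt0.
- rewrite pairing_scale//; exact: dens1 df.
Qed.

End densities.

(** * Integrals over pairs of variables and Fubini's theorem *)

Section double_pairing.
Context {R : realType}.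
Local Notation mu := (@lebesgue_measure R).
Local Notation Rp := (@Rplus R).
Implicit Types (al c : R) (f phi psi : R -> R) (Phi Psi : R -> R -> R).

Definition tame2 al Phi :=
  measurable_fun setT (fun z : measurableTypeR R * measurableTypeR R => Phi z.1 z.2) /\
  exists C, forall v w, 0 <= v -> 0 <= w -> `|Phi v w| <= C * ((1 + v `^ al) * (1 + w `^ al)).

Lemma tame2_swap al Phi : tame2 al Phi -> tame2 al (fun v w => Phi w v).
Proof.
move=> [mP [C hC]]; split; last first.
  by exists C => v w v0 w0; rewrite (mulrC (1 + v `^ al)); exact: hC.
have := measurableT_comp mP (measurable_fun_pair (@measurable_snd _ _ (measurableTypeR R) (measurableTypeR R)) measurable_fst).
by [].
Qed.

Lemma tame2_section al Phi v : tame2 al Phi -> 0 <= v -> tame al (Phi v).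
Proof.
move=> [mP [C hC]] v0; split.
  have := measurableT_comp mP (measurable_fun_pair (@measurable_cst _ _ (measurableTypeR R) (measurableTypeR R) setT v) (@measurable_id _ (measurableTypeR R) _)).
  by [].
by exists (C * (1 + v `^ al)) => w w0; rewrite -mulrA hC.
Qed.

Lemma tame2D al Phi Psi : tame2 al Phi -> tame2 al Psi ->
  tame2 al (fun v w => Phi v w + Psi v w).
Proof.
move=> [m1 [C1 h1]] [m2 [C2 h2]]; split; first exact: measurable_funD.
exists (C1 + C2) => v w v0 w0; rewrite (le_trans (ler_normD _ _))// mulrDl.
by rewrite lerD ?h1 ?h2.
Qed.

Lemma tame2M al phi psi : tame al phi -> tame al psi ->
  tame2 al (fun v w => phi v * psi w).
Proof.
move=> [m1 [C1 h1]] [m2 [C2 h2]]; split.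
  by apply: measurable_funM; apply: measurableT_comp.
exists (C1 * C2) => v w v0 w0; rewrite normrM mulrACA.
by apply: ler_pM => //; [exact: h1|exact: h2].
Qed.

Section density.
Context {al : R} {f : R -> R} (df : dens al f).

Let f0 := dens_ge0 df.
Let fN := dens_neg df.
Let mf := dens_measurable df.

Lemma measurable_pairing Phi :
  measurable_fun setT (fun z : measurableTypeR R * measurableTypeR R => Phi z.1 z.2) ->
  measurable_fun setT (fun v => pairing (Phi v) f).
Proof.
move=> mP.
pose F (z : measurableTypeR R * measurableTypeR R) := (Phi z.1 z.2 * f z.2)%:E.
have mF : measurable_fun setT F.
  apply/measurable_EFinP; apply: measurable_funM => //.
  exact: measurableT_comp.
have -> : (fun v => pairing (Phi v) f) =
  fun v => fine (\int[mu]_w (F^\+)%E (v, w) - \int[mu]_w (F^\-)%E (v, w))%E.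
  apply/funext => v; rewrite (pairing_densT _ df) /Rintegral integralE; congr fine.
  by congr (_ - _)%E; apply: eq_integral => w _; rewrite ?funeposE ?funenegE.
apply: (@measurableT_comp _ _ _ _ _ _ fine).
  exact: fine_measurable.
apply: emeasurable_funB.
- apply: (@measurable_fun_fubini_tonelli_F _ _ (measurableTypeR R) (measurableTypeR R) R mu).
    exact: measurable_funepos.
  by move=> x; exact: funepos_ge0.
- apply: (@measurable_fun_fubini_tonelli_F _ _ (measurableTypeR R) (measurableTypeR R) R mu).
    exact: measurable_funeneg.
  by move=> x; exact: funeneg_ge0.
Qed.

Lemma tame_pairing Phi : tame2 al Phi -> tame al (fun v => pairing (Phi v) f).
Proof.
move=> tP; have [mP [C hC]] := tP; split; first exact: measurable_pairing.
exists (C * pairing (fun w => 1 + w `^ al) f) => v v0.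
rewrite mulrAC -(pairingZ (dens_adm df)); last exact: tame_weight.
apply: (pairing_norm_le (dens_adm df)).
- exact: tame2_section.
- by apply: tameZ; exact: tame_weight.
- by move=> w w0; rewrite -mulrA hC.
Qed.

Lemma integrable_pair Phi : tame2 al Phi ->
  (mu \x mu)%E.-integrable setT
    (fun z : measurableTypeR R * measurableTypeR R => (f z.1 * f z.2 * Phi z.1 z.2)%:E).
Proof.
move=> tP; have [mP [C hC]] := tP.
have mff : measurable_fun setT (fun z : measurableTypeR R * measurableTypeR R => f z.1 * f z.2 * Phi z.1 z.2).
  by apply: measurable_funM => //; apply: measurable_funM; exact: measurableT_comp.
apply/integrable12ltyP; first exact/measurable_EFinP.
apply: (@le_lt_trans _ _ (\int[mu]_v (`|C| * pairing (fun w => 1 + w `^ al) f * (1 + v `^ al) * f v)%:E)%E).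
  apply: ge0_le_integral => //.
  - by move=> v _; exact: integral_ge0.
  - apply: (@measurable_fun_fubini_tonelli_F _ _ (measurableTypeR R) (measurableTypeR R) R mu (fun z => `|(f z.1 * f z.2 * Phi z.1 z.2)%:E|%E)) => //.
    by apply: measurableT_comp => //; exact/measurable_EFinP.
  - apply/measurable_EFinP; apply: measurable_funM => //; apply: measurable_funM => //.
    exact: measurable_weight.
  - move=> v _; have [v0|v0] := ltP v 0.
      rewrite (fN v0) mulr0 integral0_eq// => w _.
      by rewrite !mul0r abse0.
    apply: (@le_trans _ _ (\int[mu]_w (`|C| * (1 + v `^ al) * f v * (1 + w `^ al) * f w)%:E)%E).
      apply: ge0_le_integral => //.
      + apply: measurableT_comp => //; apply/measurable_EFinP.
        have mPv := tame_measurable (tame2_section tP v0).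
        by apply: (measurable_funM (measurable_funM (measurable_cst (f v)) mf) mPv).
      + apply/measurable_EFinP; apply: measurable_funM => //; apply: measurable_funM => //.
        exact: measurable_weight.
      + move=> w _; rewrite lee_fin /=; have [w0|w0] := ltP w 0.
          by rewrite (fN w0) mulr0 mul0r normr0 mulr0.
        rewrite normrM (ger0_norm (mulr_ge0 (f0 v) (f0 w))).
        have h := le_trans (hC _ _ v0 w0) (ler_wpM2r (mulr_ge0 (weight_ge0 al v) (weight_ge0 al w)) (ler_norm C)).
        apply: le_trans (ler_wpM2l (mulr_ge0 (f0 v) (f0 w)) h) _.
        by rewrite le_eqVlt; apply/orP; left; apply/eqP; ring.
    rewrite -integral_densT//.
    have t : tame al (fun w => `|C| * (1 + v `^ al) * f v * (1 + w `^ al)).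
      by apply: tameZ; exact: tame_weight.
    rewrite -[X in (X <= _)%E]fineK; last first.
      apply: integrable_fin_num; first exact: measurable_Rplus.
      exact: (tame_integrable (dens_adm df) t).
    rewrite -/(Rintegral _ _ _) -/(pairing _ _) lee_fin (pairingZ (dens_adm df)); last exact: tame_weight.
    by rewrite le_eqVlt; apply/orP; left; apply/eqP; ring.
rewrite -integral_densT//.
have t : tame al (fun v => `|C| * pairing (fun w => 1 + w `^ al) f * (1 + v `^ al)).
  by apply: tameZ; exact: tame_weight.
have := integrable_fin_num measurable_Rplus (tame_integrable (dens_adm df) t).
by rewrite fin_numE => /andP[_ h]; rewrite ltey.
Qed.

Lemma integral_pair12 Phi : tame2 al Phi ->
  \int[(mu \x mu)%E]_z (f z.1 * f z.2 * Phi z.1 z.2) =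
  pairing (fun v => pairing (Phi v) f) f.
Proof.
move=> tP; rewrite {1}/Rintegral -(integral12_prod_meas1 (integrable_pair tP)).
rewrite (pairing_densT _ df); congr fine; apply: eq_integral => v _.
rewrite /fubini_F /=.
have [v0|v0] := ltP v 0.
  by rewrite (fN v0) mulr0 integral0_eq// => w _; rewrite !mul0r.
have tv := tame2_section tP v0.
transitivity (\int[mu]_w (f v * Phi v w * f w)%:E)%E.
  by apply: eq_integral => w _; congr EFin; ring.
rewrite -integral_densT// -[LHS]fineK; last first.
  apply: integrable_fin_num; first exact: measurable_Rplus.
  exact: (tame_integrable (dens_adm df) (tameZ _ tv)).
rewrite -/(Rintegral _ _ _) -/(pairing _ _) (pairingZ (dens_adm df))//.
by rewrite mulrC.
Qed.

(** This order is the useful one: for fixed w the gain term is an affine substitution in v, so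
    bounds in one variable apply to the inner pairing. *)
Lemma integral_pair21 Phi : tame2 al Phi ->
  \int[(mu \x mu)%E]_z (f z.1 * f z.2 * Phi z.1 z.2) =
  pairing (fun w => pairing (fun v => Phi v w) f) f.
Proof.
move=> tP; rewrite -(integral_pair12 (tame2_swap tP)).
rewrite {1}/Rintegral -(integral21_prod_meas1 (integrable_pair tP)).
rewrite {1}/Rintegral -(integral12_prod_meas1 (integrable_pair (tame2_swap tP))).
congr fine; apply: eq_integral => v _; apply: eq_integral => w _ /=.
by congr EFin; ring.
Qed.

Lemma collision_pair p q phi : collision p q phi f =
  \int[(mu \x mu)%E]_z (f z.1 * f z.2 * (phi (p * z.1 + q * z.2) - phi z.1)).
Proof.
rewrite /collision /Rintegral integral_mkcond; congr fine.
apply: eq_integral => z _; rewrite /patch; case: ifPn => //.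
rewrite notin_setE /= => /not_andP[|]; rewrite RplusE => /negP; rewrite -ltNge => /fN ->.
  by rewrite !mul0r.
by rewrite mulr0 mul0r.
Qed.

End density.

End double_pairing.

Section exponential_weights.
Context {R : realType}.
Local Notation mu := (@lebesgue_measure R).
Local Notation Rp := (@Rplus R).
Implicit Types (al c : R) (w phi psi : R -> R).

(** Put u = cv/a. Then u <= exp(u), and raising to the power a gives (cv/a)^a <= exp(cv). *)
Lemma powR_le_expR (a c v : R) : 0 < a -> 0 < c -> 0 <= v ->
  v `^ a <= (a / c) `^ a * expR (c * v).
Proof.
move=> a0 c0 v0.
have -> : v = (a / c) * (c * v / a) by field; rewrite !gt_eqF.
rewrite powRM ?divr_ge0 ?mulr_ge0 ?(ltW a0) ?(ltW c0)//.
rewrite ler_wpM2l ?powR_ge0//.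
rewrite (_ : c * (a / c * (c * v / a)) = (c * v / a) * a); last by field; rewrite !gt_eqF.
rewrite expRM; apply: ge0_ler_powR; rewrite ?(ltW a0)// ?nnegrE ?expR_ge0 ?divr_ge0 ?mulr_ge0 ?(ltW a0) ?(ltW c0)//.
by apply: le_trans (expR_ge1Dx _); rewrite lerDr.
Qed.

Lemma integrable_expRN c : 0 < c -> mu.-integrable Rp (EFin \o (fun v => expR (- (c * v)))).
Proof.
move=> c0.
have := integrableZl measurable_Rplus c^-1 (integrableS measurableT measurable_Rplus (@subsetT _ _) (integrable_exponential_pdf c0)).
apply: eq_integrable; first exact: measurable_Rplus.
move=> v /set_mem; rewrite RplusE => v0 /=.
by rewrite exponential_pdfE// -EFinM mulKf ?gt_eqF// mulNr.
Qed.

Lemma adm_expRN al c : 0 < al -> 0 < c -> adm al (fun v => expR (- (c * v))).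
Proof.
move=> al0 c0.
have me : measurable_fun setT (fun v : R => expR (- (c * v))).
  by apply: measurableT_comp => //; apply: measurableT_comp => //; exact: measurable_funM.
split; [exact: me|by move=> v; exact: expR_ge0|].
have c20 : 0 < c / 2 by rewrite divr_gt0.
have h := integrableZl measurable_Rplus (1 + (al / (c / 2)) `^ al) (integrable_expRN c20).
apply: (le_integrable measurable_Rplus _ _ h).
  apply/measurable_EFinP; apply: measurable_funTS; apply: measurable_funM => //.
  exact: measurable_weight.
move=> v; rewrite RplusE => v0 /=; rewrite lee_fin.
rewrite !ger0_norm ?mulr_ge0 ?weight_ge0 ?expR_ge0 ?addr_ge0 ?powR_ge0//.
(* Half of the exponent absorbs the weight, the other half stays integrable. *)
rewrite (_ : - (c * v) = - (c / 2 * v) + - (c / 2 * v)); last by field.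
rewrite expRD mulrA ler_wpM2r ?expR_ge0//.
have e1 : expR (c / 2 * v) * expR (- (c / 2 * v)) = 1 by rewrite -expRD subrr expR0.
have e2 : 1 <= expR (c / 2 * v).
  by rewrite -[leLHS]expR0 ler_expR mulr_ge0 ?(ltW c20).
have := powR_le_expR al0 c20 v0.
have e0 := expR_ge0 (- (c / 2 * v)).
set K := (al / _) `^ al => hK.
have h2 : 1 + v `^ al <= (1 + K) * expR (c / 2 * v) by lra.
by apply: le_trans (ler_wpM2r e0 h2) _; rewrite -[leLHS]mulrA e1 mulr1.
Qed.

Lemma adm_add al w1 w2 : adm al w1 -> adm al w2 -> adm al (fun v => w1 v + w2 v).
Proof.
move=> [m1 p1 i1] [m2 p2 i2]; split.
- exact: measurable_funD.
- by move=> v; rewrite addr_ge0.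
- have := integrableD measurable_Rplus i1 i2; apply: eq_integrable => //.
    exact: measurable_Rplus.
  by move=> v _ /=; rewrite mulrDr EFinD.
Qed.

Lemma adm_scale al c w : 0 <= c -> adm al w -> adm al (fun v => c * w v).
Proof.
move=> c0 [m1 p1 i1]; split.
- exact: measurable_funM.
- by move=> v; rewrite mulr_ge0.
- have := integrableZl measurable_Rplus c i1; apply: eq_integrable => //.
    exact: measurable_Rplus.
  by move=> v _ /=; rewrite -EFinM mulrCA.
Qed.

Lemma pairing_weightD al w1 w2 phi : adm al w1 -> adm al w2 -> tame al phi ->
  pairing phi (fun v => w1 v + w2 v) = pairing phi w1 + pairing phi w2.
Proof.
move=> a1 a2 t; rewrite /pairing -RintegralD//; first by apply: eq_Rintegral => v _; rewrite mulrDr.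
- exact: measurable_Rplus.
- exact: (tame_integrable a1 t).
- exact: (tame_integrable a2 t).
Qed.

Lemma pairing_weightZ al c w phi : adm al w -> tame al phi ->
  pairing phi (fun v => c * w v) = c * pairing phi w.
Proof.
move=> a1 t; rewrite -(pairingZ a1 c t).
by apply: eq_Rintegral => v _; rewrite mulrCA mulrA.
Qed.

Lemma pairing_fin_num al w phi : adm al w -> tame al phi ->
  (\int[mu]_(v in Rp) (phi v * w v)%:E = (pairing phi w)%:E)%E.
Proof.
move=> a t; rewrite /pairing /Rintegral fineK//.
by apply: integrable_fin_num; [exact: measurable_Rplus|exact: (tame_integrable a t)].
Qed.

End exponential_weights.

Section tame_functions.
Context {R : realType}.
Implicit Types (al c p q : R) (f phi psi : R -> R).

Lemma tame_growth al phi : tame al phi -> growth_le al phi.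
Proof. by move=> [_ [C hC]]; exists C => v v0; apply: hC; exact: ltW. Qed.

(** Replacing v and w by their maximum avoids convexity, so every al >= 0 is covered. *)
Lemma powR_affine_le al p q (v w : R) : 0 <= al -> 0 <= p -> 0 <= q -> 0 <= v -> 0 <= w ->
  (p * v + q * w) `^ al <= (p + q) `^ al * (v `^ al + w `^ al).
Proof.
move=> al0 p0 q0 v0 w0.
apply: (@le_trans _ _ (((p + q) * Num.max v w) `^ al)).
  apply: ge0_ler_powR; rewrite ?nnegrE ?addr_ge0 ?mulr_ge0 ?le_max ?v0//.
    by rewrite addr_ge0.
  by rewrite mulrDl lerD// ler_wpM2l// le_max lexx ?orbT.
rewrite powRM ?addr_ge0 ?le_max ?v0// ler_wpM2l ?powR_ge0//.
have := powR_ge0 v al; have := powR_ge0 w al.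
by rewrite maxEle; case: ifP => _ *; lra.
Qed.

Lemma tame2_affine al p q phi : 0 <= al -> 0 <= p -> 0 <= q -> tame al phi ->
  tame2 al (fun v w => phi (p * v + q * w)).
Proof.
move=> al0 p0 q0 tphi; have [C C0 hC] := tame_bound tphi; split.
  apply: (@measurableT_comp _ _ _ _ _ _ phi); first exact: tame_measurable tphi.
  by apply: measurable_funD; apply: measurable_funM => //; exact: measurable_fst || exact: measurable_snd.
exists (C * (1 + (p + q) `^ al)) => v w v0 w0.
have h0 : 0 <= p * v + q * w by rewrite addr_ge0// mulr_ge0.
apply: le_trans (hC _ h0) _; rewrite -mulrA ler_wpM2l//.
have := powR_affine_le al0 p0 q0 v0 w0.
have := powR_ge0 v al; have := powR_ge0 w al; have := powR_ge0 (p + q) al.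
set a := v `^ al; set b := w `^ al; set c := (p + q) `^ al => c0 b0 a0 h.
apply: (@le_trans _ _ (1 + c * (a + b))); first by rewrite lerD2l.
have ab0 : 0 <= a * b by rewrite mulr_ge0.
have ca : 0 <= c * (1 + a * b) by rewrite mulr_ge0 ?addr_ge0.
nra.
Qed.

Lemma tame_id al : 1 <= al -> tame al (@idfun R).
Proof.
move=> al1; split; first exact: measurable_id.
exists 1 => v v0; rewrite mul1r ger0_norm//.
have [v1|v1] := leP v 1; first by rewrite (le_trans v1)// weight_ge1.
apply: (@le_trans _ _ (v `^ al)); last by rewrite lerDr.
by rewrite -{1}(powRr1 v0) ler_powR// ltW.
Qed.

Lemma tame_scale al c phi : 0 <= al -> 0 <= c -> tame al phi -> tame al (fun v => phi (c * v)).
Proof.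
move=> al0 c0 tphi.
have := tame2_section (tame2_swap (tame2_affine al0 c0 (lexx 0) tphi)) (lexx 0).
by congr (tame al _); apply/funext => v; rewrite mulr0 addr0.
Qed.

Lemma tame_shift al p q (w : R) phi : 0 <= al -> 0 <= p -> 0 <= q -> 0 <= w -> tame al phi ->
  tame al (fun v => phi (p * v + q * w)).
Proof.
move=> al0 p0 q0 w0 tphi.
exact: (tame2_section (tame2_swap (tame2_affine al0 p0 q0 tphi)) w0).
Qed.

End tame_functions.

(** * The Boltzmann equation *)

Section boltzmann.
Context {R : realType}.
Local Notation mu := (@lebesgue_measure R).
Local Notation Rp := (@Rplus R).
Context {p q al : R} {f0 : R -> R} {f : R -> R -> R}.
Hypotheses (q_gt0 : 0 < q) (p_gt0 : 0 < p) (al_ge1 : 1 <= al).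
Hypothesis df0 : dens al f0.
Hypothesis sol : boltzmann_weak_solution p q al f0 f.
Implicit Types (phi : R -> R) (t s : R).

Let p0 := ltW p_gt0.
Let q0 := ltW q_gt0.
Let al0 : 0 <= al. Proof. exact: le_trans al_ge1. Qed.

Lemma sol_dens t : 0 < t -> dens al (f t).
Proof. by move=> t0; apply/density_in_M_dens; case: sol => + _ _ _; exact. Qed.

Lemma collisionE t phi : 0 < t -> tame al phi ->
  collision p q phi (f t) =
  pairing (fun w => pairing (fun v => phi (p * v + q * w) - phi v) (f t)) (f t).
Proof.
move=> t0 tphi; rewrite (collision_pair (sol_dens t0)).
rewrite (integral_pair21 (sol_dens t0) (Phi := fun v w => phi (p * v + q * w) - phi v))//.
apply: tame2D; first exact: tame2_affine.
have := tame2M (tameN tphi) (tame_cst al 1).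
by under eq_fun do under eq_fun do rewrite mulr1.
Qed.

Lemma collisionB t phi : 0 < t -> tame al phi ->
  collision p q phi (f t) =
  pairing (fun w => pairing (fun v => phi (p * v + q * w)) (f t)) (f t) - pairing phi (f t).
Proof.
move=> t0 tphi; rewrite collisionE//; have d := sol_dens t0.
rewrite -[X in _ = _ - X](dens_cst (pairing phi (f t)) d) -(pairingB (dens_adm d)).
- apply: eq_pairing => w w0; rewrite -(pairingB (dens_adm d))//.
  exact: tame_shift.
- exact: (tame_pairing d (tame2_swap (tame2_affine al0 p0 q0 tphi))).
- exact: tame_cst.
Qed.

Lemma sol_derive phi t : smooth phi -> tame al phi -> 0 < t ->
  is_derive t 1 (fun t => pairing phi (f t)) (collision p q phi (f t)).
Proof.
by move=> sphi tphi t0; case: sol => _ _ + _; apply => //; exact: tame_growth.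
Qed.

Lemma sol_cvg0 phi : smooth phi -> tame al phi ->
  pairing phi (f t) @[t --> 0^'+] --> pairing phi f0.
Proof.
by move=> sphi tphi; case: sol => _ _ _; apply => //; exact: tame_growth.
Qed.

Lemma sol_mean t : 0 < t -> mean (f t) = expR ((p + q - 1) * t) * mean f0.
Proof.
move=> t0.
have tid := tame_id al_ge1.
have hd s : 0 < s -> is_derive s 1 (fun t => pairing idfun (f t)) ((p + q - 1) * pairing idfun (f s)).
  move=> s0; have := sol_derive (@smooth_id R) tid s0; rewrite collisionB//.
  have d := sol_dens s0; have a := dens_adm d.
  set m := pairing idfun (f s).
  have -> : pairing (fun w => pairing (fun v => p * v + q * w) (f s)) (f s) = p * m + q * m.
    transitivity (pairing (fun w => p * m + q * w) (f s)).
      apply: eq_pairing => w w0; rewrite (pairingD a); last 2 first.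
      - exact: (tameZ p tid).
      - exact: tame_cst.
      by rewrite (pairingZ a p tid) (dens_cst (q * w) d).
    rewrite (pairingD a); last 2 first.
    - exact: tame_cst.
    - exact: (tameZ q tid).
    by rewrite (pairingZ a q tid) (dens_cst (p * m) d).
  by rewrite (_ : p * m + q * m - m = (p + q - 1) * m); last ring.
have hcv := sol_cvg0 (@smooth_id R) tid.
(* The equation m' = (p + q - 1) m is solved by Gronwall's lemma applied to m and to -m. *)
apply/eqP; rewrite eq_le; apply/andP; split.
  apply: (gronwall (y := fun t => pairing idfun (f t))) => // s /andP[s0 _].
    exact: is_derive_derivable (hd s s0).
  by rewrite (is_derive_derive1 (hd s s0)).
rewrite -lerN2 -mulrN.
apply: (gronwall (y := fun t => - pairing idfun (f t))) => //; last exact: cvgN.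
  by move=> s /andP[s0 _]; exact: is_derive_derivable (is_deriveN (hd s s0)).
by move=> s /andP[s0 _]; rewrite (is_derive_derive1 (is_deriveN (hd s s0))) mulrN.
Qed.

(* Only smooth phi are allowed, because these are the test functions of the
   Boltzmann equation. *)
Definition smooth_dominated (g : R -> R) K y := forall phi c, smooth phi ->
  (forall v, 0 <= v -> 0 <= phi v <= 1) ->
  (\int[mu]_(v in Rp) (phi v)%:E <= c%:E)%E -> pairing phi g <= K * c + y.

Lemma tame_01 phi : smooth phi -> (forall v, 0 <= v -> 0 <= phi v <= 1) -> tame al phi.
Proof.
move=> sphi h; apply: (@tame_bounded _ _ _ 1); first exact: smooth_measurable.
by move=> v v0; have /andP[h1 h2] := h _ v0; rewrite ger0_norm.
Qed.

Lemma integral_shift_le phi (w c : R) : smooth phi ->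
  (forall v, 0 <= v -> 0 <= phi v <= 1) -> 0 <= w ->
  (\int[mu]_(v in Rp) (phi v)%:E <= c%:E)%E ->
  (\int[mu]_(v in Rp) (phi (p * v + q * w))%:E <= (c / p)%:E)%E.
Proof.
move=> sphi h w0 hc.
have mphi := smooth_measurable sphi.
(* The substitution rule asks for a function nonnegative on the whole line, while phi is known to be
   nonnegative on R_+ only; there |phi| = phi. *)
have mn : measurable_fun setT (fun v => `|phi v|) by exact: measurableT_comp.
have := ge0_integral_affine (q * w) p_gt0 mn (fun u => normr_ge0 _).
rewrite (_ : (\int[mu]_(v in Rp) _)%E = (p%:E * \int[mu]_(v in Rp) (phi (p * v + q * w))%:E)%E); last first.
  rewrite -ge0_integralZl//.
  - apply: eq_integral => v /set_mem; rewrite RplusE => v0; rewrite -EFinM ger0_norm//.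
    by have /andP[] := h (p * v + q * w) (addr_ge0 (mulr_ge0 p0 v0) (mulr_ge0 q0 w0)).
  - exact: measurable_Rplus.
  - apply/measurable_EFinP; apply: measurable_funTS.
    by apply: (smooth_measurable (smooth_affine p (q * w) sphi)).
  - move=> v; rewrite RplusE => v0; rewrite lee_fin.
    by have /andP[] := h (p * v + q * w) (addr_ge0 (mulr_ge0 p0 v0) (mulr_ge0 q0 w0)).
move=> E.
rewrite -(lee_pmul2l (x := p%:E)) ?lte_fin//.
rewrite E -EFinM (_ : p * (c / p) = c); last by rewrite mulrC divfK ?gt_eqF.
apply: le_trans hc.
rewrite (_ : (\int[mu]_(v in Rp) (phi v)%:E = \int[mu]_(v in Rp) (`|phi v|)%:E)%E); last first.
  apply: eq_integral => v /set_mem; rewrite RplusE => v0.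
  by have /andP[h1 _] := h _ v0; rewrite ger0_norm.
apply: ge0_subset_integral => //.
- exact: measurable_Rplus.
- by apply/measurable_EFinP; exact: measurable_funTS.
- by move=> v /=; rewrite in_itv/= andbT RplusE => /(le_trans _) -> //; rewrite mulr_ge0.
Qed.

(** The gain term is an average over w of pairings with phi(p v + q w), whose Lebesgue integral is
    at most c/p. It is therefore bounded by K_s/p + Y with K_s = K c exp((1/p - 1)s). The rate 1/p -
    1 is the one for which this bound and the loss term give z' <= -z, where z is the pairing of phi
    with f_s minus K_s + Y. So z decays like exp(-s), and an assumed Y improves to a weighted mean
    of y and Y. *)
Lemma sol_dominated_step K y T Y : 0 <= K -> y <= Y -> smooth_dominated f0 K y ->
  (forall t, 0 < t <= T -> smooth_dominated (f t) (K * expR ((p^-1 - 1) * t)) Y) ->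
  forall t, 0 < t <= T -> smooth_dominated (f t) (K * expR ((p^-1 - 1) * t))
    (y + (1 - expR (- T)) * (Y - y)).
Proof.
move=> K0 yY hf0 hY t /andP[t0 tT] phi c sphi phi01 hc.
have tphi := tame_01 sphi phi01.
pose Kt s := K * expR ((p^-1 - 1) * s) * c.
pose z s := pairing phi (f s) - (Kt s + Y).
have dK s : is_derive s 1 Kt ((p^-1 - 1) * Kt s).
  rewrite /Kt (_ : (fun s => _) = fun s => (K * c) * expR ((p^-1 - 1) * s)); last first.
    by apply/funext => x; rewrite mulrAC.
  rewrite (_ : _ * (K * _ * c) = (K * c) *: ((p^-1 - 1) * expR ((p^-1 - 1) * s))).
    exact: is_deriveZ (is_derive_expRM _ _).
  by rewrite /GRing.scale /=; ring.
have dz s : 0 < s -> is_derive s 1 z (collision p q phi (f s) - ((p^-1 - 1) * Kt s + 0)).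
  by move=> s0; apply: is_deriveB; exact: sol_derive.
have hz : z t <= expR ((-1) * t) * (pairing phi f0 - (K * c + Y)).
  apply: (gronwall (y := z)) => // [s /andP[s0 st]|s /andP[s0 st]|].
  - exact: is_derive_derivable (dz s s0).
  - rewrite (is_derive_derive1 (dz s s0)) collisionB// /z.
    have d := sol_dens s0.
    suff : pairing (fun w => pairing (fun v => phi (p * v + q * w)) (f s)) (f s) <= Kt s / p + Y by lra.
    rewrite -(dens_cst (Kt s / p + Y) d); apply: (pairing_le (dens_adm d)).
    + exact: (tame_pairing d (tame2_swap (tame2_affine al0 p0 q0 tphi))).
    + exact: tame_cst.
    + move=> w w0; have sT : 0 < s <= T by rewrite s0 (le_trans st).
      rewrite /Kt -mulrA; apply: (hY s sT).
      * exact: smooth_affine.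
      * by move=> v v0; apply: phi01; rewrite addr_ge0// mulr_ge0.
      * exact: integral_shift_le.
  - apply: cvgB; first exact: sol_cvg0.
    apply: cvgD; last exact: cvg_cst.
    rewrite (_ : K * c = Kt 0); last by rewrite /Kt mulr0 expR0 mulr1.
    apply: cvg_at_right_filter.
    exact: (is_derive_continuous (dK 0)).
have := hf0 phi c sphi phi01 hc.
rewrite /z mulN1r in hz => h0.
have e1 : expR (- T) <= expR (- t) by rewrite ler_expR lerN2.
have e2 := expR_gt0 (- t).
suff : expR (- t) * (pairing phi f0 - (K * c + Y)) <= expR (- T) * (y - Y).
  by rewrite -/(Kt t); lra.
apply: (@le_trans _ _ (expR (- t) * (y - Y))); first by rewrite ler_wpM2l ?(ltW e2)//; lra.
by rewrite ler_wnM2r// subr_le0.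
Qed.

(** Iterates the previous step from the trivial bound 1 on the pairing: the excess over y starts at
    1 and is multiplied by r = 1 - exp(-t) each time. *)
Lemma sol_dominated K y t : 0 <= K -> smooth_dominated f0 K y -> 0 < t ->
  smooth_dominated (f t) (K * expR ((p^-1 - 1) * t)) y.
Proof.
move=> K0 hf0 t0.
(* The zero test with c = 0 gives this. *)
have y0 : 0 <= y.
  have := hf0 (fun=> 0) 0 (smooth_cst 0) (fun _ _ => _).
  rewrite lexx ler01 mulr0 add0r (pairing0 (dens_adm df0)); apply => //.
  by rewrite integral0.
pose r := 1 - expR (- t).
have r1 : `|r| < 1.
  have e0 := expR_gt0 (- t); have e1 : expR (- t) < 1 by rewrite -expR0 ltr_expR oppr_lt0.
  by rewrite ger0_norm /r; lra.
have hk k : forall s, 0 < s <= t ->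
    smooth_dominated (f s) (K * expR ((p^-1 - 1) * s)) (y + r ^+ k).
  elim: k => [|k IH] s /andP[s0 st].
    move=> phi c sphi phi01 hc.
    have c0 : 0 <= c.
      rewrite -lee_fin; apply: le_trans hc; apply: integral_ge0 => v; rewrite RplusE => v0.
      by have /andP[] := phi01 _ v0.
    have : pairing phi (f s) <= pairing (fun=> 1) (f s).
      apply: (pairing_le (dens_adm (sol_dens s0))).
      - exact: tame_01.
      - exact: tame_cst.
      - by move=> v v0; have /andP[] := phi01 _ v0.
    rewrite (dens1 (sol_dens s0)) expr0 => h.
    have : 0 <= K * expR ((p^-1 - 1) * s) * c by rewrite !mulr_ge0 ?expR_ge0.
    by lra.
  have r0 : 0 <= r by rewrite subr_ge0 -expR0 ler_expR oppr_le0 ltW.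
  have := @sol_dominated_step K y t (y + r ^+ k) K0 _ hf0 IH s.
  rewrite lerDl exprn_ge0// s0 st (addrC y (r ^+ k)) addrK exprS.
  by apply.
move=> phi c sphi phi01 hc.
have cv : K * expR ((p^-1 - 1) * t) * c + (y + r ^+ k) @[k --> \oo] -->
    K * expR ((p^-1 - 1) * t) * c + (y + 0).
  by apply: cvgD; [exact: cvg_cst|apply: cvgD; [exact: cvg_cst|exact: cvg_expr]].
rewrite -[y in leRHS]addr0; apply: (cvgr_to_ge cv).
by apply: nearW => k; apply: hk => //; rewrite t0 lexx.
Qed.

End boltzmann.

(** * Differentiation up to a quadratic error *)

Section perturbation.
Context {R : realType}.
Implicit Types (F G B e rho : R -> R) (t s d C : R).

Lemma is_derive_near F G t d : (\forall s \near t, F s = G s) ->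
  is_derive t 1 G d -> is_derive t 1 F d.
Proof.
move=> /nbhs_ballP[r /= r0 hr] /is_derive1P hG; apply/is_derive1P => e e0.
have [r' r'0 hr'] := hG e e0.
exists (Num.min r r'); first by rewrite lt_min r0.
move=> y; rewrite lt_min => /andP[h1 h2]; rewrite !hr.
- exact: hr'.
- exact: ballxx.
- by rewrite /ball /= distrC.
Qed.

(** Product rule at a zero of rho, where continuity of e is enough. It serves for test functions
    dilated by a factor that depends on time: rho is the relative change of the factor, and e is a
    pairing with the moving solution. *)
Lemma is_derive_perturb B rho e t d C : is_derive t 1 rho d -> rho t = 0 ->
  {for t, continuous e} ->
  (\forall s \near t, `|B s - rho s * e s| <= C * rho s ^+ 2) ->
  is_derive t 1 B (d * e t).
Proof.
move=> /is_derive1P hrho rt0 ce hB.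
have B0 : B t = 0.
  have := nbhs_singleton hB; rewrite rt0 mul0r subr0 expr0n mulr0 => h.
  by move: h; rewrite normr_le0 => /eqP.
pose L := `|d| + 1; pose C' := `|C| + 1; pose E := `|e t| + 1.
have L0 : 0 < L by rewrite /L ltr_pwDr.
have C0 : 0 < C' by rewrite /C' ltr_pwDr.
have E0 : 0 < E by rewrite /E ltr_pwDr.
apply/is_derive1P => eps eps0.
have e3 : 0 < eps / 3 by rewrite divr_gt0.
have [r1 r10 h1] := hrho _ (divr_gt0 e3 E0).
have [r2 r20 h2] := hrho 1 ltr01.
have /cvgrPdist_le/(_ _ (divr_gt0 e3 L0))/nbhs_ballP[r3 /= r30 h3] := ce.
have /nbhs_ballP[r4 /= r40 h4] := hB.
pose r5 := eps / 3 / (C' * L ^+ 2).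
have r50 : 0 < r5 by rewrite !divr_gt0// mulr_gt0// exprn_gt0.
exists (Num.min r1 (Num.min r2 (Num.min r3 (Num.min r4 r5)))).
  by rewrite !lt_min r10 r20 r30 r40.
move=> s; rewrite !lt_min => /and5P[s1 s2 s3 s4 s5].
have sb r : `|s - t| < r -> ball t r s by rewrite /ball /= distrC.
have k1 := h1 _ s1; have k2 := h2 _ s2; have k3 := h3 _ (sb _ s3); have k4 := h4 _ (sb _ s4).
rewrite rt0 subr0 in k1 k2; rewrite B0 subr0.
set x := s - t in k1 k2 s1 s2 s3 s4 s5 *.
have rhoL : `|rho s| <= L * `|x|.
  rewrite /L mulrDl -normrM mulrC; have := ler_normD (rho s - x * d) (x * d).
  by rewrite subrK; lra.
(* Quadratic error, variation of e, and linearization error of rho; each is at most (eps/3)|x|. *)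
have -> : B s - x * (d * e t) = (B s - rho s * e s) + rho s * (e s - e t) + e t * (rho s - x * d).
  by ring.
apply: (le_trans (ler_normD _ _)); apply: (@le_trans _ _ (eps / 3 * `|x| + eps / 3 * `|x| + eps / 3 * `|x|)); last by lra.
apply: lerD; first apply: (le_trans (ler_normD _ _)); first apply: lerD.
- apply: (le_trans k4); rewrite -real_normK ?num_real//.
  apply: (@le_trans _ _ (C' * (L * `|x|) ^+ 2)).
    have CC' : C <= C' by rewrite /C'; have := ler_norm C; lra.
    apply: le_trans (ler_wpM2r (sqr_ge0 _) CC') _; rewrite ler_wpM2l ?(ltW C0)//.
    by rewrite lerXn2r ?nnegrE ?mulr_ge0 ?(ltW L0).
  have s5' : `|x| * (C' * L ^+ 2) <= eps / 3.
    by rewrite -ler_pdivlMr ?mulr_gt0 ?exprn_gt0// ltW.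
  rewrite (_ : C' * _ = `|x| * (C' * L ^+ 2) * `|x|); last by ring.
  by rewrite ler_wpM2r.
- rewrite normrM distrC; apply: le_trans (ler_pM _ _ rhoL k3) _ => //.
  by rewrite mulrAC [L * _]mulrC divfK ?gt_eqF.
- rewrite normrM; apply: (@le_trans _ _ (E * (eps / 3 / E * `|x|))).
    by apply: ler_pM => //; rewrite /E lerDl.
  by rewrite mulrA [E * _]mulrC divfK ?gt_eqF.
Qed.

End perturbation.

(** * Expansions under dilation *)

Section dilations.
Context {R : realType}.
Implicit Types (phi : R -> R) (al a x : R).

(** The functions whose dilations x -> phi(a x) expand to second order in a - 1 with a remainder of
    growth x^al. The factors v and v^2 make the conditions invariant under dilation. *)
Definition test2 al phi := [/\ smooth phi, tame al phi,
  tame al (fun v => v * derive1 phi v) &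
  tame al (fun v => v ^+ 2 * derive1 (derive1 phi) v)].

Lemma dilation_between (a x c : R) : 2^-1 <= a <= 2 -> 0 <= x ->
  Num.min x (a * x) <= c <= Num.max x (a * x) -> x <= 2 * c /\ c <= 2 * x.
Proof.
move=> /andP[a1 a2] x0; have h1 : 2^-1 * x <= a * x by rewrite ler_wpM2r.
have h2 : a * x <= 2 * x by rewrite ler_wpM2r.
rewrite ge_min le_max => /andP[/orP[] ? /orP[] ?]; split; lra.
Qed.

Lemma dilation1 al phi : 0 <= al -> test2 al phi -> exists2 C, 0 <= C &
  forall a x, 2^-1 <= a <= 2 -> 0 <= x ->
    `|phi (a * x) - phi x| <= C * `|a - 1| * (1 + x `^ al).
Proof.
move=> al0 [sphi _ t1 _]; have [C C0 hC] := tame_bound t1.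
have k0 := powR_ge0 (2 : R) al.
(* At the intermediate point c, 2 comes from x <= 2c and 1 + 2^al from c <= 2x. *)
exists (2 * C * (1 + 2 `^ al)); first by rewrite !mulr_ge0// addr_ge0.
move=> a x a2 x0; have [c hc ->] := MVT_eq (smooth_derivable sphi) x (a * x).
have [xc cx] := dilation_between a2 x0 hc.
have c0 : 0 <= c by lra.
rewrite (_ : a * x - x = (a - 1) * x); last by ring.
rewrite !normrM (ger0_norm x0).
rewrite (_ : `|derive1 phi c| * _ = `|a - 1| * (x * `|derive1 phi c|)); last by ring.
have -> : 2 * C * (1 + 2 `^ al) * `|a - 1| * (1 + x `^ al) =
  `|a - 1| * (2 * C * ((1 + 2 `^ al) * (1 + x `^ al))) by ring.
rewrite ler_wpM2l//; apply: (@le_trans _ _ (2 * (C * (1 + c `^ al)))).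
  apply: (@le_trans _ _ (2 * (c * `|derive1 phi c|))).
    by rewrite mulrA ler_wpM2r.
  by rewrite ler_wpM2l//; have := hC c c0; rewrite normrM (ger0_norm c0).
rewrite -!mulrA ler_wpM2l// ler_wpM2l//.
have := powR_ge0 x al; have : c `^ al <= 2 `^ al * x `^ al.
  by rewrite -powRM//; apply: ge0_ler_powR; rewrite ?nnegrE ?mulr_ge0.
by nra.
Qed.

Lemma dilation2 al phi : 0 <= al -> test2 al phi -> exists2 C, 0 <= C &
  forall a x, 2^-1 <= a <= 2 -> 0 <= x ->
    `|phi (a * x) - phi x - (a - 1) * (x * derive1 phi x)| <= C * (a - 1) ^+ 2 * (1 + x `^ al).
Proof.
move=> al0 [sphi _ _ t2]; have [C C0 hC] := tame_bound t2.
have k0 := powR_ge0 (2 : R) al.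
exists (4 * C * (1 + 2 `^ al)); first by rewrite !mulr_ge0// addr_ge0.
move=> a x a2 x0.
have [c [hc]] := taylor2 (smooth_derivable sphi) (smooth_derivable (smooth_derive1 sphi)) x (a * x).
have [xc cx] := dilation_between a2 x0 hc.
have c0 : 0 <= c by lra.
rewrite (_ : a * x - x = (a - 1) * x); last by ring.
rewrite mulrA => /le_trans; apply; rewrite exprMn.
have -> : 4 * C * (1 + 2 `^ al) * (a - 1) ^+ 2 * (1 + x `^ al) =
  (a - 1) ^+ 2 * (4 * (C * ((1 + 2 `^ al) * (1 + x `^ al)))) by ring.
rewrite -mulrA ler_wpM2l ?sqr_ge0//; apply: (@le_trans _ _ (4 * (C * (1 + c `^ al)))).
  apply: (@le_trans _ _ (4 * (c ^+ 2 * `|derive1 (derive1 phi) c|))).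
    by rewrite mulrA ler_wpM2r//; nra.
  rewrite ler_wpM2l//; have := hC c c0; rewrite normrM (ger0_norm (sqr_ge0 _)) //.
rewrite ler_wpM2l// ler_wpM2l//.
have := powR_ge0 x al; have : c `^ al <= 2 `^ al * x `^ al.
  by rewrite -powRM//; apply: ge0_ler_powR; rewrite ?nnegrE ?mulr_ge0.
by nra.
Qed.

(** The weight v^al may fail to be smooth at 0 and then is no test function; (1 + v^2)^(al/2)
    replaces it when moments of the solution are followed in time. *)
Lemma smooth_weight_dominating al : 0 <= al -> exists2 W : R -> R, smooth W /\ tame al W &
  forall v, 0 <= v -> 1 + v `^ al <= W v.
Proof.
move=> al0; pose u v : R := 1 + v ^+ 2.
have u0 v : 0 < u v by rewrite /u ltr_pwDl ?sqr_ge0.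
have su : smooth u by apply: smoothD; [exact: smooth_cst|exact: (smoothX 2)].
have sU := smooth_powR u (al / 2) su u0.
have e1 v : 0 <= v -> v `^ al = (v ^+ 2) `^ (al / 2).
  move=> v0; rewrite -powR_mulrn// -powRrM; congr (_ `^ _); by field.
have a20 : 0 <= al / 2 by rewrite divr_ge0.
exists (fun v => 1 + u v `^ (al / 2)); last first.
  move=> v v0; rewrite lerD2l e1//; apply: ge0_ler_powR; rewrite ?nnegrE ?sqr_ge0 ?(ltW (u0 v))//.
  by rewrite lerDr.
have sW : smooth (fun v => 1 + u v `^ (al / 2)) := smoothD (smooth_cst 1) sU.
split => //; split; first exact: smooth_measurable.
exists (1 + 2 `^ (al / 2)) => v v0.
rewrite ger0_norm ?addr_ge0 ?powR_ge0//.
have : u v `^ (al / 2) <= 2 `^ (al / 2) * (1 + v `^ al).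
  have [v1|v1] := leP v 1.
    apply: (@le_trans _ _ (2 `^ (al / 2))).
      apply: ge0_ler_powR; rewrite ?nnegrE ?(ltW (u0 v))//.
      by rewrite /u; nra.
    by rewrite ler_peMr ?powR_ge0// lerDl powR_ge0.
  rewrite e1//; apply: (@le_trans _ _ (2 `^ (al / 2) * (v ^+ 2) `^ (al / 2))).
    rewrite -powRM ?sqr_ge0//; apply: ge0_ler_powR; rewrite ?nnegrE ?(ltW (u0 v)) ?mulr_ge0 ?sqr_ge0//.
    by rewrite /u; nra.
  by rewrite ler_wpM2l ?powR_ge0// lerDr.
have := powR_ge0 v al; have := powR_ge0 (2 : R) (al / 2); nra.
Qed.

End dilations.

(** * The scaled Boltzmann equation *)

Section scaled_equation.
Context {R : realType}.
Context {p q al : R} {f0 : R -> R} {f : R -> R -> R}.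
Hypotheses (q_gt0 : 0 < q) (p_gt0 : 0 < p) (al_ge1 : 1 <= al).
Hypothesis df0 : dens al f0.
Hypothesis mf0 : mean f0 = 1.
Hypothesis sol : boltzmann_weak_solution p q al f0 f.
Implicit Types (phi : R -> R) (t s : R).

Let p0 := ltW p_gt0.
Let q0 := ltW q_gt0.
Let al0 : 0 <= al. Proof. exact: le_trans al_ge1. Qed.
Let r := p + q - 1.

Definition scaled t v := mean (f t) * f t (mean (f t) * v).

Let meanE t : 0 < t -> mean (f t) = expR (r * t).
Proof. by move=> t0; rewrite (sol_mean q_gt0 p_gt0 al_ge1 sol t0) mf0 mulr1. Qed.

Lemma scaled_dens t : 0 < t -> dens al (scaled t).
Proof.
move=> t0; apply: scale_dens; last exact: (sol_dens sol t0).
by rewrite meanE// expR_gt0.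
Qed.

Lemma pairing_scaled t phi : 0 < t -> measurable_fun setT phi ->
  pairing phi (scaled t) = pairing (fun v => phi (expR (- (r * t)) * v)) (f t).
Proof.
move=> t0 mphi; rewrite pairing_scale//.
- by rewrite meanE// expRN.
- by rewrite meanE// expR_gt0.
- exact: dens_measurable (sol_dens sol t0).
Qed.

Lemma scaled_mean t : 0 < t -> pairing idfun (scaled t) = 1.
Proof.
move=> t0; rewrite pairing_scaled//; last exact: measurable_id.
rewrite (pairingZ (dens_adm (sol_dens sol t0)) _ (tame_id al_ge1)).
by rewrite -[pairing _ _]/(mean (f t)) meanE// -expRD addNr expR0.
Qed.

Definition scaled_collision phi t :=
  pairing (fun w => pairing (fun v => phi (p * v + q * w) - phi v) (scaled t)) (scaled t)
  - r * pairing (fun v => v * derive1 phi v) (scaled t).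

Lemma tame2_gain phi : tame al phi ->
  tame2 al (fun v w => phi (p * v + q * w) - phi v).
Proof.
move=> tphi; apply: tame2D; first exact: tame2_affine.
have := tame2M (tameN tphi) (tame_cst al 1).
by under eq_fun do under eq_fun do rewrite mulr1.
Qed.

Let moment_bounded t : 0 < t -> exists M, 0 <= M /\
  \forall s \near t, 0 < s /\ pairing (fun v => 1 + v `^ al) (f s) <= M.
Proof.
move=> t0; have [W [sW tW] hW] := smooth_weight_dominating al0.
have cW := is_derive_continuous (sol_derive sol sW tW t0).
exists (`|pairing W (f t)| + 1); split; first by rewrite addr_ge0.
have /cvgrPdist_le/(_ 1 ltr01) := cW.
apply: filterS2 (lt_nbhsr t0) => s s0 h; split=> //.
apply: (@le_trans _ _ (pairing W (f s))).
  apply: (pairing_le (dens_adm (sol_dens sol s0))) => //; exact: tame_weight.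
have := ler_norm (pairing W (f t)); have := ler_norm (- (pairing W (f t) - pairing W (f s))).
by rewrite normrN; lra.
Qed.

(** Pairing with the scaled solution at time s means testing f with phi(exp(-rs) v), which depends
    on s, while the equation is given for fixed tests. Near t the pairing is split into A, with the
    factor frozen at k, and the increment B. Up to O(rho^2), B is rho(s) times the pairing of f with
    k v phi'(k v), and [is_derive_perturb] applies. *)
Lemma scaled_derive phi t : 0 < t -> test2 al phi ->
  is_derive t 1 (fun t => pairing phi (scaled t)) (scaled_collision phi t).
Proof.
move=> t0 tphi; have [sphi t_0 t_1 t_2] := tphi.
have mphi := smooth_measurable sphi.
pose k := expR (- (r * t)).
have k0 : 0 < k by exact: expR_gt0.
(* Chosen so that exp(-rs) = k (1 + rho(s)). *)
pose rho s := expR (- (r * (s - t))) - 1.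
pose psi v := (k * v) * derive1 phi (k * v).
have spsi : smooth psi.
  have sm : smooth (fun v => v * derive1 phi v).
    by have := smoothM (@smooth_id R) (smooth_derive1 sphi).
  by have := smooth_scale k sm.
have tpsi : tame al psi by exact: (tame_scale al0 (ltW k0) t_1).
pose A s := pairing (fun v => phi (k * v)) (f s).
pose B s := pairing (fun v => phi (k * v + k * (rho s * v)) - phi (k * v)) (f s).
have Fnear : \forall s \near t, pairing phi (scaled s) = A s + B s.
  apply: filterS (lt_nbhsr t0) => s s0; rewrite pairing_scaled// /A /B.
  have a := dens_adm (sol_dens sol s0).
  have tk : tame al (fun v => phi (k * v)) by exact: (tame_scale al0 (ltW k0) t_0).
  have e v : k * v + k * (rho s * v) = expR (- (r * s)) * v.
    rewrite /rho mulrA -mulrDl mulrBr mulr1 addrC subrK -expRD; congr (expR _ * _); ring.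
  under [X in _ = _ + X]eq_pairing => v _ do rewrite e.
  rewrite -(pairingD a) //; first by apply: eq_pairing => v _; rewrite addrC subrK.
  by apply: tameB => //; exact: (tame_scale al0 (expR_ge0 _) t_0).
apply: (is_derive_near Fnear).
have drho : is_derive t 1 rho (- r).
  have h := @is_derive_affine _ (fun x => expR (- r * x)) 1 (- t) t _ (is_derive_expRM (- r) _).
  have := is_deriveB h (is_derive_cst (1 : R) t 1).
  rewrite (_ : 1 * t + - t = 0); last by rewrite mul1r subrr.
  rewrite mulr0 expR0 mulr1 mul1r subr0.
  congr (is_derive _ _ _ _); apply/funext => s.
  by rewrite !fctE /rho mul1r mulNr.
have rho0 : rho t = 0 by rewrite /rho subrr mulr0 oppr0 expR0 subrr.
have dA : is_derive t 1 A (collision p q (fun v => phi (k * v)) (f t)).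
  have s1 : smooth (fun v => phi (k * v)) by exact: smooth_scale.
  exact: (sol_derive sol s1 (tame_scale al0 (ltW k0) t_0) t0).
have cpsi := is_derive_continuous (sol_derive sol spsi tpsi t0).
have [C C0 hC] := dilation2 al0 tphi.
have [M [M0 hM]] := moment_bounded t0.
have dB : is_derive t 1 B (- r * pairing psi (f t)).
  apply: (is_derive_perturb (C := C * ((1 + k `^ al) * M)) drho rho0 cpsi).
  have crho := is_derive_continuous drho.
  have /cvgrPdist_le/(_ 2^-1) := crho; rewrite invr_gt0 ltr0n => /(_ isT).
  apply: filterS2 hM => s [s0 hs]; rewrite rho0 sub0r normrN ler_norml => /andP[rl ru].
  have a := dens_adm (sol_dens sol s0).
  have Crho0 : 0 <= C * rho s ^+ 2 by apply: mulr_ge0 => //; exact: sqr_ge0.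
  have tk : tame al (fun v => phi (k * v)) by exact: (tame_scale al0 (ltW k0) t_0).
  have e v : k * v + k * (rho s * v) = (k * (1 + rho s)) * v by ring.
  have tk2 : tame al (fun v => phi (k * v + k * (rho s * v))).
    under eq_fun do rewrite e.
    by apply: (tame_scale al0 _ t_0); rewrite mulr_ge0 ?(ltW k0)//; lra.
  rewrite -(pairingZ a (rho s) tpsi) -(pairingB a); last 2 first.
  - exact: tameB.
  - exact: tameZ.
  apply: (@le_trans _ _ (pairing (fun v => C * rho s ^+ 2 * ((1 + k `^ al) * (1 + v `^ al))) (f s))).
    apply: (pairing_norm_le a).
    + by apply: tameB; [exact: tameB|exact: tameZ].
    + by apply: tameZ; apply: tameZ; exact: tame_weight.
    + move=> v v0; rewrite /psi.
      have kv0 : 0 <= k * v by rewrite mulr_ge0// ltW.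
      have := hC (1 + rho s) (k * v).
      have -> : (1 + rho s) * (k * v) = k * v + k * (rho s * v) by ring.
      rewrite (_ : 1 + rho s - 1 = rho s); last by ring.
      move=> h; apply: (le_trans (h _ kv0)); first by apply/andP; split; lra.
      rewrite (ler_wpM2l Crho0)//.
      rewrite powRM ?(ltW k0)//; have := powR_ge0 k al; have := powR_ge0 v al.
      by nra.
  rewrite (pairingZ a); last by apply: tameZ; exact: tame_weight.
  rewrite (pairingZ a); last exact: tame_weight.
  rewrite (_ : C * ((1 + k `^ al) * M) * _ = C * rho s ^+ 2 * ((1 + k `^ al) * M)); last by ring.
  by rewrite (ler_wpM2l Crho0)// ler_wpM2l// addr_ge0// powR_ge0.
have -> : scaled_collision phi t =
    collision p q (fun v => phi (k * v)) (f t) + - r * pairing psi (f t).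
  rewrite /scaled_collision mulNr; congr (_ - _); last first.
    by rewrite pairing_scaled//; exact: tame_measurable t_1.
  rewrite (collisionE q_gt0 p_gt0 al_ge1 sol t0); last exact: (tame_scale al0 (ltW k0) t_0).
  have d := scaled_dens t0.
  rewrite (pairing_scaled t0 (tame_measurable (tame_pairing d (tame2_swap (tame2_gain t_0))))).
  apply: eq_pairing => w w0; rewrite pairing_scaled//.
    by apply: eq_pairing => v v0; congr (phi _ - phi _); rewrite /k; ring.
  have kw0 : 0 <= expR (- (r * t)) * w by rewrite mulr_ge0 ?expR_ge0.
  exact: tame_measurable (tame2_section (tame2_swap (tame2_gain t_0)) kw0).
exact: is_deriveD1.
Qed.

(** The dilation factor tends to 1. The error C |k(s) - 1| multiplies a moment, which stays bounded
    because its smooth majorant W is itself a test. *)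
Lemma scaled_cvg0 phi : test2 al phi ->
  pairing phi (scaled t) @[t --> 0^'+] --> pairing phi f0.
Proof.
move=> tphi; have [sphi t_0 _ _] := tphi.
have mphi := smooth_measurable sphi.
have [W [sW tW] hW] := smooth_weight_dominating al0.
have [C C0 hC] := dilation1 al0 tphi.
have cphi := sol_cvg0 sol sphi t_0.
have cW := sol_cvg0 sol sW tW.
pose k s := expR (- (r * s)).
have ck : `|k s - 1| @[s --> 0^'+] --> (0 : R).
  have ck0 : `|k s - 1| @[s --> (0 : R)] --> `|k 0 - 1|.
    apply: cvg_norm; apply: cvgB; last exact: cvg_cst.
    apply: (@continuous_comp R R R (fun s : R => - (r * s)) expR); last exact: continuous_expR.
    by apply: continuousN; exact: mulrl_continuous.
  by move: (cvg_at_right_filter ck0); rewrite /k mulr0 oppr0 expR0 subrr normr0.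
have cz : C * `|k s - 1| * pairing W (f s) @[s --> 0^'+] --> C * 0 * pairing W f0.
  by apply: cvgM => //; apply: cvgM => //; exact: cvg_cst.
rewrite mulr0 mul0r in cz.
apply/cvgrPdist_le => e e0.
have e20 : 0 < e / 2 by rewrite divr_gt0.
have /cvgrPdist_le/(_ _ e20) h1 := cphi.
have /cvgrPdist_le/(_ _ e20) h2 := cz.
have h3 : \forall s \near 0^'+, `|k s - 1| <= 2^-1.
  by apply: (cvgr_le _ ck); rewrite invr_gt0.
near=> s.
have s0 : 0 < s by near: s; exact: nbhs_right_gt.
have k1 : `|pairing phi f0 - pairing phi (f s)| <= e / 2 by near: s.
have k2 : `|0 - C * `|k s - 1| * pairing W (f s)| <= e / 2 by near: s; exact: h2.
have k3 : `|k s - 1| <= 2^-1 by near: s.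
have a := dens_adm (sol_dens sol s0).
rewrite pairing_scaled// -/(k s).
have tks : tame al (fun v => phi (k s * v)) by exact: (tame_scale al0 (expR_ge0 _) t_0).
suff h : `|pairing phi (f s) - pairing (fun v => phi (k s * v)) (f s)| <= e / 2.
  have := ler_normD (pairing phi f0 - pairing phi (f s)) (pairing phi (f s) - pairing (fun v => phi (k s * v)) (f s)).
  by rewrite addrA subrK; lra.
rewrite sub0r normrN in k2; apply: le_trans k2; apply: le_trans (ler_norm _).
rewrite -(pairingZ a _ tW) -(pairingB a)//; apply: (pairing_norm_le a).
- exact: tameB.
- exact: tameZ.
move=> v v0; rewrite distrC; apply: le_trans (hC _ _ _ v0) _.
  by move: k3; rewrite ler_norml => /andP[? ?]; apply/andP; split; lra.
by rewrite ler_wpM2l ?mulr_ge0// hW.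
Unshelve. all: by end_near. Qed.

End scaled_equation.

(** * Uniform tails of the moment *)

Section moment_test.
Context {R : realType}.
Implicit Types (phi : R -> R) (p q v w D : R).

(** Nondecreasing convex functions on R_+ comparable to powers in a uniform way. The factor 4
    suffices because p v + q w <= 4 max(v, w) when p <= 2 and q <= 1. *)
Definition moment_test D phi := smooth phi /\ forall v, 0 <= v ->
  [/\ 0 <= phi v, 0 <= derive1 phi v, 0 <= derive1 (derive1 phi) v,
      v * derive1 phi v <= D * phi v /\ v ^+ 2 * derive1 (derive1 phi) v <= D * phi v &
      phi (4 * v) <= D * phi v].

Lemma moment_test_nondecreasing D phi v w : moment_test D phi ->
  0 <= v -> v <= w -> phi v <= phi w.
Proof.
move=> [sphi h] v0 vw; rewrite -subr_ge0.
have [c] := MVT_eq (smooth_derivable sphi) v w.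
rewrite min_l// max_r// => /andP[vc cw] ->; rewrite mulr_ge0 ?subr_ge0//.
by have [] := h c (le_trans v0 vc).
Qed.

Lemma moment_test_derive_nondecreasing D phi v w : moment_test D phi ->
  0 <= v -> v <= w -> derive1 phi v <= derive1 phi w.
Proof.
move=> [sphi h] v0 vw; rewrite -subr_ge0.
have [c] := MVT_eq (smooth_derivable (smooth_derive1 sphi)) v w.
rewrite min_l// max_r// => /andP[vc cw] ->; rewrite mulr_ge0 ?subr_ge0//.
by have [] := h c (le_trans v0 vc).
Qed.

(* The first order terms in [p - 1], which would blow up after division by [q],
   cancel because the mean is normalized. *)
Lemma moment_test_gain D phi p q v w : 0 <= D -> moment_test D phi ->
  2^-1 <= p <= 2 -> 0 <= q <= 1 -> 0 <= v -> 0 <= w ->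
  phi (p * v + q * w) - phi v - (p + q - 1) * (v * derive1 phi v) <=
  (q + (p - 1) ^+ 2) * (4 * D ^+ 2) * (phi v + phi w).
Proof.
move=> D0 tphi /andP[p1 p2] /andP[q0 q1] v0 w0; have [sphi h] := tphi.
have pv0 : 0 <= p * v by apply: mulr_ge0 => //; apply: le_trans p1; rewrite invr_ge0.
have [fv0 dv0 _ _ f4v] := h v v0.
have [fw0 _ _ _ _] := h w w0.
(* Terms in q need no cancellation. With M the larger of v and w, w phi'(c) is at most 4M phi'(4M)
   <= D phi(4M) <= D^2 phi(M). *)
have step1 : phi (p * v + q * w) - phi (p * v) <= q * (D ^+ 2 * (phi v + phi w)).
  pose M := Num.max v w.
  have vM : v <= M by rewrite le_max lexx.
  have wM : w <= M by rewrite le_max lexx orbT.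
  have M0 : 0 <= M by exact: le_trans vM.
  have qw0 : 0 <= q * w by rewrite mulr_ge0.
  have [c] := MVT_eq (smooth_derivable sphi) (p * v) (p * v + q * w).
  rewrite min_l ?lerDl// max_r ?lerDl// => /andP[c1 c2] ->.
  rewrite addrAC subrr add0r mulrC -mulrA ler_wpM2l//.
  have c4M : c <= 4 * M by nra.
  have d1 := moment_test_derive_nondecreasing tphi (le_trans pv0 c1) c4M.
  have [_ d4M _ [h4 _] _] := h (4 * M) (mulr_ge0 (ler0n _ 4) M0).
  have [_ _ _ _ hM] := h M M0.
  have fM : phi M <= phi v + phi w.
    by rewrite /M maxEle; case: ifP => _; rewrite ?lerDl ?lerDr.
  apply: (@le_trans _ _ (D * phi (4 * M))).
    apply: le_trans h4; apply: ler_pM => //.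
      by have [] := h c (le_trans pv0 c1).
    by apply: (le_trans wM); rewrite ler_peMl// ler1n.
  rewrite expr2 -mulrA ler_wpM2l//; apply: (le_trans hM).
  by rewrite ler_wpM2l.
(* The linear term in p - 1 is kept, since the scaling drift subtracts it. In 4 D^2, 4 comes from
   v^2 <= 4 c^2, one D from the bound on phi'' and one from phi(c) <= phi(4v) <= D phi(v). *)
have step2 : phi (p * v) - phi v - (p - 1) * (v * derive1 phi v) <= (p - 1) ^+ 2 * (4 * D ^+ 2 * phi v).
  have [c [hc]] := taylor2 (smooth_derivable sphi) (smooth_derivable (smooth_derive1 sphi)) v (p * v).
  have [vc cv] : v <= 2 * c /\ c <= 2 * v.
    have h1 : 2^-1 * v <= p * v by rewrite ler_wpM2r.
    have h2 : p * v <= 2 * v by rewrite ler_wpM2r.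
    move: hc; rewrite ge_min le_max => /andP[/orP[] ? /orP[] ?]; split; lra.
  have c0 : 0 <= c by lra.
  have [fc0 _ ddc0 [_ hc2] _] := h c c0.
  rewrite (_ : p * v - v = (p - 1) * v); last by ring.
  rewrite -mulrA => /(le_trans (ler_norm _)) /le_trans; apply.
  rewrite (ger0_norm ddc0) (_ : ((p - 1) * v) ^+ 2 * derive1 (derive1 phi) c =
    (p - 1) ^+ 2 * (v ^+ 2 * derive1 (derive1 phi) c)); last by ring.
  rewrite ler_wpM2l ?sqr_ge0//.
  apply: (@le_trans _ _ (4 * (c ^+ 2 * derive1 (derive1 phi) c))).
    by rewrite mulrA ler_wpM2r//; nra.
  rewrite (_ : 4 * D ^+ 2 * phi v = 4 * (D * (D * phi v))); last by ring.
  rewrite ler_wpM2l//; apply: (le_trans hc2).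
  rewrite ler_wpM2l//; apply: le_trans f4v.
  by apply: (moment_test_nondecreasing tphi) => //; lra.
(* The part q v phi' of the drift has the favourable sign and is dropped. *)
have qv : 0 <= q * (v * derive1 phi v) by rewrite !mulr_ge0.
have e1 : 0 <= q * D ^+ 2 * (phi v + phi w).
  by apply: mulr_ge0; [apply: mulr_ge0 => //; exact: sqr_ge0|exact: addr_ge0].
have e2 : 0 <= (p - 1) ^+ 2 * D ^+ 2 * phi w.
  by apply: mulr_ge0 => //; apply: mulr_ge0; exact: sqr_ge0.
move: step1 step2 e1 e2 qv; move: (derive1 phi v) => d.
set X := D ^+ 2; set Y := (p - 1) ^+ 2; set F := phi v; set G := phi w.
rewrite (_ : (p + q - 1) * (v * d) = (p - 1) * (v * d) + q * (v * d)); last by ring.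
rewrite (_ : (q + Y) * (4 * X) * (F + G) =
  q * (X * (F + G)) + 3 * (q * X * (F + G)) + Y * (4 * X * F) + 4 * (Y * X * G)); last by ring.
by lra.
Qed.

End moment_test.

(** * Smooth truncations of the power v^al *)

Section truncated_power.
Context {R : realType}.
Context {k : nat} {b al : R}.
Local Notation n := k.+1.*2.
Hypotheses (al_ge1 : 1 <= al) (al_lt : al < n%:R) (bE : b = al / n%:R).
Implicit Types (a v x y : R).

Let n0 : 0 < n%:R :> R. Proof. by rewrite ltr0n. Qed.
Let b0 : 0 < b. Proof. by rewrite bE divr_gt0// (lt_le_trans _ al_ge1). Qed.
Let b1 : b < 1. Proof. by rewrite bE ltr_pdivrMr// mul1r. Qed.
Let nb : n%:R * b = al. Proof. by rewrite bE mulrC divfK// gt_eqF. Qed.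

(** A concave power lies below its tangent. This follows from Young's inequality for (x/y)^b and 1
    with the exponents 1/b and 1/(1 - b). *)
Lemma powR_tangent x y : 0 <= x -> 0 < y -> x `^ b <= y `^ b + b * y `^ (b - 1) * (x - y).
Proof.
move=> x0 y0.
have [p0 q0] : 0 < b^-1 /\ 0 < (1 - b)^-1 by rewrite !invr_gt0 subr_gt0.
have h := @conjugate_powR R ((x / y) `^ b) 1 _ _ (powR_ge0 _ _) ler01 p0 q0.
rewrite !invrK addrC subrK in h; have {h} := h erefl.
rewrite mulr1 powR1 mul1r -powRrM mulfV ?gt_eqF// powRr1 ?divr_ge0 ?(ltW y0)//.
move=> h.
have -> : x = x / y * y by rewrite divfK ?gt_eqF.
rewrite powRM ?divr_ge0 ?(ltW y0)//.
have e : y `^ b = y `^ (b - 1) * y.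
  rewrite -{3}[y]powRr1 ?ltW// -powRD; first by rewrite subrK.
  by rewrite (gt_eqF y0) implybT.
have h2 := ler_wpM2r (powR_ge0 y b) h; apply: le_trans h2 _.
by rewrite e le_eqVlt; apply/orP; left; apply/eqP; ring.
Qed.

(** The exponent is even, so a + v^n is positive on the whole line for a > 0 and its powers are
    smooth there. *)
Let u a v := a + v ^+ n.
(* Comparable with v^al when v^n exceeds [a], and tends to 0 as [a] grows, so that
   bounds on it control the tails of the moment of order al. *)
Definition tpow a v := u a v `^ b - a `^ b.

Let vn_ge0 v : 0 <= v ^+ n. Proof. by rewrite exprn_even_ge0// odd_double. Qed.
Let u_gt0 a v : 0 < a -> 0 < u a v. Proof. by move=> a0; rewrite /u ltr_pwDl. Qed.

Let smooth_u a : smooth (u a).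
Proof. by apply: smoothD; [exact: smooth_cst|exact: smoothX]. Qed.

Let derive_exp m v : is_derive v 1 (fun x : R => x ^+ m) (m%:R * v ^+ m.-1).
Proof.
elim: m => [|m IH]; first by rewrite mul0r; exact: is_derive_cst.
have e : 1 * v ^+ m + v * (m%:R * v ^+ m.-1) = m.+1%:R * v ^+ m.
  by case: (m) => [|j]; [ring|rewrite -[j.+2%:R]natr1 exprS /=; ring].
have := is_deriveM1 (is_derive_id v 1) IH; rewrite e.
by under eq_fun do rewrite -exprS.
Qed.

Let derive_u a v : is_derive v 1 (u a) (n%:R * v ^+ n.-1).
Proof.
by have := is_deriveD1 (is_derive_cst a v 1) (derive_exp n v); rewrite add0r.
Qed.

Let derive_pow a v g : 0 < a ->
  is_derive v 1 (fun v => u a v `^ g) (g * u a v `^ (g - 1) * (n%:R * v ^+ n.-1)).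
Proof.
move=> a0.
exact: (@is_derive1_comp R (fun y => y `^ g) (u a) v _ _ (is_derive1_powR g (u_gt0 v a0)) (derive_u a v)).
Qed.

Lemma smooth_tpow a : 0 < a -> smooth (tpow a).
Proof.
move=> a0; apply: smoothB; last exact: smooth_cst.
by apply: smooth_powR => // v; exact: u_gt0.
Qed.

Lemma derive_tpow a v : 0 < a -> derive1 (tpow a) v = al * (v ^+ n.-1 * u a v `^ (b - 1)).
Proof.
move=> a0; have := is_deriveB (derive_pow v b a0) (is_derive_cst (a `^ b) v 1).
by move=> /is_derive_derive1 ->; rewrite subr0 -nb; ring.
Qed.

(** In this factored form al >= 1 makes the bracket nonnegative, hence [tpow] convex on R_+, and al
    < n makes the bracket at most n u. *)
Lemma derive2_tpow a v : 0 < a -> derive1 (derive1 (tpow a)) v =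
  al * v ^+ n.-2 * u a v `^ (b - 2) * (n.-1%:R * a + (al - 1) * v ^+ n).
Proof.
move=> a0.
have -> : derive1 (tpow a) = fun v => al * (v ^+ n.-1 * u a v `^ (b - 1)).
  by apply/funext => x; exact: derive_tpow.
have := is_deriveZ al (is_deriveM1 (derive_exp n.-1 v) (derive_pow v (b - 1) a0)).
move=> /is_derive_derive1 ->; rewrite /GRing.scale /=.
have e : u a v `^ (b - 1) = u a v `^ (b - 2) * u a v.
  rewrite -{3}[u a v]powRr1 ?(ltW (u_gt0 v a0))// -powRD; first by congr (_ `^ _); ring.
  by rewrite (gt_eqF (u_gt0 v a0)) implybT.
rewrite (_ : b - 1 - 1 = b - 2); last by ring.
rewrite e /u -nb doubleS /= -[k.*2.+1%:R]natr1 -[k.*2.+2%:R]natr1 -[k.*2.+1%:R]natr1.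
rewrite !exprS; set X := v ^+ k.*2; set U := _ `^ _; set m := k.*2%:R.
by ring.
Qed.

Lemma tpow_lower a v : 0 < a -> 0 <= v -> b * (v ^+ n * u a v `^ (b - 1)) <= tpow a v.
Proof.
move=> a0 v0; have := powR_tangent (ltW a0) (u_gt0 v a0).
by rewrite /tpow /u; set U := _ `^ (b - 1); set V := _ `^ b; set A := a `^ b; nra.
Qed.

Lemma tpow_ge0 a v : 0 < a -> 0 <= v -> 0 <= tpow a v.
Proof.
move=> a0 v0; rewrite subr_ge0; apply: ge0_ler_powR; rewrite ?nnegrE ?(ltW b0) ?(ltW a0) ?(ltW (u_gt0 _ _))//.
by rewrite /u lerDl.
Qed.

(* Concavity of [x |-> x `^ b] in the variable [v ^+ n]. *)
Lemma tpow_dilate a v : 0 < a -> 0 <= v -> tpow a (4 * v) <= 4 ^+ n * tpow a v.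
Proof.
move=> a0 v0; have y0 := u_gt0 v a0.
have h1 := powR_tangent (ltW a0) y0.
have h2 := powR_tangent (ltW (u_gt0 (4 * v) a0)) y0.
have c1 : 1 <= 4 ^+ n :> R by rewrite exprn_ege1// ler1n.
have e : u a (4 * v) - u a v = - (4 ^+ n - 1) * (a - u a v).
  by rewrite /u exprMn; ring.
rewrite e in h2; rewrite /tpow.
move: h1 h2; set T := b * _; set A := a `^ b; set U := u a v `^ b; set c := 4 ^+ n in c1 *.
set V := u a (4 * v) `^ b => h1 h2.
have c2 : 0 <= c - 1 by rewrite subr_ge0.
have := ler_wpM2l c2 h1; nra.
Qed.

(** The constant does not depend on a. This is decisive: the Gronwall factor is the same for all
    truncations, while the initial value tends to 0 as a grows. *)
Lemma tpow_moment_test a : 0 < a -> moment_test (4 ^+ n * n%:R ^+ 2) (tpow a).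
Proof.
move=> a0; split; first exact: smooth_tpow.
move=> v v0; have f0 := tpow_ge0 a0 v0; have lo := tpow_lower a0 v0.
have al0 : 0 <= al by apply: le_trans al_ge1.
have al10 : 0 <= al - 1 by rewrite subr_ge0.
have n1 : 1 <= n%:R :> R by rewrite ler1n.
have c1 : 1 <= 4 ^+ n :> R by rewrite exprn_ege1// ler1n.
have nn : n%:R <= n%:R ^+ 2 :> R by rewrite expr2 ler_peMl.
have n20 : 0 <= n%:R ^+ 2 :> R by apply: le_trans nn.
have nD : n%:R <= 4 ^+ n * n%:R ^+ 2 :> R by apply: (le_trans nn); rewrite ler_peMl.
have nD2 : n%:R ^+ 2 <= 4 ^+ n * n%:R ^+ 2 :> R by rewrite ler_peMl.
have cD : 4 ^+ n <= 4 ^+ n * n%:R ^+ 2 :> R by rewrite ler_peMr ?(le_trans ler01)// (le_trans n1).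
have h1 : v * derive1 (tpow a) v = n%:R * (b * (v ^+ n * u a v `^ (b - 1))).
  by rewrite derive_tpow// -nb doubleS /= !exprS; ring.
have lo2 : v * derive1 (tpow a) v <= n%:R * tpow a v by rewrite h1 ler_wpM2l.
split => //.
- by rewrite derive_tpow// !mulr_ge0 ?powR_ge0 ?exprn_ge0.
- by rewrite derive2_tpow// !mulr_ge0 ?powR_ge0 ?exprn_ge0// addr_ge0// mulr_ge0// ltW.
- split; first by apply: (le_trans lo2); rewrite ler_wpM2r.
  apply: (@le_trans _ _ (n%:R ^+ 2 * tpow a v)); last by rewrite ler_wpM2r.
  apply: (@le_trans _ _ (n%:R * (v * derive1 (tpow a) v))); last first.
    by rewrite expr2 -mulrA ler_wpM2l.
  rewrite derive2_tpow// derive_tpow//.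
  have e : u a v `^ (b - 1) = u a v `^ (b - 2) * u a v.
    rewrite -{3}[u a v]powRr1 ?(ltW (u_gt0 v a0))// -powRD; first by congr (_ `^ _); ring.
    by rewrite (gt_eqF (u_gt0 v a0)) implybT.
  have e1 : v ^+ 2 * (al * v ^+ n.-2 * u a v `^ (b - 2) * (n.-1%:R * a + (al - 1) * v ^+ n)) =
    al * v ^+ n * u a v `^ (b - 2) * (n.-1%:R * a + (al - 1) * v ^+ n).
    by rewrite doubleS /= !exprS expr0; ring.
  have e2 : n%:R * (v * (al * (v ^+ n.-1 * u a v `^ (b - 1)))) =
    al * v ^+ n * u a v `^ (b - 2) * (n%:R * u a v).
    by rewrite e doubleS /= !exprS; ring.
  have nn0 : 0 <= al * v ^+ n * u a v `^ (b - 2).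
    by apply: mulr_ge0; [apply: mulr_ge0 => //; exact: vn_ge0|exact: powR_ge0].
  rewrite e1 e2; apply: (ler_wpM2l nn0).
  rewrite /u mulrDr; apply: lerD; first by rewrite ler_wpM2r ?(ltW a0)// ler_nat leq_pred.
  by apply: (ler_wpM2r (vn_ge0 v)); apply: ltW; apply: (le_lt_trans _ al_lt); lra.
- by apply: (le_trans (tpow_dilate a0 v0)); rewrite ler_wpM2r.
Qed.

Lemma powR_powal v : 0 <= v -> (v ^+ n) `^ b = v `^ al.
Proof. by move=> v0; rewrite -powR_mulrn// -powRrM nb. Qed.

(** Uniform in a, hence a majorant for dominated convergence. Where v^n <= a the tangent at a and
    a^(b - 1) <= (v^n)^(b - 1) give it; elsewhere a + v^n <= 2 v^n. *)
Lemma tpow_upper a v : 0 < a -> 0 <= v -> tpow a v <= 2 * v `^ al.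
Proof.
move=> a0 v0; rewrite -powR_powal//; have bn0 := vn_ge0 v.
have B0 := powR_ge0 (v ^+ n) b.
have [ba|ab] := leP (v ^+ n) a.
  have := powR_tangent (ltW (u_gt0 v a0)) a0; rewrite /tpow /u addrAC subrr add0r => h.
  have : a `^ (b - 1) * v ^+ n <= (v ^+ n) `^ b.
    move: bn0; rewrite le_eqVlt => /predU1P[<-|bn0]; first by rewrite mulr0 powR_ge0.
    have -> : (v ^+ n) `^ b = (v ^+ n) `^ (b - 1) * v ^+ n.
      rewrite -{3}[v ^+ n]powRr1 ?(ltW bn0)// -powRD; first by rewrite subrK.
      by rewrite (gt_eqF bn0) implybT.
    rewrite ler_wpM2r ?(ltW bn0)//.
    rewrite (_ : b - 1 = - (1 - b)); last by rewrite opprB.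
    rewrite !powRN lef_pV2 ?posrE ?powR_gt0//.
    by apply: ge0_ler_powR; rewrite ?nnegrE ?(ltW a0) ?(ltW bn0)// subr_ge0 ltW.
  move=> h3; apply: (le_trans (_ : _ <= b * (a `^ (b - 1) * v ^+ n))).
    by rewrite mulrA; lra.
  apply: (@le_trans _ _ (a `^ (b - 1) * v ^+ n)).
    by rewrite ler_piMl ?(ltW b1)// mulr_ge0 ?powR_ge0.
  by lra.
have h : u a v `^ b <= 2 * (v ^+ n) `^ b.
  apply: (@le_trans _ _ ((2 * v ^+ n) `^ b)).
    apply: ge0_ler_powR; rewrite ?nnegrE ?(ltW b0)//; first exact: ltW (u_gt0 _ _).
      by apply: mulr_ge0 => //; exact: vn_ge0.
    by rewrite /u; lra.
  rewrite powRM ?ler0n//.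
  apply: (ler_wpM2r B0); rewrite -[leRHS]powRr1 ?ler0n//.
  by apply: ler_powR; rewrite ?ler1n// ltW.
by rewrite /tpow; have := powR_ge0 a b; lra.
Qed.

(** Here a + v^n <= 2 v^n, and the negative exponent b - 1 reverses this inequality inside
    [tpow_lower]. *)
Lemma tpow_tail a v : 0 < a -> 0 <= v -> a <= v ^+ n -> b * 2 `^ (b - 1) * v `^ al <= tpow a v.
Proof.
move=> a0 v0 av; apply: le_trans (tpow_lower a0 v0).
have bn0 : 0 < v ^+ n by exact: lt_le_trans av.
rewrite -mulrA ler_wpM2l ?(ltW b0)// -powR_powal//.
have -> : (v ^+ n) `^ b = (v ^+ n) `^ (b - 1) * v ^+ n.
  rewrite -{3}[v ^+ n]powRr1 ?(ltW bn0)// -powRD; first by rewrite subrK.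
  by rewrite (gt_eqF bn0) implybT.
rewrite mulrA -powRM ?(ltW bn0)// [leRHS]mulrC ler_wpM2r ?(ltW bn0)//.
rewrite (_ : b - 1 = - (1 - b)); last by rewrite opprB.
have u0 := u_gt0 v a0.
have b20 : 0 < 2 * v ^+ n by apply: mulr_gt0.
rewrite !powRN; rewrite lef_pV2 ?posrE; [|exact: powR_gt0|exact: powR_gt0].
apply: ge0_ler_powR; rewrite ?nnegrE ?subr_ge0 ?(ltW b1) ?(ltW u0) ?(ltW b20)//.
by rewrite /u; lra.
Qed.

Lemma tpow_small a v : 0 < a -> 0 <= v -> tpow a v <= b * a `^ (b - 1) * v ^+ n.
Proof.
move=> a0 v0; have := powR_tangent (ltW (u_gt0 v a0)) a0.
by rewrite /tpow /u addrAC subrr add0r; lra.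
Qed.

End truncated_power.

Section double_pairing.
Context {R : realType} {al : R} {g : R -> R} (dg : dens al g).
Implicit Types (phi psi chi : R -> R) (Phi : R -> R -> R).

Lemma double_pairing_le Phi psi chi : tame2 al Phi -> tame al psi -> tame al chi ->
  (forall v w, 0 <= v -> 0 <= w -> Phi v w <= psi v + chi w) ->
  pairing (fun w => pairing (fun v => Phi v w) g) g <= pairing psi g + pairing chi g.
Proof.
move=> tP tpsi tchi h; have ag := dens_adm dg.
apply: (@le_trans _ _ (pairing (fun w => pairing psi g + chi w) g)); last first.
  by rewrite (pairingD ag (tame_cst _ _) tchi) (dens_cst _ dg).
apply: (pairing_le ag).
- exact: (tame_pairing dg (tame2_swap tP)).
- by apply: tameD => //; exact: tame_cst.
move=> w w0; rewrite -[chi w](dens_cst _ dg) -(pairingD ag tpsi (tame_cst _ _)).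
apply: (pairing_le ag).
- exact: (tame2_section (tame2_swap tP) w0).
- by apply: tameD => //; exact: tame_cst.
- by move=> v v0; exact: h.
Qed.

Lemma double_pairing_norm_le Phi psi chi : tame2 al Phi -> tame al psi -> tame al chi ->
  (forall v w, 0 <= v -> 0 <= w -> `|Phi v w| <= psi v + chi w) ->
  `|pairing (fun w => pairing (fun v => Phi v w) g) g| <= pairing psi g + pairing chi g.
Proof.
move=> tP tpsi tchi h; have ag := dens_adm dg; rewrite ler_norml; apply/andP; split.
  have tN : tame2 al (fun v w => - Phi v w).
    case: tP => mP [C hC]; split; first by apply: measurableT_comp.
    by exists C => v w v0 w0; rewrite normrN; exact: hC.
  have hN v w : 0 <= v -> 0 <= w -> - Phi v w <= psi v + chi w.
    by move=> v0 w0; rewrite (le_trans _ (h v w v0 w0))// -normrN ler_norm.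
  rewrite lerNl; apply: le_trans (double_pairing_le tN tpsi tchi hN).
  rewrite -(pairingN ag) ?le_eqVlt; last exact: (tame_pairing dg (tame2_swap tP)).
  apply/orP; left; apply/eqP; apply: eq_pairing => w w0.
  by rewrite (pairingN ag)//; exact: (tame2_section (tame2_swap tP) w0).
by apply: double_pairing_le => // v w v0 w0; exact: le_trans (ler_norm _) (h v w v0 w0).
Qed.

End double_pairing.

Section moment_growth.
Context {R : realType}.
Context {p q al : R} {f0 : R -> R} {f : R -> R -> R}.
Hypotheses (q_gt0 : 0 < q) (p_gt0 : 0 < p) (al_ge1 : 1 <= al).
Hypothesis df0 : dens al f0.
Hypothesis mf0 : mean f0 = 1.
Hypothesis sol : boltzmann_weak_solution p q al f0 f.
Implicit Types (phi : R -> R) (t D : R).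

Lemma tame2_scaled_gain phi : test2 al phi -> tame2 al (fun v w =>
  phi (p * v + q * w) - phi v - (p + q - 1) * (v * derive1 phi v)).
Proof.
move=> [_ t0 t1 _]; apply: tame2D; first exact: tame2_gain.
have := tame2M (tameN (tameZ (p + q - 1) t1)) (tame_cst al 1).
by under eq_fun do under eq_fun do rewrite mulr1.
Qed.

Lemma scaled_collisionE phi t : 0 < t -> test2 al phi ->
  scaled_collision (p := p) (q := q) (f := f) phi t =
  pairing (fun w => pairing (fun v =>
    phi (p * v + q * w) - phi v - (p + q - 1) * (v * derive1 phi v))
  (scaled (f := f) t)) (scaled (f := f) t).
Proof.
move=> t_gt0 tphi; have [_ t0 t1 _] := tphi.
have dg := scaled_dens q_gt0 p_gt0 al_ge1 mf0 sol t_gt0; have ag := dens_adm dg.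
have tg := tame2_gain q_gt0 p_gt0 al_ge1 t0.
rewrite /scaled_collision -(dens_cst (_ * _) dg) -(pairingB ag) ?tame_cst//; last 2 first.
- exact: (tame_pairing dg (tame2_swap tg)).
- exact: tame_cst.
apply: eq_pairing => w w0; rewrite -(pairingZ ag)// -(pairingB ag)//.
  exact: (tame2_section (tame2_swap tg) w0).
exact: tameZ.
Qed.

Lemma moment_test_test2 D phi : 0 <= D -> moment_test D phi -> tame al phi -> test2 al phi.
Proof.
move=> D0 [sphi h] tphi; split => //.
  apply: (tame_le _ (tameZ D tphi)).
    by apply: measurable_funM => //; exact: smooth_measurable (smooth_derive1 sphi).
  move=> v v0; have [f_ge0 d0 _ [h1 _] _] := h v v0.
  by rewrite !ger0_norm ?mulr_ge0.
apply: (tame_le _ (tameZ D tphi)).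
  apply: measurable_funM; first exact: measurable_funX.
  exact: smooth_measurable (smooth_derive1 (smooth_derive1 sphi)).
move=> v v0; have [f_ge0 _ d0 [_ h1] _] := h v v0.
have v20 : 0 <= v ^+ 2 by exact: sqr_ge0.
by rewrite !ger0_norm ?(mulr_ge0 v20 d0) ?(mulr_ge0 D0 f_ge0).
Qed.

Lemma moment_growth D phi t : 0 <= D -> moment_test D phi -> tame al phi ->
  2^-1 <= p <= 2 -> q <= 1 -> 0 < t ->
  pairing phi (scaled (f := f) t) <=
  expR ((q + (p - 1) ^+ 2) * (8 * D ^+ 2) * t) * pairing phi f0.
Proof.
move=> D0 mphi tphi hp hq t0; have tphi2 := moment_test_test2 D0 mphi tphi.
have hd (s : R) : 0 < s -> is_derive s 1 (fun s : R => pairing phi (scaled (f := f) s)) (scaled_collision (p := p) (q := q) (f := f) phi s).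
  by move=> s0; exact: (scaled_derive q_gt0 p_gt0 al_ge1 mf0 sol s0 tphi2).
apply: (@gronwall R (fun s => pairing phi (scaled (f := f) s)) _ _ t t0).
- by move=> s /andP[s0 _]; exact: is_derive_derivable (hd s s0).
- move=> s /andP[s0 _]; rewrite (is_derive_derive1 (hd s s0)) (scaled_collisionE s0 tphi2).
  have dg := scaled_dens q_gt0 p_gt0 al_ge1 mf0 sol s0; have ag := dens_adm dg.
  (* The pointwise bound is c (phi(v) + phi(w)). Each variable contributes c, which doubles 4 D^2
     into 8 D^2. *)
  pose c := (q + (p - 1) ^+ 2) * (4 * D ^+ 2).
  apply: (@le_trans _ _ (pairing (fun v => c * phi v) (scaled (f := f) s) + pairing (fun v => c * phi v) (scaled (f := f) s))).
    apply: (double_pairing_le dg (tame2_scaled_gain tphi2)).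
    - exact: tameZ.
    - exact: tameZ.
    - move=> v w v0 w0; rewrite -mulrDr.
      by apply: moment_test_gain => //; rewrite hq ltW.
  rewrite (pairingZ ag c tphi) -mulrDl le_eqVlt; apply/orP; left; apply/eqP.
  by congr (_ * _); rewrite /c; ring.
- exact: (scaled_cvg0 q_gt0 p_gt0 al_ge1 mf0 sol tphi2).
Qed.

End moment_growth.

Section moment_tail.
Context {R : realType}.
Context {al lambda : R} {f0 : R -> R}.
Hypotheses (al_ge1 : 1 <= al) (lambda_gt0 : 0 < lambda).
Hypothesis df0 : dens al f0.
Hypothesis mf0 : mean f0 = 1.

Lemma cvg_powRN (s : R) : 0 < s -> n.+1%:R `^ (- s) @[n --> \oo] --> (0 : R).
Proof.
move=> s0; have /cvg_at_rightP := powR_cvg0 s0.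
move=> /(_ (@harmonic R)) h0.
have h : harmonic n `^ s @[n --> \oo] --> (0 : R) by apply: h0; split; [move=> n; exact: harmonic_gt0|exact: cvg_harmonic].
 apply: (cvg_trans _ h); apply: near_eq_cvg.
by near=> n; rewrite /harmonic /= -[X in X `^ s]powR_inv1// -powRrM mulN1r.
Unshelve. all: by end_near. Qed.

Lemma tpow_cvg0 k b : al < k.+1.*2%:R -> b = al / k.+1.*2%:R ->
  pairing (tpow (R := R) (k := k) (b := b) m.+1%:R) f0 @[m --> \oo] --> (0 : R).
Proof.
move=> al_lt bE; have af := dens_adm df0.
rewrite -(pairing0 af).
have t2 : tame al (fun v => 2 * (1 + v `^ al)) by apply: tameZ; exact: tame_weight.
have m0 m : 0 < m.+1%:R :> R by rewrite ltr0n.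
have b1 : 0 < 1 - b by rewrite bE subr_gt0 ltr_pdivrMr ?ltr0n// mul1r.
apply: (pairing_dct af _ _ t2) => //.
- by move=> m; apply: smooth_measurable; exact: smooth_tpow.
- move=> m v v0; rewrite ger0_norm; last exact: (tpow_ge0 al_ge1 bE (m0 m) v0).
  apply: le_trans (tpow_upper al_ge1 al_lt bE (m0 m) v0) _.
  by rewrite ler_wpM2l// lerDr.
apply: aeW => v v0.
have h : b * m.+1%:R `^ (- (1 - b)) * v ^+ k.+1.*2 @[m --> \oo] --> b * 0 * v ^+ k.+1.*2.
  by apply: cvgMr_tmp; apply: cvgMl_tmp; exact: cvg_powRN.
rewrite mulr0 mul0r in h; apply: (squeeze_cvgr _ _ h); last exact: cvg_cst.
near=> m; rewrite (tpow_ge0 al_ge1 bE (m0 m) v0) opprB /=.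
exact: (tpow_small al_ge1 al_lt bE (m0 m) v0).
Unshelve. all: by end_near. Qed.

(** As (q + (p - 1)^2) tau/q = (1 + lambda) tau, one C bounds the Gronwall factor for all q. The
    truncation parameter can then be chosen from f_0 alone. *)
Lemma moment_tail T e : 0 < e -> exists2 rho, 1 <= rho &
  forall p q f tau, 2^-1 <= p <= 2 -> 0 < q <= 1 -> (p - 1) ^+ 2 = lambda * q ->
    boltzmann_weak_solution p q al f0 f -> 0 < tau <= T ->
    pairing (fun v => \1_[set x : R | rho <= x] v * (1 + v `^ al)) (scaled (f := f) (tau / q)) <= e.
Proof.
move=> e0; pose k := Num.truncn al; set n := k.+1.*2.
have al_lt : al < k.+1.*2%:R.
  by apply: lt_le_trans (truncnS_gt al) _; rewrite ler_nat -addnn leq_addr.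
have b_gt0 : 0 < al / k.+1.*2%:R by rewrite divr_gt0 ?ltr0n// (lt_le_trans _ al_ge1).
pose D : R := 4 ^+ n * n%:R ^+ 2.
have D0 : 0 <= D by apply: mulr_ge0; [exact: exprn_ge0|exact: sqr_ge0].
pose C := expR ((1 + lambda) * (8 * D ^+ 2) * T).
pose b := al / k.+1.*2%:R; pose kap := b * 2 `^ (b - 1).
have kap0 : 0 < kap by rewrite mulr_gt0// powR_gt0.
have C0 : 0 < C by exact: expR_gt0.
have d0 : 0 < e * kap / 2 / C by rewrite !divr_gt0// mulr_gt0.
have := tpow_cvg0 al_lt erefl => /cvgrPdist_le/(_ _ d0)[m _ /(_ m (leqnn m))].
rewrite sub0r normrN -/b => /(le_trans (ler_norm _)) hm.
have m0 : 0 < m.+1%:R :> R by rewrite ltr0n.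
(* One number serves as the radius and as a: for v >= m + 1 one has v^n >= v >= a. *)
exists m.+1%:R; first by rewrite ler1n.
move=> p q f tau /[dup] hp /andP[p1 p2] /andP[q0 q1] pq sol /andP[tau0 tauT].
have p0 : 0 < p by lra.
have t0 : 0 < tau / q by rewrite divr_gt0.
have dg := scaled_dens q0 p0 al_ge1 mf0 sol t0; have ag := dens_adm dg.
have tt : tame al (tpow (R := R) (k := k) (b := b) m.+1%:R).
  apply: (tame_le _ (tameZ 2 (tame_weight al))); first by apply: smooth_measurable; exact: smooth_tpow.
  move=> v v0; rewrite !ger0_norm ?(tpow_ge0 al_ge1 erefl m0 v0) ?mulr_ge0 ?weight_ge0//.
  apply: le_trans (tpow_upper al_ge1 al_lt erefl m0 v0) _.
  by rewrite ler_wpM2l// lerDr.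
have mg := moment_growth q0 p0 al_ge1 mf0 sol D0 (tpow_moment_test al_ge1 al_lt erefl m0) tt hp q1 t0.
(* For v >= 1 the weight 1 + v^al is at most 2 v^al, and [kap] is the constant of [tpow_tail]. *)
apply: (@le_trans _ _ (2 / kap * pairing (tpow (R := R) (k := k) (b := b) m.+1%:R) (scaled (f := f) (tau / q)))).
  rewrite -(pairingZ ag _ tt); apply: (pairing_le ag).
  - apply: (tame_bM (M := 1) (tame_weight al)).
      apply: measurable_ind; rewrite (_ : [set x | _] = `[m.+1%:R, +oo[%classic); first exact: measurable_itv.
      by apply/seteqP; split => x /=; rewrite in_itv /= andbT.
    by move=> v _; rewrite indicE; case: (_ \in _); rewrite ?normr1 ?normr0.
  - exact: tameZ.
  move=> v v0; rewrite indicE; case: (boolP (v \in _)) => [|_]; last first.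
    rewrite mul0r mulr_ge0 ?divr_ge0 ?(ltW kap0)//; exact: (tpow_ge0 al_ge1 erefl m0 v0).
  rewrite inE /= => mv; rewrite mul1r.
  have v1 : 1 <= v by apply: le_trans mv; rewrite ler1n.
  have va : 1 <= v `^ al by rewrite -(powRr0 v) ler_powR// (le_trans ler01).
  have := tpow_tail al_ge1 al_lt erefl m0 v0 (le_trans mv (ler_eXnr (isT : (0 < n)%N) v1)).
  rewrite -/b -/kap -ler_pdivlMl// -mulrA.
  by move: (kap^-1 * _) => Z h; lra.
set X := pairing _ _; have XC : X <= e * kap / 2.
  apply: (le_trans mg); rewrite -(@divfK _ C _ (e * kap / 2)) ?gt_eqF// [leRHS]mulrC.
  have i0 : 0 <= pairing (tpow (R := R) (k := k) (b := b) m.+1%:R) f0.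
    by apply: (pairing_ge0 (dens_adm df0)) => v v0; exact: (tpow_ge0 al_ge1 erefl m0 v0).
  apply: ler_pM => //; rewrite ?expR_ge0// ler_expR pq.
  rewrite (_ : _ * (tau / q) = (1 + lambda) * (8 * D ^+ 2) * tau); last by field; rewrite gt_eqF.
  rewrite ler_wpM2l//; apply: mulr_ge0; first by rewrite addr_ge0// ltW.
  by apply: mulr_ge0 => //; exact: sqr_ge0.
apply: (@le_trans _ _ (2 / kap * (e * kap / 2))).
  by rewrite ler_wpM2l// divr_ge0// ltW.
by rewrite le_eqVlt; apply/orP; left; apply/eqP; field; rewrite gt_eqF.
Qed.

End moment_tail.

(** * Uniform absolute continuity *)

Section domination.
Context {R : realType}.
Local Notation mu := (@lebesgue_measure R).
Local Notation Rp := (@Rplus R).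
Implicit Types (al : R) (w phi psi g : R -> R).

Definition expw (v : R) := expR (- v).

Lemma measurable_expw : measurable_fun setT expw.
Proof. by apply: measurableT_comp => //; exact: measurableT_comp. Qed.

Lemma adm_expw al : 0 < al -> adm al expw.
Proof.
move=> al0; have := adm_expRN al0 ltr01.
by under eq_fun do rewrite mul1r.
Qed.

Lemma smooth_expw : smooth expw.
Proof.
have := @smooth_expRM R (-1).
by under eq_fun do rewrite mulN1r.
Qed.

Lemma smooth_expoly P : smooth (expoly (R := R) P).
Proof.
have -> : expoly P = fun v => \sum_(i < size P) (P`_i * expR (- i%:R * v)).
  apply/funext => v; rewrite /expoly horner_coef; apply: eq_bigr => i _.
  by rewrite -expRM_natl mulNr mulrN.
by apply: smooth_sum => i; apply: smoothZ; exact: smooth_expRM.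
Qed.

Lemma pairing_mulw phi w g : pairing phi (fun v => w v * g v) = pairing (fun v => phi v * w v) g.
Proof. by apply: eq_Rintegral => v _; rewrite mulrA. Qed.

Lemma adm_bM al w g : adm al g -> measurable_fun setT w ->
  (forall v, 0 <= w v) -> (forall v, 0 <= v -> w v <= 1) -> adm al (fun v => w v * g v).
Proof.
move=> ag mw w0 w1; have [mg g0 ig] := ag; split.
- exact: measurable_funM.
- by move=> v; rewrite mulr_ge0.
have tt : tame al (fun v => w v * (1 + v `^ al)).
  apply: (tame_bM (M := 1)) => //; first exact: tame_weight.
  by move=> v v0; rewrite ger0_norm ?w1.
have := tame_integrable ag tt; apply: eq_integrable; first exact: measurable_Rplus.
by move=> v _ /=; rewrite mulrAC mulrC mulrA.
Qed.

Lemma measurable_superlevel g c : measurable_fun setT g -> measurable [set v : R | c < g v].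
Proof.
move=> mg; have := mg measurableT _ (@measurable_itv R `]c, +oo[); rewrite setTI.
by congr measurable; apply/seteqP; split => x /=; rewrite in_itv /= andbT.
Qed.

Lemma expw_itv v : 0 <= v -> 0 <= expw v <= 1.
Proof. by move=> v0; rewrite expR_ge0 /= -[leRHS]expR0 ler_expR oppr_le0. Qed.

Section dominated_measurable.
Context {al K y : R} {g : R -> R}.
Hypotheses (al_gt0 : 0 < al) (dg : dens al g) (K_ge0 : 0 <= K) (hg : smooth_dominated g K y).

Let ag := dens_adm dg.
Let aw : adm al expw := adm_expw al_gt0.
Let G v := expw v * g v.
Let H v := K * expw v.
Let aH : adm al H. Proof. exact: adm_scale. Qed.
Let aG : adm al G.
Proof.
by apply: (adm_bM ag measurable_expw) => v; [exact: expR_ge0|move=> /expw_itv/andP[]].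
Qed.

(** If P(exp(-v)) approximates the indicator, P(exp(-v)) exp(-v) is a smooth test with values in
    [0, 1]. The factor exp(-v) makes its Lebesgue integral finite. *)
Let dominated_set A : measurable A -> pairing \1_A G <= pairing \1_A H + y.
Proof.
move=> mA; apply/ler_addgt0Pl => e e0.
(* Approximation for the sum of the two weights keeps the two errors together below e. *)
have [P [P01 hP]] := approx_set (adm_add aG aH) mA e0.
have td : tame al (fun v => `|\1_A v - expoly P v|) by exact: tame_dist.
rewrite (pairing_weightD aG aH)// in hP.
have tP : tame al (expoly P) by exact: tame_expoly.
have tA : tame al (\1_A : R -> R) by exact: tame_ind.
have h1 : pairing \1_A G <= pairing (expoly P) G + pairing (fun v => `|\1_A v - expoly P v|) G.
  rewrite -(pairingD aG)//; apply: (pairing_le aG) => //; first exact: tameD.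
  by move=> v v0; have := ler_norm (\1_A v - expoly P v); lra.
have h2 : pairing (expoly P) H <= pairing \1_A H + pairing (fun v => `|\1_A v - expoly P v|) H.
  rewrite -(pairingD aH)//; apply: (pairing_le aH) => //; first exact: tameD.
  by move=> v v0; have := ler_norm (expoly P v - \1_A v); rewrite distrC; lra.
have h3 : pairing (expoly P) G <= pairing (expoly P) H + y.
  rewrite pairing_mulw (pairing_weightZ K aw tP); apply: hg.
  - by apply: smoothM; [exact: smooth_expoly|exact: smooth_expw].
  - move=> v v0; have /andP[a1 a2] := P01 v v0; have /andP[b1 b2] := expw_itv v0.
    by rewrite mulr_ge0//= mulr_ile1.
  - by rewrite (pairing_fin_num aw tP).
lra.
Qed.

(** Among all psi with values in [0, 1], the integral of psi exp(-v) (g - K) is largest for the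
    indicator of {g > K}, so the case of sets suffices. *)
Lemma dominated_measurable psi : measurable_fun setT psi ->
  (forall v, 0 <= v -> 0 <= psi v <= 1) ->
  pairing (fun v => psi v * expw v) g <= K * pairing psi expw + y.
Proof.
move=> mpsi hpsi; rewrite -pairing_mulw.
have tpsi : tame al psi.
  by apply: (@tame_bounded _ _ _ 1) => // v v0; have /andP[h1 h2] := hpsi _ v0; rewrite ger0_norm.
rewrite -(pairing_weightZ K aw tpsi).
pose A := [set v | K < g v].
have mA : measurable A by apply: measurable_superlevel; exact: dens_measurable dg.
have tA : tame al (\1_A : R -> R) by exact: tame_ind.
have h : pairing psi G + pairing \1_A H <= pairing psi H + pairing \1_A G.
  have mR := @measurable_Rplus R.
  have i1 := tame_integrable aG tpsi; have i2 := tame_integrable aH tpsi.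
  have i3 := tame_integrable aG tA; have i4 := tame_integrable aH tA.
  rewrite /pairing -!RintegralD//; apply: le_Rintegral => //.
  - exact: (integrableD mR i1 i4).
  - exact: (integrableD mR i2 i3).
  move=> v; rewrite RplusE => v0; have /andP[p0 p1] := hpsi v v0.
  have /andP[e0 _] := expw_itv v0.
  rewrite /G /H indicE; case: (pselect (A v)) => [/[dup] Kg|] Av; last first.
    move: (Av) => /negP; rewrite -leNgt => gK; rewrite memNset// !mul0r !addr0 ler_wpM2l//.
    by rewrite mulrC ler_wpM2r.
  rewrite mem_set// !mul1r -subr_ge0.
  rewrite (_ : _ - _ = (1 - psi v) * (expw v * (g v - K))); last by ring.
  by rewrite !mulr_ge0// subr_ge0// ltW.
have := dominated_set mA; lra.
Qed.

End dominated_measurable.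

(** Cut g at the height n: the part of g on {g > n} has small integral for large n, and the rest is
    at most n. *)
Lemma smooth_dominated_cvg al g : 0 < al -> dens al g -> forall e, 0 < e ->
  exists2 K, 0 <= K & smooth_dominated g K e.
Proof.
move=> al0 dg e e0; have ag := dens_adm dg; have mg := dens_measurable dg.
pose A (n : nat) := [set v | n%:R < g v].
have mA n : measurable (A n) by exact: measurable_superlevel.
have h : pairing (\1_(A n)) g @[n --> \oo] --> pairing (fun=> 0) g.
  apply: (pairing_dct ag _ _ (tame_cst al 1)) => //.
  by move=> n v _; have /andP[? ?] := ind_itv (A n) v; rewrite ger0_norm.
  apply: aeW => v _; apply: cvg_near_cst; exists (Num.truncn (g v)).+1 => // n /= hn.
  rewrite indicE; case: (pselect (A n v)) => h; last by rewrite memNset.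
  exfalso; move: h; rewrite /A /= => h.
  have := truncnS_gt (g v); have : (Num.truncn (g v)).+1%:R <= n%:R :> R by rewrite ler_nat.
  by move=> /(lt_le_trans _) h1 /h1 /lt_trans/(_ h); rewrite ltxx.
rewrite (pairing0 ag) in h; have /cvgrPdist_le/(_ _ e0)[n _ /(_ n (leqnn n))] := h.
rewrite sub0r normrN => /(le_trans (ler_norm _)) hn.
exists n%:R => // phi c sphi phi01 hc.
have tphi : tame al phi := tame_01 sphi phi01; have tA : tame al (\1_(A n) : R -> R) by exact: tame_ind.
have mphi := smooth_measurable sphi; have mR := @measurable_Rplus R.
have phi0 v : 0 <= v -> 0 <= phi v by move=> /phi01/andP[].
suff : ((pairing phi g)%:E <= (n%:R * c)%:E + (pairing \1_(A n) g)%:E)%E.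
  by rewrite -EFinD lee_fin => /le_trans; apply; rewrite lerD2l.
rewrite -!(pairing_fin_num ag)//.
apply: (@le_trans _ _ (\int[mu]_(v in Rp) ((n%:R * phi v)%:E + (\1_(A n) v * g v)%:E))%E).
  apply: ge0_le_integral => //.
  - by move=> v; rewrite RplusE => v0; rewrite lee_fin mulr_ge0 ?phi0 ?(dens_ge0 dg).
  - by apply/measurable_EFinP; apply: measurable_funTS; exact: measurable_funM.
  - apply: emeasurable_funD; apply/measurable_EFinP; apply: measurable_funTS; apply: measurable_funM => //.
    exact: measurable_ind.
  - move=> v; rewrite RplusE => v0; rewrite -EFinD lee_fin.
    have /andP[a0 a1] := phi01 v v0; have g0 := dens_ge0 dg v.
    rewrite indicE; case: (pselect (A n v)) => Av.
      by rewrite mem_set// mul1r ler_wpDl ?mulr_ge0// ler_piMl.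
    by move: (Av) => /negP; rewrite -leNgt => gn; rewrite memNset// mul0r addr0 mulrC ler_wpM2r.
rewrite ge0_integralD//=; first last.
- by apply/measurable_EFinP; apply: measurable_funTS; apply: measurable_funM => //; exact: measurable_ind.
- by move=> v _; rewrite lee_fin mulr_ge0 ?(dens_ge0 dg).
- by apply/measurable_EFinP; apply: measurable_funTS; exact: measurable_funM.
- by move=> v; rewrite RplusE => v0; rewrite lee_fin mulr_ge0 ?phi0.
rewrite leeD2r//; under eq_integral do rewrite EFinM.
rewrite ge0_integralZl//.
- by rewrite EFinM lee_wpmul2l// lee_fin.
- by apply/measurable_EFinP; apply: measurable_funTS.
- by move=> v; rewrite RplusE => v0; rewrite lee_fin phi0.
Qed.

Lemma smooth_dominated_scale g K y c : 0 < c -> measurable_fun setT g -> smooth_dominated g K y ->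
  smooth_dominated (fun v => c * g (c * v)) (K * c) y.
Proof.
move=> c0 mg hg phi d sphi phi01 hd.
rewrite (pairing_scale c0)//; last exact: smooth_measurable.
have ci : 0 < c^-1 by rewrite invr_gt0.
(* A dilation is the shift with p = c^-1, q = 1 and w = 0. *)
have := integral_shift_le ltr01 ci sphi phi01 (lexx 0) hd.
rewrite invrK => h.
rewrite -mulrA [c * d]mulrC; apply: hg.
- have := smooth_affine c^-1 0 sphi.
  by under eq_fun do rewrite addr0.
- by move=> v v0; apply: phi01; rewrite mulr_ge0// ltW.
- by apply: le_trans h; under [X in (_ <= X)%E]eq_integral do rewrite mulr0 addr0.
Qed.

End domination.

Section equi.
Context {R : realType} {al : R}.
Implicit Types (psi g : R -> R) (F : (R -> R) -> Prop).

(* Uniform absolute continuity of the measures (1 + v^al) g(v) dv with respect to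
   exp(-v) dv: it excludes concentration and loss of mass at infinity. *)
Definition equi F := forall e, 0 < e -> exists2 K, 0 <= K & forall g, F g ->
  forall psi, measurable_fun setT psi -> (forall v, 0 <= v -> 0 <= psi v <= 1) ->
  pairing (fun v => psi v * (1 + v `^ al)) g <= K * pairing psi expw + e.

End equi.
Arguments equi {R} al F.

Section scaled_equi.
Context {R : realType}.
Context {al lambda : R} {f0 : R -> R}.
Hypotheses (al_ge1 : 1 <= al) (lambda_gt0 : 0 < lambda).
Hypothesis df0 : dens al f0.
Hypothesis mf0 : mean f0 = 1.

(** Parameters, solution and time are quantified inside, so that the constants of [equi] are uniform
    in all of them. *)
Definition scaled_family T (g : R -> R) := exists p q f tau,
  [/\ 2^-1 <= p <= 2, 0 < q <= 1, (p - 1) ^+ 2 = lambda * q,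
     boltzmann_weak_solution p q al f0 f & 0 < tau <= T /\ g = scaled (f := f) (tau / q)].

Lemma scaled_family_equi T : equi al (scaled_family T).
Proof.
have al_gt0 : 0 < al by exact: lt_le_trans al_ge1.
move=> e e0; have e20 : 0 < e / 2 by rewrite divr_gt0.
have [rho rho1 hrho] := moment_tail al_ge1 lambda_gt0 df0 mf0 T e20.
have rho0 : 0 <= rho by exact: le_trans rho1.
(* On [0, rho[ the weight 1 + v^al is at most C exp(-v), which leads to [dominated_measurable];
   beyond rho the tail bound takes over. *)
pose C := (1 + rho `^ al) * expR rho.
have C0 : 0 < C by rewrite mulr_gt0 ?expR_gt0// ltr_wpDr ?powR_ge0.
have eC : 0 < e / 2 / C by rewrite divr_gt0.
have [K K0 hK] := smooth_dominated_cvg al_gt0 df0 eC.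
pose L := expR ((2 * lambda + 1) * T).
exists (C * (K * L)); first exact: mulr_ge0 (ltW C0) (mulr_ge0 K0 (expR_ge0 _)).
move=> _ [p [q [f [tau [/[dup] hp /andP[p1 p2] /[dup] hq /andP[q0 q1] pq sol [/[dup] htau /andP[tau0 tauT] ->]]]]]].
move=> psi mpsi psi01.
have p0 : 0 < p by lra.
have t0 : 0 < tau / q by rewrite divr_gt0.
set g := scaled (tau / q).
have dg : dens al g by exact: scaled_dens q0 p0 al_ge1 mf0 sol _ t0.
have ag := dens_adm dg.
have domg : smooth_dominated g (K * L) (e / 2 / C).
  have m0 : 0 < mean (f (tau / q)).
    by rewrite (sol_mean q0 p0 al_ge1 sol t0) mf0 mulr1 expR_gt0.
  have h1 := sol_dominated q0 p0 al_ge1 df0 sol K0 hK t0.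
  have h2 := smooth_dominated_scale m0 (dens_measurable (sol_dens sol t0)) h1.
  move=> phi c sphi phi01 hc; apply: le_trans (h2 phi c sphi phi01 hc) _.
  have c0 : 0 <= c.
    rewrite -lee_fin; apply: le_trans hc; apply: integral_ge0 => v; rewrite RplusE => v0.
    by rewrite lee_fin; have /andP[] := phi01 v v0.
  rewrite lerD2r ler_wpM2r// -mulrA ler_wpM2l//.
  rewrite (sol_mean q0 p0 al_ge1 sol t0) mf0 mulr1 -expRD ler_expR.
  (* The terms of first order in p - 1 cancel between the growth of K and that of the mean. With p
     >= 1/2 the remaining rate is at most 2 lambda + 1. *)
  rewrite (_ : (p^-1 - 1) * (tau / q) + (p + q - 1) * (tau / q) = (lambda * p^-1 + 1) * tau).
    apply: ler_pM => //; rewrite ?(ltW tau0)//.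
      by rewrite addr_ge0// mulr_ge0 ?invr_ge0 ?ltW.
    rewrite lerD2r [2 * _]mulrC ler_wpM2l ?(ltW lambda_gt0)//.
    by rewrite -[2]invrK lef_pV2 ?posrE.
  rewrite (_ : lambda = (p - 1) ^+ 2 / q); last by rewrite pq mulfK// gt_eqF.
  by field; rewrite !gt_eqF.
have dom := dominated_measurable al_gt0 dg (mulr_ge0 K0 (expR_ge0 _)) domg mpsi psi01.
have tail := hrho p q f tau hp hq pq sol htau.
have tpsi : tame al psi.
  by apply: (@tame_bounded _ _ _ 1) => // v v0; have /andP[h1 h2] := psi01 _ v0; rewrite ger0_norm.
have mI : measurable [set x : R | rho <= x].
  rewrite (_ : [set x | _] = `[rho, +oo[%classic); first exact: measurable_itv.
  by apply/seteqP; split => x /=; rewrite in_itv /= andbT.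
have t1 : tame al (fun v => \1_[set x : R | rho <= x] v * (1 + v `^ al)).
  apply: (tame_bM (M := 1) (tame_weight al)); first exact: measurable_ind.
  by move=> v _; have /andP[? ?] := ind_itv [set x : R | rho <= x] v; rewrite ger0_norm.
have t2 : tame al (fun v => psi v * expw v).
  have := tame_bM (M := 1) tpsi (@measurable_expw R).
  under eq_fun do rewrite mulrC.
  by apply => v /expw_itv/andP[? ?]; rewrite ger0_norm.
have t3 : tame al (fun v => psi v * (1 + v `^ al)).
  apply: (tame_bM (M := 1) (tame_weight al)) => //.
  by move=> v /psi01/andP[? ?]; rewrite ger0_norm.
apply: (@le_trans _ _ (C * pairing (fun v => psi v * expw v) g +
   pairing (fun v => \1_[set x : R | rho <= x] v * (1 + v `^ al)) g)).
  rewrite -(pairingZ ag)// -(pairingD ag)//; last exact: tameZ.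
  apply: (pairing_le ag) => //; first by apply: tameD => //; exact: tameZ.
  move=> v v0; have /andP[s0 s1] := psi01 v v0; have W0 := weight_ge0 al v.
  rewrite indicE; have [vrho|vrho] := leP rho v.
    rewrite mem_set// mul1r; apply: (@le_trans _ _ (1 + v `^ al)).
      by rewrite ler_piMl.
    by rewrite lerDr; exact: mulr_ge0 (ltW C0) (mulr_ge0 s0 (expR_ge0 _)).
  rewrite memNset; last by apply/negP; rewrite -ltNge.
  rewrite mul0r addr0 /C /expw.
  rewrite mulrCA ler_wpM2l// -mulrA -expRD -[leLHS]mulr1.
  apply: ler_pM => //.
    by rewrite lerD2l ge0_ler_powR ?nnegrE ?(ltW al_gt0)// ltW.
  by rewrite -[leLHS]expR0 ler_expR subr_ge0 ltW.
have := ler_wpM2l (ltW C0) dom.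
rewrite mulrDr [C * (e / 2 / C)]mulrC divfK ?gt_eqF// mulrA -/L; move: tail.
by move: (pairing _ g) (pairing _ g) (pairing psi expw) => X Y Z; lra.
Qed.

End scaled_equi.

(** * Consistency on exponentials *)

Section exponential_remainders.
Context {R : realType}.
Implicit Types (x z a c : R).

Let dexp x : derivable (@expR R) x 1.
Proof. exact: is_derive_derivable (is_derive_expR x). Qed.

Lemma between0 x c : Num.min 0 x <= c <= Num.max 0 x -> `|c| <= `|x|.
Proof.
rewrite ge_min le_max => /andP[]; case: (leP 0 x) => x0.
  rewrite (ger0_norm x0) => /orP[] ? /orP[] ?; rewrite ler_norml; apply/andP; split; lra.
rewrite (ltr0_norm x0) => /orP[] ? /orP[] ?; rewrite ler_norml; apply/andP; split; lra.
Qed.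

Lemma expR_taylor1 x : `|expR x - 1| <= `|x| * expR `|x|.
Proof.
have [c /between0 hc] := MVT_eq dexp 0 x.
rewrite expR0 subr0 => ->; rewrite (is_derive_derive1 (is_derive_expR c)) normrM mulrC.
by rewrite ler_wpM2l// ger0_norm ?expR_ge0// ler_expR (le_trans (ler_norm _)).
Qed.

Lemma expR_taylor2 x : `|expR x - 1 - x| <= `|x| ^+ 2 * expR `|x|.
Proof.
have hd (y : R) : is_derive y 1 (fun y => expR y - y) (expR y - 1).
  exact: is_deriveB (is_derive_expR y) (is_derive_id y 1).
have [c /between0 hc] := MVT_eq (fun y => is_derive_derivable (hd y)) 0 x.
rewrite expR0 !subr0 (is_derive_derive1 (hd c)) addrAC => ->.
rewrite normrM mulrC expr2 -mulrA ler_wpM2l//; apply: (le_trans (expR_taylor1 c)).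
by apply: ler_pM => //; rewrite ?expR_ge0// ler_expR.
Qed.

Lemma expR_taylor3 x : `|expR x - 1 - x - x ^+ 2 / 2| <= `|x| ^+ 3 * expR `|x|.
Proof.
have hd (y : R) : is_derive y 1 (fun y => expR y - y - y * y / 2) (expR y - 1 - y).
  have h1 := is_deriveB (is_derive_expR y) (is_derive_id y 1).
  have h2 := is_deriveM1 (is_deriveM1 (is_derive_id y 1) (is_derive_id y 1)) (is_derive_cst (2^-1 : R) y 1).
  have := is_deriveB h1 h2; rewrite (_ : expR y - 1 - _ = expR y - 1 - y); last by rewrite /cst; field.
  by [].
have [c /between0 hc] := MVT_eq (fun y => is_derive_derivable (hd y)) 0 x.
rewrite expR0 !mul0r !subr0 (is_derive_derive1 (hd c)) => h.
rewrite (_ : _ - _ = (expR c - 1 - c) * x); last by rewrite -h; ring.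
rewrite normrM mulrC exprS -mulrA ler_wpM2l//; apply: (le_trans (expR_taylor2 c)).
by apply: ler_pM => //; rewrite ?expR_ge0 ?ler_expR ?exprn_ge0//; apply: lerXn2r; rewrite ?nnegrE.
Qed.

(** Interpolates between the remainders of first and second order. The exponent g will be min(al,
    2): the available moment limits it, and g > 1 makes the error o(q). *)
Lemma expRN_remainder z g : 0 <= z -> 1 <= g <= 2 ->
  0 <= expR (- z) - 1 + z <= expR 1 * z `^ g.
Proof.
move=> z0 /andP[g1 g2]; apply/andP; split.
  by have := expR_ge1Dx (- z); lra.
have e1 : 1 <= expR 1 :> R by apply: le_trans (expR_ge1Dx _); lra.
have [z1|z1] := leP z 1.
  have := le_trans (ler_norm _) (expR_taylor2 (- z)); rewrite opprK normrN ger0_norm// => h.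
  apply: (le_trans h); rewrite mulrC; apply: ler_pM; rewrite ?expR_ge0 ?sqr_ge0 ?ler_expR//.
  move: z0; rewrite le_eqVlt => /predU1P[<-|z0]; first by rewrite expr0n /= powR_ge0.
  by rewrite -powR_mulrn ?(ltW z0)//; apply: ger_powR; rewrite ?z0.
have : expR (- z) <= 1 by rewrite -[leRHS]expR0 ler_expR; lra.
have h2 : z <= z `^ g by rewrite -{1}(powRr1 z0) ler_powR// ltW.
by have := powR_ge0 z g; nra.
Qed.

Lemma expRN_bounded n z : 0 <= z -> z ^+ n.+1 * expR (- (z / 2)) <= (2 * n.+1%:R) ^+ n.+1.
Proof.
move=> z0; have n0 : 0 < n.+1%:R :> R by rewrite ltr0n.
have := @powR_le_expR R n.+1%:R 2^-1 z n0 _ z0; rewrite invr_gt0 => /(_ (ltr0n _ 2)).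
rewrite !powR_mulrn ?divr_ge0 ?invr_ge0// invrK [n.+1%:R * 2]mulrC => h.
have := ler_wpM2r (expR_ge0 (- (z / 2))) h.
by rewrite -[leRHS]mulrA -expRD [z / 2]mulrC subrr expR0 mulr1.
Qed.

End exponential_remainders.

Section exponential_functions.
Context {R : realType}.
Implicit Types (c v w : R).

Definition ec (c v : R) : R := expR (- (c * v)).

Lemma ec_le1 c v : 0 <= c -> 0 <= v -> ec c v <= 1.
Proof. by move=> c0 v0; rewrite -[leRHS]expR0 ler_expR oppr_le0 mulr_ge0. Qed.

Lemma smooth_ec c : smooth (ec c).
Proof. by apply: smooth_ext (smooth_expRM (- c)) => v; rewrite mulNr. Qed.

Lemma measurable_ec c : measurable_fun setT (ec c).
Proof. apply: smooth_measurable. exact: smooth_ec. Qed.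

Lemma is_derive_ec c v : is_derive v 1 (ec c) (- c * ec c v).
Proof.
have := is_derive_expRM (- c) v.
suff e : ec c = fun x => expR (- c * x) by rewrite e.
by apply/funext => x; rewrite /ec mulNr.
Qed.

Lemma derive_ec c : derive1 (ec c) = fun v => - c * ec c v.
Proof. by apply/funext => v; exact: is_derive_derive1 (is_derive_ec c v). Qed.

Lemma derive2_ec c : derive1 (derive1 (ec c)) = fun v => c ^+ 2 * ec c v.
Proof.
apply/funext => v; rewrite derive_ec.
rewrite (is_derive_derive1 (is_deriveZ (- c) (is_derive_ec c v))) /GRing.scale /=; ring.
Qed.

Lemma ec_moment_bounded n c v : 0 <= c -> 0 <= v ->
  0 <= (c * v) ^+ n * ec c v <= (2 * n%:R) ^+ n.
Proof.
move=> c0 v0; have z0 : 0 <= c * v by exact: mulr_ge0.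
rewrite mulr_ge0 ?exprn_ge0 ?expR_ge0//=.
case: n => [|n]; first by rewrite !expr0 mul1r; exact: ec_le1.
apply: le_trans (expRN_bounded n z0); rewrite ler_wpM2l ?exprn_ge0// ler_expR; lra.
Qed.

Lemma tame_ec_moment al n c : 0 <= c -> tame al (fun v => (c * v) ^+ n * ec c v).
Proof.
move=> c0; apply: (@tame_bounded _ _ _ ((2 * n%:R) ^+ n)).
  apply: measurable_funM; first by apply: measurable_funX; exact: measurable_funM.
  exact: measurable_ec.
by move=> v v0; have /andP[h1 h2] := ec_moment_bounded n c0 v0; rewrite ger0_norm.
Qed.

Lemma tame_ec al c : 0 <= c -> tame al (ec c).
Proof. by move=> c0; have := tame_ec_moment al 0 c0; under eq_fun do rewrite expr0 mul1r. Qed.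

Lemma test2_ec al c : 0 <= c -> test2 al (ec c).
Proof.
move=> c0; split; first exact: smooth_ec.
- exact: tame_ec.
- rewrite derive_ec; have := tameZ (-1) (tame_ec_moment al 1 c0).
  by congr tame; apply/funext => v; rewrite expr1; ring.
- rewrite derive2_ec; have := tame_ec_moment al 2 c0.
  by congr tame; apply/funext => v; ring.
Qed.

(** Formal adjoint of the Fokker-Planck operator, acting on test functions. *)
Definition fp lambda (phi : R -> R) v :=
  lambda / 2 * (v ^+ 2 * derive1 (derive1 phi) v) - (v - 1) * derive1 phi v.

Lemma tame_fp_ec al lambda c : 0 <= c -> tame al (fp lambda (ec c)).
Proof.
move=> c0; have [_ _ t1 t2] := test2_ec al c0.
have t3 : tame al (derive1 (ec c)) by rewrite derive_ec; apply: tameZ; exact: tame_ec.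
have := tameB (tameZ (lambda / 2) t2) (tameB t1 t3).
by congr tame; apply/funext => v; rewrite /fp; ring.
Qed.

Lemma powR_minW al w : 0 <= w -> 1 <= al -> w `^ (Num.min al 2) <= 1 + w `^ al.
Proof.
move=> w0 al1; have := powR_ge0 w al; have [w1|w1] := leP w 1.
  move=> h; apply: (@le_trans _ _ 1); last by rewrite lerDl.
  move: w0; rewrite le_eqVlt => /predU1P[<-|w0].
    by rewrite powR0 ?ler01// gt_eqF// lt_min (lt_le_trans ltr01 al1) ltr0n.
  rewrite -[leRHS](powRr0 w); apply: ger_powR; rewrite ?w0 ?w1//.
  by rewrite le_min (le_trans ler01 al1) ler0n.
move=> _; apply: (@le_trans _ _ (w `^ al)); last by rewrite lerDr.
by rewrite ler_powR ?(ltW w1)// ge_min lexx.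
Qed.

(** The gain is E exp(x) exp(-s) with z = cv, E = exp(-z), x = -(p - 1) z and s = cqw. In it, E x is
    the linear term removed by the scaling, E x^2/2 is the diffusion because (p - 1)^2 = lambda q,
    and -s E is the transport by w. What remains is of third order in x, beyond first order in s, or
    mixed. *)
Lemma ec_gain al lambda c p q v w : 1 <= al -> 0 <= c -> `|p - 1| <= 2^-1 -> 0 < q ->
  (p - 1) ^+ 2 = lambda * q -> 0 <= v -> 0 <= w ->
  `|ec c (p * v + q * w) - ec c v - (p + q - 1) * (v * derive1 (ec c) v)
    - q * (lambda / 2 * (v ^+ 2 * derive1 (derive1 (ec c)) v) - v * derive1 (ec c) v
           + w * derive1 (ec c) v)| <=
  q * (216 * lambda * `|p - 1| + 2 * c * `|p - 1| * w
       + expR 1 * c `^ (Num.min al 2) * q `^ (Num.min al 2 - 1) * (1 + w `^ al)).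
Proof.
move=> al1 c0 hp q0 pq v0 w0; rewrite derive2_ec derive_ec.
set g := Num.min al 2; set a := p - 1 in hp pq *.
have g12 : 1 <= g <= 2 by rewrite le_min al1 ler1n ge_min lexx orbT.
have z0 : 0 <= c * v by exact: mulr_ge0.
set z := c * v in z0; have qw0 : 0 <= c * (q * w) by rewrite !mulr_ge0// ltW.
(* As |p - 1| <= 1/2, half of the decay of E absorbs exp|x|. *)
have ez : expR (- z) * expR `|- (a * z)| <= expR (- (z / 2)).
  rewrite -expRD ler_expR normrN normrM (ger0_norm z0).
  by have := ler_wpM2r z0 hp; lra.
set E := expR (- z) in ez *; set x := - (a * z) in ez *; set s := c * (q * w) in qw0 *.
have E0 : 0 <= E by exact: expR_ge0.
have pE : p = 1 + a by rewrite /a addrC subrK.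
have dec : ec c (p * v + q * w) = E * expR x * expR (- s).
  by rewrite /ec -!expRD; congr expR; rewrite /x /s /z pE; ring.
(* This turns the third order in p - 1 into q times a quantity that tends to 0. *)
have aq : `|a| ^+ 3 = lambda * `|a| * q by rewrite exprS real_normK ?num_real// pq; ring.
have T1 : `|E * (expR x - 1 - x - x ^+ 2 / 2)| <= q * (216 * lambda * `|a|).
  rewrite normrM (ger0_norm E0).
  apply: (le_trans (ler_wpM2l E0 (expR_taylor3 x))).
  apply: (@le_trans _ _ (`|x| ^+ 3 * expR (- (z / 2)))).
    by rewrite mulrCA ler_wpM2l ?exprn_ge0.
  rewrite (_ : `|x| ^+ 3 = (lambda * `|a| * q) * z ^+ 3); last first.
    by rewrite /x normrN normrM (ger0_norm z0) exprMn aq.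
  have := expRN_bounded 2 z0; rewrite (_ : (2 * 3) ^+ 3 = 216 :> R); last by ring.
  have k0 : 0 <= lambda * `|a| * q by rewrite -aq exprn_ge0.
  by move=> h; have := ler_wpM2l k0 h; lra.
have T2 : `|E * expR x * (expR (- s) - 1 + s)| <= expR 1 * s `^ g.
  have /andP[r0 r1] := expRN_remainder qw0 g12.
  have e1 : E * expR x <= 1.
    rewrite -expRD -[leRHS]expR0 ler_expR /x.
    have := ler_norm (- a); rewrite normrN => h1; have := ler_wpM2r z0 h1.
    have := ler_wpM2r z0 hp; lra.
  rewrite !normrM (ger0_norm E0) (ger0_norm (expR_ge0 _)) (ger0_norm r0).
  apply: le_trans r1; rewrite ler_piMl//.
have T3 : `|s * (E * (1 - expR x))| <= s * (2 * `|a|).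
  rewrite normrM (ger0_norm qw0) ler_wpM2l// normrM (ger0_norm E0) distrC.
  apply: (le_trans (ler_wpM2l E0 (expR_taylor1 x))).
  apply: (@le_trans _ _ (`|x| * expR (- (z / 2)))); first by rewrite mulrCA ler_wpM2l.
  have := expRN_bounded 0 z0; rewrite !expr1 mulr1 => h.
  by rewrite /x normrN normrM (ger0_norm z0) -mulrA [leRHS]mulrC ler_wpM2l.
have T4 : s `^ g <= q * (c `^ g * q `^ (g - 1) * (1 + w `^ al)).
  have g0 : 0 < g by lra.
  rewrite /s powRM ?mulr_ge0 ?(ltW q0)// powRM ?(ltW q0)// -(mulr_powRB1 (ltW q0) g0).
  rewrite (_ : q * (_ * _ * _) = c `^ g * (q * q `^ (g - 1) * (1 + w `^ al))); last by ring.
  rewrite ler_wpM2l ?powR_ge0// ler_wpM2l ?mulr_ge0 ?powR_ge0 ?(ltW q0)//.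
  exact: powR_minW.
rewrite (_ : _ - q * _ = E * (expR x - 1 - x - x ^+ 2 / 2) + (E * expR x * (expR (- s) - 1 + s) + s * (E * (1 - expR x)))); last first.
  rewrite dec /ec -/z -/E.
  rewrite (_ : q * _ = (q * lambda) / 2 * (z ^+ 2 * E) + q * (z * E) - s * E); last by rewrite /z /s; field.
  rewrite [q * lambda]mulrC -pq (_ : v * (- c * E) = - (z * E)); last by rewrite /z; ring.
  by rewrite pE /x; field.
apply: (le_trans (ler_normD _ _)); apply: (le_trans (lerD (lexx _) (ler_normD _ _))).
have e0 := expR_ge0 (1 : R); have := ler_wpM2l e0 T4.
have sE : s * (2 * `|a|) = q * (2 * c * `|a| * w) by rewrite /s; ring.
rewrite sE in T3; lra.
Qed.

Lemma min_gt1 (al : R) : 1 < al -> 0 < Num.min al 2 - 1.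
Proof. by move=> h; rewrite subr_gt0 lt_min h ltr1n. Qed.

End exponential_functions.

Section consistency.
Context {R : realType}.
Context {p q al lambda : R} {f0 : R -> R} {f : R -> R -> R}.
Hypotheses (q_gt0 : 0 < q) (p_gt0 : 0 < p) (al_ge1 : 1 <= al).
Hypothesis mf0 : mean f0 = 1.
Hypothesis sol : boltzmann_weak_solution p q al f0 f.
Hypotheses (p_near1 : `|p - 1| <= 2^-1) (pqE : (p - 1) ^+ 2 = lambda * q).
Implicit Types (c t M : R).

(** Averaging w phi'(v) over w gives phi'(v) because the mean is 1; this produces the constant part
    of the drift towards 1. *)
Lemma ec_consistency c t M : 0 <= c -> 0 < t ->
  pairing (fun v => 1 + v `^ al) (scaled (f := f) t) <= M ->
  `|scaled_collision (p := p) (q := q) (f := f) (ec c) t / q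
    - pairing (fp lambda (ec c)) (scaled (f := f) t)| <=
  216 * lambda * `|p - 1| + 2 * c * `|p - 1|
  + expR 1 * c `^ (Num.min al 2) * q `^ (Num.min al 2 - 1) * M.
Proof.
move=> c0 t0 hM.
have dg := scaled_dens q_gt0 p_gt0 al_ge1 mf0 sol t0; have ag := dens_adm dg.
have tphi := test2_ec al c0; have [_ _ t1 t2] := tphi.
set g := scaled t in hM dg ag *.
pose B := derive1 (ec c).
pose A v := lambda / 2 * (v ^+ 2 * derive1 (derive1 (ec c)) v) - v * derive1 (ec c) v.
have tB : tame al B by rewrite /B derive_ec; apply: tameZ; exact: tame_ec.
have tA : tame al A by apply: tameB => //; exact: tameZ.
have tI := tame_id al_ge1.
have tPhi := tame2_scaled_gain q_gt0 p_gt0 al_ge1 tphi.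
set Phi := (fun v w => _) in tPhi.
have tL : tame2 al (fun v w => q * A v * 1 + q * B v * w).
  by apply: tame2D; apply: tame2M; rewrite ?tI//; [exact: tameZ|exact: tame_cst|exact: tameZ].
have tD : tame2 al (fun v w => Phi v w - q * (A v + w * B v)).
  have -> : (fun v w => Phi v w - q * (A v + w * B v)) =
     (fun v w => Phi v w + (- 1 * (q * A v) * 1 + - 1 * (q * B v) * w)).
    by apply/funext => v; apply/funext => w; ring.
  apply: tame2D => //; apply: tame2D; apply: tame2M => //; do ?exact: tame_cst.
    by do 2 apply: tameZ.
  by do 2 apply: tameZ.
have tW := tame_weight al.
have E : pairing (fun w => pairing (fun v => Phi v w - q * (A v + w * B v)) g) g =
    scaled_collision (p := p) (q := q) (f := f) (ec c) t - q * pairing (fp lambda (ec c)) g.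
  rewrite (scaled_collisionE q_gt0 p_gt0 al_ge1 mf0 sol t0 tphi) -/g.
  have -> : pairing (fp lambda (ec c)) g = pairing A g + pairing B g.
    rewrite -(pairingD ag)//; apply: eq_pairing => v _; rewrite /fp /A /B; ring.
  have tP := tame_pairing dg (tame2_swap tPhi).
  have -> : q * (pairing A g + pairing B g) = pairing (fun w => q * pairing A g + q * pairing B g * w) g.
    rewrite (pairingD ag (tame_cst _ _) (tameZ _ tI)) (dens_cst _ dg) (pairingZ ag _ tI).
    rewrite /g (scaled_mean q_gt0 p_gt0 al_ge1 mf0 sol t0); ring.
  rewrite -(pairingB ag) //; last by apply: tameD; [exact: tame_cst|exact: tameZ].
  apply: eq_pairing => w w0.
  have ts := tame2_section (tame2_swap tPhi) w0.
  rewrite (_ : q * pairing A g + _ = q * (pairing A g + w * pairing B g)); last by ring.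
  have -> : q * (pairing A g + w * pairing B g) = pairing (fun v => q * (A v + w * B v)) g.
    by rewrite (pairingZ ag q (tameD tA (tameZ w tB))) (pairingD ag tA (tameZ w tB)) (pairingZ ag w tB).
  by rewrite -(pairingB ag)//; apply: tameZ; apply: tameD => //; exact: tameZ.
rewrite (_ : _ / q - _ = (scaled_collision (p := p) (q := q) (f := f) (ec c) t - q * pairing (fp lambda (ec c)) g) / q); last by field; rewrite gt_eqF.
rewrite -E normrM (@ger0_norm _ q^-1) ?invr_ge0 ?(ltW q_gt0)// ler_pdivrMr//.
set X := 216 * lambda * `|p - 1|; set Y := 2 * c * `|p - 1|.
set Z := expR 1 * _ * _.
have Z0 : 0 <= Z by rewrite !mulr_ge0 ?expR_ge0 ?powR_ge0.
have tchi : tame al (fun w => q * (X + Y * w + Z * (1 + w `^ al))).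
  by apply: tameZ; apply: tameD; [apply: tameD; [exact: tame_cst|exact: tameZ]|exact: tameZ].
apply: (le_trans (double_pairing_norm_le dg tD (tame_cst al 0) tchi _)).
  move=> v w v0 w0; rewrite add0r; apply: le_trans (ec_gain al_ge1 c0 p_near1 q_gt0 pqE v0 w0).
  exact: lexx.
rewrite (pairing0 ag) add0r.
rewrite (pairingZ ag) ?(pairingD ag) ?(pairingZ ag Z tW) ?(pairingZ ag Y tI) ?(dens_cst _ dg) //; do ?exact: tame_cst; do ?exact: tameZ.
  rewrite /g (scaled_mean q_gt0 p_gt0 al_ge1 mf0 sol t0) mulr1 mulrC.
  by rewrite ler_wpM2r ?(ltW q_gt0)// lerD2l ler_wpM2l.
- by apply: tameD; [exact: tame_cst|exact: tameZ].
by apply: tameD; [apply: tameD; [exact: tame_cst|exact: tameZ]|exact: tameZ].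
Qed.

End consistency.

(** * Compactness *)

Section bounded_measurable.
Context {R : realType}.
Implicit Types (f g : R -> R) (P : (R -> R) -> Prop).

Definition bmeas f := measurable_fun setT f /\ exists M, forall v, 0 <= v -> `|f v| <= M.

Lemma bmeas_tame al f : bmeas f -> tame al f.
Proof. by move=> [mf [M hM]]; exact: tame_bounded mf hM. Qed.

Lemma bmeas_ind (A : set R) : measurable A -> bmeas (\1_A : R -> R).
Proof.
move=> mA; split; first exact: measurable_ind.
by exists 1 => v _; have /andP[h0 h1] := ind_itv A v; rewrite ger0_norm.
Qed.

Lemma bmeasD f g : bmeas f -> bmeas g -> bmeas (fun v => f v + g v).
Proof.
move=> [mf [M hM]] [mg [N hN]]; split; first exact: measurable_funD.
by exists (M + N) => v v0; apply: (le_trans (ler_normD _ _)); rewrite lerD ?hM ?hN.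
Qed.

Lemma bmeasZ c f : bmeas f -> bmeas (fun v => c * f v).
Proof.
move=> [mf [M hM]]; split; first exact: measurable_funM.
by exists (`|c| * M) => v v0; rewrite normrM ler_wpM2l ?hM.
Qed.

Section induction.
Variable P : (R -> R) -> Prop.
Hypothesis P_ind : forall A : set R, measurable A -> P \1_A.
Hypothesis PD : forall f g, bmeas f -> bmeas g -> P f -> P g -> P (fun v => f v + g v).
Hypothesis PZ : forall c f, bmeas f -> P f -> P (fun v => c * f v).
Hypothesis P_unif : forall f, bmeas f -> (forall e, 0 < e -> exists g,
  [/\ bmeas g, P g & forall v, 0 <= v -> `|f v - g v| <= e]) -> P f.

(* Binary digits: if [0 <= f <= 1] and [A] is the set where [2^-1 <= f], then
   [2 f - \1_A] takes its values in [0, 1] again. *)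
Let approx01 n f : measurable_fun setT f -> (forall v, 0 <= v -> 0 <= f v <= 1) ->
  exists g, [/\ bmeas g, P g & forall v, 0 <= v -> `|f v - g v| <= (2 ^- n)].
Proof.
elim: n f => [|n IH] f mf f01.
  exists (fun v => 0 * \1_setT v); split.
  - by apply: bmeasZ; exact: bmeas_ind.
  - by apply: PZ; [exact: bmeas_ind|exact: P_ind].
  - by move=> v v0; have /andP[? ?] := f01 v v0; rewrite mul0r subr0 ger0_norm// expr0 invr1.
pose A := [set v | 2^-1 <= f v].
have mA : measurable A.
  have := mf measurableT _ (@measurable_itv R `[2^-1, +oo[); rewrite setTI.
  by congr measurable; apply/seteqP; split => x /=; rewrite in_itv /= andbT.
have [|v v0|g [bg Pg hg]] := IH (fun v => 2 * f v - \1_A v).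
- by apply: measurable_funB; [exact: measurable_funM|exact: measurable_ind].
- have /andP[f0 f1] := f01 v v0; rewrite indicE; case: (pselect (A v)) => Av.
    by rewrite mem_set//; move: Av; rewrite /A /= => h; apply/andP; split; lra.
  rewrite memNset// subr0; have : f v < 2^-1 by move/negP: Av; rewrite -ltNge.
  by move=> h; apply/andP; split; lra.
have bA := bmeas_ind mA.
exists (fun v => 2^-1 * (\1_A v + g v)); split.
- by apply: bmeasZ; exact: bmeasD.
- by apply: PZ; [exact: bmeasD|apply: PD => //; exact: P_ind].
move=> v v0; rewrite (_ : f v - _ = 2^-1 * (2 * f v - \1_A v - g v)); last by field.
by rewrite normrM ger0_norm ?invr_ge0// exprS invfM ler_wpM2l ?invr_ge0// hg.
Qed.

(** The function (f + N)/(2N) takes values in [0, 1] on R_+, and n of its binary digits reproduce f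
    up to 2N 2^-n. *)
Lemma bounded_measurable_ind f : bmeas f -> P f.
Proof.
move=> bf; have [mf [M hM]] := bf; apply: P_unif => // e e0.
have M0 : 0 <= M by exact: le_trans (normr_ge0 _) (hM 0 (lexx 0)).
pose N := M + 1; have N0 : 0 < N by rewrite ltr_wpDl.
pose k v := (2 * N)^-1 * (f v + N).
have [n hn] : exists n, 2 * N * 2 ^- n <= e.
  pose m := (Num.truncn (2 * N / e)).+1; exists m.
  have h1 : 2 * N / e < m%:R by exact: truncnS_gt.
  have h2 : m%:R <= 2 ^+ m :> R by rewrite -natrX ler_nat ltnW// ltn_expl.
  rewrite ler_pdivrMr ?exprn_gt0// [leRHS]mulrC -ler_pdivrMr//.
  exact: le_trans (ltW h1) h2.
have mk : measurable_fun setT k.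
  by apply: measurable_funM => //; exact: measurable_funD.
have [v v0|g [bg Pg hg]] := approx01 n mk.
  have := hM v v0; rewrite ler_norml => /andP[h1 h2].
  apply/andP; split; first by rewrite /k mulr_ge0 ?invr_ge0 ?mulr_ge0 ?(ltW N0)// /N; lra.
  rewrite /k.
  by rewrite mulrC ler_pdivrMr ?mulr_gt0// mul1r /N; lra.
have bT : bmeas (\1_(@setT R) : R -> R) by exact: bmeas_ind.
exists (fun v => 2 * N * g v + - N * \1_setT v); split.
- by apply: bmeasD; exact: bmeasZ.
- by apply: PD; try exact: bmeasZ; apply: PZ => //; exact: P_ind.
move=> v v0; rewrite indicT mulr1.
rewrite (_ : f v - _ = 2 * N * (k v - g v)); last by rewrite /k; field; rewrite gt_eqF.
rewrite normrM ger0_norm ?mulr_ge0 ?(ltW N0)//; apply: le_trans hn.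
by rewrite ler_wpM2l ?mulr_ge0 ?(ltW N0)// hg.
Qed.

End induction.

End bounded_measurable.

(** * Consequences of uniform absolute continuity *)

Section equi_families.
Context {R : realType} {al : R}.
Hypothesis al_gt0 : 0 < al.
Implicit Types (g psi zeta : R -> R) (F : (R -> R) -> Prop).

Lemma equi_sub F F' : (forall g, F' g -> F g) -> equi al F -> equi al F'.
Proof.
move=> h hF e e0; have [K K0 hK] := hF e e0; exists K => // g /h; exact: hK.
Qed.

Lemma equi_weight F : (forall g, F g -> adm al g) -> equi al F -> exists2 M, 0 <= M &
  forall g, F g -> pairing (fun v => 1 + v `^ al) g <= M.
Proof.
move=> aF hF; have [K K0 hK] := hF 1 ltr01; have aw := @adm_expw R _ al_gt0.
exists (K * pairing (fun=> 1) expw + 1).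
  by rewrite addr_ge0// mulr_ge0// (pairing_ge0 aw).
move=> g Fg; have := hK g Fg (fun=> 1) _ _; under eq_pairing do rewrite mul1r.
by apply=> //; move=> *; rewrite ler01 lexx.
Qed.

(** The sets have to leave positive points only. The origin is a null set, and exempting it allows
    complements of intervals such as ]1/n, n]. *)
Lemma pairing_ind_cvg0 w psi (A : nat -> set R) : adm al w -> tame al psi ->
  (forall n, measurable (A n)) ->
  (forall v, 0 < v -> exists N, forall n, (N <= n)%N -> ~ A n v) ->
  pairing (fun v => \1_(A n) v * psi v) w @[n --> \oo] --> (0 : R).
Proof.
move=> aw tpsi mA hA; rewrite -(pairing0 aw).
apply: (pairing_dct aw _ _ (tame_norm tpsi)) => //.
- by move=> n; apply: measurable_funM; [exact: measurable_ind|exact: tame_measurable tpsi].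
- move=> n v _; rewrite normrM ler_piMl//.
  by have /andP[? ?] := ind_itv (A n) v; rewrite ger0_norm.
exists [set 0]; split => //; first exact: lebesgue_measure_set1.
move=> v /= nv; apply/eqP/negPn/negP => v_neq0; apply: nv => v0.
apply: cvg_near_cst; have [|N hN] := hA v; first by rewrite lt0r v_neq0.
by exists N => // n /= Nn; rewrite indicE memNset ?mul0r//; exact: hN.
Qed.

Lemma equi_expw : equi al (fun g => g = expw).
Proof.
move=> e e0; have aw := @adm_expw R _ al_gt0; have tW := @tame_weight R al.
pose A (n : nat) := [set v : R | n%:R < 1 + v `^ al].
have mA n : measurable (A n) by apply: measurable_superlevel; exact: measurable_weight.
have hA v : 0 < v -> exists N, forall n, (N <= n)%N -> ~ A n v.
  move=> v0; exists (Num.truncn (1 + v `^ al)).+1 => n; rewrite /A /= => hn.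
  apply/negP; rewrite -leNgt; apply: (le_trans (ltW (truncnS_gt _))).
  by rewrite ler_nat.
have := pairing_ind_cvg0 aw tW mA hA => /cvgrPdist_le/(_ _ e0)[n _ /(_ n (leqnn n))].
rewrite sub0r normrN => /(le_trans (ler_norm _)) hn.
exists n%:R => // _ -> psi mpsi psi01.
have tpsi : tame al psi.
  by apply: (@tame_bounded _ _ _ 1) => // v v0; have /andP[h1 h2] := psi01 _ v0; rewrite ger0_norm.
have tA : tame al (fun v => \1_(A n) v * (1 + v `^ al)).
  apply: (tame_bM (M := 1) tW (measurable_ind (mA n))).
  by move=> v _; have /andP[? ?] := ind_itv (A n) v; rewrite ger0_norm.
apply: (@le_trans _ _ (n%:R * pairing psi expw + pairing (fun v => \1_(A n) v * (1 + v `^ al)) expw)); last by rewrite lerD2l.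
rewrite -(pairingZ aw)// -(pairingD aw)//; last exact: tameZ.
apply: (pairing_le aw).
- apply: (tame_bM (M := 1)) => // v v0; have /andP[h1 h2] := psi01 _ v0; rewrite ger0_norm//.
- by apply: tameD => //; exact: tameZ.
move=> v v0; have /andP[p0 p1] := psi01 _ v0; have W0 := weight_ge0 al v.
rewrite indicE; case: (pselect (A n v)) => Av.
  by rewrite mem_set// mul1r ler_wpDl ?mulr_ge0// ler_piMl.
by rewrite memNset// mul0r addr0 mulrC ler_wpM2r//; move/negP: Av; rewrite -leNgt.
Qed.

Lemma equi_union F F' : equi al F -> equi al F' -> equi al (fun g => F g \/ F' g).
Proof.
move=> h1 h2 e e0; have [K1 K10 hK1] := h1 e e0; have [K2 K20 hK2] := h2 e e0.
have aw := @adm_expw R _ al_gt0.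
exists (K1 + K2) => [|g [Fg|Fg] psi mpsi psi01]; first by rewrite addr_ge0.
  apply: (le_trans (hK1 g Fg psi mpsi psi01)); rewrite lerD2r ler_wpM2r ?lerDl//.
  by apply: (pairing_ge0 aw) => v /psi01/andP[].
apply: (le_trans (hK2 g Fg psi mpsi psi01)); rewrite lerD2r ler_wpM2r ?lerDr//.
by apply: (pairing_ge0 aw) => v /psi01/andP[].
Qed.

(** The measure exp(-v) dv of the sets tends to 0 by dominated convergence, and [equi] transfers
    this to the weighted masses of all members at once. *)
Lemma equi_vanish F (A : nat -> set R) e : equi al F ->
  (forall n, measurable (A n)) -> 0 < e ->
  (forall v, 0 < v -> exists N, forall n, (N <= n)%N -> ~ A n v) ->
  exists N, forall n, (N <= n)%N -> forall g, F g ->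
    pairing (fun v => \1_(A n) v * (1 + v `^ al)) g <= e.
Proof.
move=> hF mA e0 hA; have e20 : 0 < e / 2 by rewrite divr_gt0.
have [K K0 hK] := hF _ e20; have aw := @adm_expw R _ al_gt0.
(* K may be 0, hence the divisor K + 1. *)
have K1 : 0 < K + 1 by rewrite ltr_wpDl.
have d0 : 0 < e / 2 / (K + 1) by rewrite divr_gt0.
have := pairing_ind_cvg0 aw (tame_cst al 1) mA hA => /cvgrPdist_le/(_ _ d0)[N _ hN].
exists N => n Nn g Fg; have := hN n Nn; rewrite sub0r normrN /=.
under eq_pairing do rewrite mulr1.
move=> /(le_trans (ler_norm _)) h.
apply: (le_trans (hK g Fg _ (measurable_ind (mA n)) (fun v _ => ind_itv (A n) v))).
have : K * pairing \1_(A n) expw <= e / 2.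
  apply: (@le_trans _ _ ((K + 1) * (e / 2 / (K + 1)))).
    by apply: ler_pM => //; rewrite ?lerDl// (pairing_ge0 aw)// => v _; have /andP[] := ind_itv (A n) v.
  by rewrite mulrC divfK ?gt_eqF.
lra.
Qed.

Section approximation.
Variable F : (R -> R) -> Prop.
Hypotheses (aF : forall g, F g -> adm al g) (eF : equi al F).

Let approx zeta := forall e, 0 < e -> exists P : {poly R},
  forall g, F g -> pairing (fun v => `|zeta v - expoly P v|) g <= e.

Let tame_d zeta P : tame al zeta -> tame al (fun v => `|zeta v - expoly P v|).
Proof. by move=> t; apply: tame_norm; apply: tameB => //; exact: tame_expoly. Qed.

Let approx_close zeta : tame al zeta -> (forall e, 0 < e -> exists zeta',
   [/\ tame al zeta', approx zeta' &
   forall g, F g -> pairing (fun v => `|zeta v - zeta' v|) g <= e]) -> approx zeta.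
Proof.
move=> tz h e e0; have e20 : 0 < e / 2 by rewrite divr_gt0.
have [z' [tz' az' hz']] := h _ e20; have [P hP] := az' _ e20.
exists P => g Fg; have ag := aF Fg.
have td : tame al (fun v => `|zeta v - z' v|) by apply: tame_norm; exact: tameB.
apply: (@le_trans _ _ (pairing (fun v => `|zeta v - z' v|) g + pairing (fun v => `|z' v - expoly P v|) g)).
  rewrite -(pairingD ag td (tame_d P tz')); apply: (pairing_le ag (tame_d P tz)).
    by apply: tameD => //; exact: tame_d.
  by move=> v v0; exact: ler_distD.
have := hz' g Fg; have := hP g Fg; lra.
Qed.

Let approx_ind A : measurable A -> approx \1_A.
Proof.
move=> mA e e0; have e20 : 0 < e / 2 by rewrite divr_gt0.
have [K K0 hK] := eF e20; have aw := @adm_expw R _ al_gt0.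
have K1 : 0 < K + 1 by rewrite ltr_wpDl.
(* Approximation is asked for the single weight exp(-v). The error takes values in [0, 1], so it is
   an admissible psi in [equi], which carries the bound to the whole family. *)
have [P [P01 hP]] := approx_set aw mA (divr_gt0 e20 K1).
exists P => g Fg; have ag := aF Fg.
have tI : tame al (\1_A : R -> R) by exact: tame_ind.
pose psi v := `|\1_A v - expoly P v|.
have mpsi : measurable_fun setT psi by exact: tame_measurable (tame_d P tI).
have psi01 v : 0 <= v -> 0 <= psi v <= 1.
  move=> v0; rewrite normr_ge0 /=; have /andP[a0 a1] := P01 v v0.
  have /andP[b0 b1] := ind_itv A v; rewrite ler_norml; apply/andP; split; lra.
apply: (@le_trans _ _ (pairing (fun v => psi v * (1 + v `^ al)) g)).
  apply: (pairing_le ag (tame_d P tI)).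
    apply: (tame_bM (M := 1) (tame_weight al)) => // v /psi01/andP[? ?].
    by rewrite ger0_norm.
  by move=> v v0; rewrite ler_peMr// weight_ge1.
apply: (le_trans (hK g Fg _ mpsi psi01)).
have : K * pairing psi expw <= e / 2.
  apply: (@le_trans _ _ ((K + 1) * (e / 2 / (K + 1)))).
    apply: ler_pM => //; rewrite ?lerDl//; apply: (pairing_ge0 aw) => v _; exact: normr_ge0.
  by rewrite mulrC divfK ?gt_eqF.
lra.
Qed.

Let approx_bmeas zeta : bmeas zeta -> approx zeta.
Proof.
have [M M0 hM] := equi_weight aF eF.
apply: bounded_measurable_ind => //.
- move=> f g bf bg af ag' e e0; have e20 : 0 < e / 2 by rewrite divr_gt0.
  have [P hP] := af _ e20; have [Q hQ] := ag' _ e20.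
  have tf := bmeas_tame al bf; have tg := bmeas_tame al bg.
  exists (P + Q) => k Fk; have ak := aF Fk.
  apply: (@le_trans _ _ (pairing (fun v => `|f v - expoly P v|) k + pairing (fun v => `|g v - expoly Q v|) k)).
    rewrite -(pairingD ak (tame_d P tf) (tame_d Q tg)); apply: (pairing_le ak).
    - by apply: tame_d; exact: tameD.
    - by apply: tameD; exact: tame_d.
    move=> v v0; apply: le_trans (ler_normD _ _); rewrite le_eqVlt; apply/orP; left; apply/eqP.
    by congr `|_|; rewrite /expoly hornerD; ring.
  have := hP k Fk; have := hQ k Fk; lra.
- move=> c f bf af e e0.
  have c1 : 0 < `|c| + 1 by rewrite ltr_wpDl.
  have [P hP] := af _ (divr_gt0 e0 c1); have tf := bmeas_tame al bf.
  exists (c *: P) => k Fk; have ak := aF Fk.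
  rewrite (@eq_pairing _ _ (fun v => `|c| * `|f v - expoly P v|)); last first.
    by move=> v _; rewrite -normrM /expoly hornerZ mulrBr.
  rewrite (pairingZ ak _ (tame_d P tf)).
  apply: (@le_trans _ _ ((`|c| + 1) * (e / (`|c| + 1)))).
    apply: ler_pM => //; rewrite ?lerDl ?hP//; apply: (pairing_ge0 ak) => v _; exact: normr_ge0.
  by rewrite mulrC divfK ?gt_eqF.
- move=> f bf h; apply: approx_close; first exact: bmeas_tame.
  move=> e e0; have M1 : 0 < M + 1 by rewrite ltr_wpDl.
  have [g [bg ag' hg]] := h _ (divr_gt0 e0 M1).
  exists g; split => //; first exact: bmeas_tame.
  move=> k Fk; have ak := aF Fk.
  have tW := @tame_weight R al.
  apply: (@le_trans _ _ (pairing (fun v => e / (M + 1) * (1 + v `^ al)) k)).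
    apply: (pairing_le ak).
    - by apply: tame_norm; apply: tameB; exact: bmeas_tame.
    - exact: tameZ.
    move=> v v0; apply: (le_trans (hg v v0)); rewrite ler_peMr ?weight_ge1//.
    by rewrite divr_ge0// ltW.
  rewrite (pairingZ ak _ tW) mulrAC ler_pdivrMr// ler_wpM2l ?(ltW e0)//.
  by have := hM k Fk; lra.
Qed.

Lemma equi_approx zeta : tame al zeta -> forall e, 0 < e -> exists P : {poly R},
  forall g, F g -> pairing (fun v => `|zeta v - expoly P v|) g <= e.
Proof.
move=> tz; apply: approx_close => // e e0.
have [C C0 hC] := tame_bound tz; have C1 : 0 < C + 1 by rewrite ltr_wpDl.
(* Cutting zeta at v = n makes it bounded; the part cut off is uniformly small because [equi]
   includes the weight. *)
pose A (n : nat) := [set v : R | n%:R < v].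
have mA n : measurable (A n) by exact: measurable_superlevel.
have hA v : 0 < v -> exists N, forall n, (N <= n)%N -> ~ A n v.
  move=> v0; exists (Num.truncn v).+1 => n; rewrite /A /= => hn.
  by apply/negP; rewrite -leNgt; apply: (le_trans (ltW (truncnS_gt _))); rewrite ler_nat.
have [n /(_ n (leqnn n)) hn] := equi_vanish eF mA (divr_gt0 e0 C1) hA.
have tI : tame al (\1_(A n) : R -> R) by exact: tame_ind.
have mz := tame_measurable tz.
have tIz : tame al (fun v => (1 - \1_(A n) v) * zeta v).
  apply: (tame_bM (M := 1)) => //.
    by apply: measurable_funB => //; exact: measurable_ind.
  by move=> v _; have /andP[? ?] := ind_itv (A n) v; rewrite ger0_norm; lra.
exists (fun v => (1 - \1_(A n) v) * zeta v); split => //.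
  apply: approx_bmeas; split; first exact: tame_measurable tIz.
  exists (C * (1 + n%:R `^ al)) => v v0; rewrite indicE; case: (pselect (A n v)) => Av.
    by rewrite mem_set// subrr mul0r normr0 mulr_ge0 ?weight_ge0.
  rewrite memNset// subr0 mul1r; apply: (le_trans (hC v v0)); rewrite ler_wpM2l// lerD2l.
  apply: ge0_ler_powR; rewrite ?nnegrE ?(ltW al_gt0)//.
  by move/negP: Av; rewrite -leNgt.
move=> g Fg; have ag := aF Fg.
have tA : tame al (fun v => \1_(A n) v * (1 + v `^ al)).
  apply: (tame_bM (M := 1) (tame_weight al)); first exact: measurable_ind.
  by move=> v _; have /andP[? ?] := ind_itv (A n) v; rewrite ger0_norm.
apply: (@le_trans _ _ (pairing (fun v => C * (\1_(A n) v * (1 + v `^ al))) g)).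
  apply: (pairing_le ag); [by apply: tame_norm; exact: tameB|exact: tameZ|].
  move=> v v0; have /andP[h0 h1] := ind_itv (A n) v.
  rewrite (_ : zeta v - _ = \1_(A n) v * zeta v); last by ring.
  by rewrite normrM ger0_norm// mulrCA ler_wpM2l// hC.
rewrite (pairingZ ag)//.
apply: (@le_trans _ _ ((C + 1) * (e / (C + 1)))).
  apply: ler_pM => //; rewrite ?lerDl ?hn//; apply: (pairing_ge0 ag) => v _.
  by rewrite mulr_ge0 ?weight_ge0//; have /andP[] := ind_itv (A n) v.
by rewrite mulrC divfK ?gt_eqF.
Qed.

End approximation.

End equi_families.

Lemma measurable_weightV {R : realType} (al : R) : measurable_fun setT (fun v : R => (1 + v `^ al)^-1).
Proof.
have := measurableT_comp (measurable_powR (-1)) (measurable_weight al).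
by congr measurable_fun; apply/funext => v /=; rewrite powR_inv1// weight_ge0.
Qed.

(** * Density of a limit of solutions *)

Section limit_density.
Context {R : realType} {al : R}.
Hypothesis al_gt0 : 0 < al.
Variable g : nat -> R -> R.
Hypothesis dg : forall n, dens al (g n).
Hypothesis eg : equi al (fun f => exists n, f = g n).
Hypothesis cg : forall zeta, tame al zeta -> cvg (pairing zeta (g n) @[n --> \oo]).
Local Notation mu := (@lebesgue_measure R).
Local Notation Rp := (@Rplus R).
Implicit Types (A B : set (measurableTypeR R)) (zeta : R -> R).

Let ag n : adm al (g n) := dens_adm (dg n).
Let lm zeta : R := lim (pairing zeta (g n) @[n --> \oo]).
(** The weight is built into the set function so that the limit controls tests of growth v^al and
    not only bounded ones. *)
Let W A (v : R) : R := \1_A v * (1 + v `^ al).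

Let cvg_lm zeta : tame al zeta -> pairing zeta (g n) @[n --> \oo] --> lm zeta.
Proof. exact: cg. Qed.

Let tW A : measurable A -> tame al (W A).
Proof.
move=> mA; apply: (tame_bM (M := 1) (tame_weight al) (measurable_ind mA)).
by move=> v _; have /andP[? ?] := ind_itv A v; rewrite ger0_norm.
Qed.

Let W_ge0 A v : 0 <= W A v.
Proof. by rewrite mulr_ge0 ?weight_ge0//; have /andP[] := ind_itv A v. Qed.

Let lm_ge0 A : measurable A -> 0 <= lm (W A).
Proof.
move=> mA; apply: limr_ge; first exact: cg (tW mA).
by near=> n; apply: (pairing_ge0 (ag n)) => v _; exact: W_ge0.
Unshelve. all: by end_near. Qed.

Let lm_le A e : measurable A -> (forall n, pairing (W A) (g n) <= e) -> lm (W A) <= e.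
Proof.
by move=> mA h; apply: limr_le; [exact: cg (tW mA)|near=> n; exact: h].
Unshelve. all: by end_near. Qed.

Let lmU A B : measurable A -> measurable B -> A `&` B = set0 ->
  lm (W (A `|` B)) = lm (W A) + lm (W B).
Proof.
move=> mA mB AB; have mU := measurableU _ _ mA mB.
apply: cvg_lim => //.
have -> : (fun n => pairing (W (A `|` B)) (g n)) = (fun n => pairing (W A) (g n) + pairing (W B) (g n)).
  apply/funext => n; rewrite -(pairingD (ag n) (tW mA) (tW mB)).
  apply: eq_pairing => v _; rewrite /W -mulrDl; congr (_ * _).
  rewrite !indicE in_setU; case: (boolP (v \in A)) => [/set_mem Av|_]; case: (boolP (v \in B)) => [/set_mem Bv|_] /=; rewrite ?addr0 ?add0r//.
  have : (A `&` B) v by [].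
  by rewrite AB.
by apply: cvgD; exact: cvg_lm (tW _).
Qed.

(** On measurable sets the absolute value changes nothing. It makes [nu] nonnegative on all sets, as
    the measure structure demands, including sets for which the limit may not exist. *)
Let nu A : \bar R := `|lm (W A)|%:E.

Let nuE A : measurable A -> nu A = (lm (W A))%:E.
Proof. by move=> mA; rewrite /nu ger0_norm// lm_ge0. Qed.

Let lm0 : lm (W set0) = 0.
Proof.
apply: cvg_lim => //; have -> : (fun n => pairing (W set0) (g n)) = fun=> 0; last exact: cvg_cst.
apply/funext => n; rewrite -(pairing0 (ag n)); apply: eq_pairing => v _.
by rewrite /W indic0 mul0r.
Qed.

Let nu0 : nu set0 = 0%E. Proof. by rewrite nuE// lm0. Qed.

Let nu_ge0 A : (0 <= nu A)%E. Proof. by rewrite lee_fin. Qed.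

Let nu_sigma_additive : semi_sigma_additive nu.
Proof.
move=> F mF tF mUF.
pose U n := \big[setU/set0]_(i < n) F i.
have mU n : measurable (U n) by apply: bigsetU_measurable => i _.
have sumE n : (\sum_(0 <= i < n) nu (F i) = (lm (W (U n)))%:E)%E.
  elim: n => [|n IH]; first by rewrite big_nil /U big_ord0 lm0.
  rewrite big_nat_recr//= IH (nuE (mF n)) -EFinD -(lmU (mU n) (mF n)).
    by rewrite /U big_ord_recr.
  rewrite /U -bigcup_mkord setIC setI_bigcupr; apply: bigcup0 => i /= ni.
  by have /trivIsetP := tF; apply => //; rewrite neq_ltn ni orbT.
under eq_fun do rewrite sumE.
rewrite nuE//; apply: cvg_EFin; first by near=> n.
(* The remainders B n of the union leave every point, so their weighted masses are small uniformly
   in the index of g. This exchanges the limit in that index with the sum. *)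
apply/cvgrPdist_le => e e0; pose B n := \bigcup_n F n `\` U n.
have mB n : measurable (B n) by exact: measurableD.
have hB v : 0 < v -> exists N, forall n, (N <= n)%N -> ~ B n v.
  move=> _; case: (pselect ((\bigcup_n F n) v)) => [[i _ Fi]|nv]; last first.
    by exists 0%N => n _ [].
  exists i.+1 => n hn [_]; apply; rewrite /U -bigcup_mkord.
  by exists i.
have [N hN] := equi_vanish al_gt0 eg mB e0 hB.
near=> n; have Nn : (N <= n)%N by near: n; exists N.
have UU : \bigcup_n F n = B n `|` U n.
  rewrite /B setUC setDUK// => x; rewrite /U -bigcup_mkord => -[i _ Fi]; by exists i.
rewrite /= {1}UU lmU//; last by rewrite /B setIC setDIK.
rewrite addrK ger0_norm ?lm_ge0//; apply: lm_le => // k.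
by apply: hN => //; exists k.
Unshelve. all: by end_near. Qed.

HB.instance Definition _ := isMeasure.Build _ _ _ nu nu0 nu_ge0 nu_sigma_additive.

Let nu_fin : fin_num_fun nu. Proof. by move=> A _. Qed.

HB.instance Definition _ := Measure_isFinite.Build _ _ _ nu nu_fin.

Let nu_dom : nu `<< mu.
Proof.
move=> A0 nullA A mA /(nullA _ mA) muA; rewrite nuE//; congr EFin.
have h n : pairing (W A) (g n) = 0.
  (* The integrand vanishes off a null set, so it is the almost everywhere limit of the constant
     sequence 0. *)
  suff : pairing (fun=> 0) (g n) @[_ --> \oo] --> pairing (W A) (g n).
    by rewrite (pairing0 (ag n)) => /(cvg_lim (@Rhausdorff R)) <-; rewrite lim_cst.
  apply: (pairing_dct (ag n) _ (tame_measurable (tW mA)) (tW mA)) => //.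
    by move=> _ v _; rewrite normr0 W_ge0.
  exists A; split => // v /=; apply: contra_notP => Av v0.
  by rewrite /W indicE memNset// mul0r; exact: cvg_cst.
apply: cvg_lim => //; have -> : (fun n => pairing (W A) (g n)) = fun=> 0 by apply/funext.
exact: cvg_cst.
Qed.

Lemma limit_density : exists2 h, dens al h & forall zeta, tame al zeta ->
  pairing zeta (g n) @[n --> \oo] --> pairing zeta h.
Proof.
have [k [k0 kfin ik hk]] := radon_nikodym_sigma_finite nu_dom.
have mk : measurable_fun setT (fun v => fine (k v)).
  by apply: measurableT_comp => //; exact: measurable_int ik.
(* Dividing by the weight undoes its inclusion in [nu]; the indicator gives the value 0 on the
   negative axis. *)
pose h v : R := \1_Rp v * (fine (k v) / (1 + v `^ al)).
have mRp := @measurable_Rplus R.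
have W0 (v : R) : 1 + v `^ al != 0 by rewrite gt_eqF// (lt_le_trans ltr01)// weight_ge1.
have mh : measurable_fun setT h.
  apply: measurable_funM; first exact: measurable_ind.
  by apply: measurable_funM => //; exact: measurable_weightV.
have hW v : 0 <= v -> (1 + v `^ al) * h v = fine (k v).
  by move=> v0; rewrite /h indicE mem_set ?RplusE// mul1r mulrC divfK.
have ah : adm al h.
  split => //.
    move=> v; rewrite /h mulr_ge0 ?divr_ge0 ?weight_ge0 ?fine_ge0//.
  apply: (eq_integrable mRp (k : _ -> _)); last exact: (integrableS measurableT mRp (@subsetT _ _) ik).
  by move=> v /set_mem; rewrite RplusE => v0 /=; rewrite hW// fineK.
have hlim zeta : bmeas zeta -> pairing (fun v => zeta v * (1 + v `^ al)) (g n) @[n --> \oo] -->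
   pairing (fun v => zeta v * (1 + v `^ al)) h.
  have tZ z : bmeas z -> tame al (fun v => z v * (1 + v `^ al)).
    by move=> [mz [M hM]]; exact: (tame_bM (M := M) (tame_weight al)).
  apply: (@bounded_measurable_ind R (fun z => pairing (fun v => z v * (1 + v `^ al)) (g n) @[n --> \oo] -->
   pairing (fun v => z v * (1 + v `^ al)) h)).
  - move=> A mA; suff -> : pairing (W A) h = lm (W A) by exact: cvg_lm (tW mA).
    have mAR : measurable (Rp `&` A) by exact: measurableI.
    (* k is a density on the whole line, whereas pairings integrate over R_+ and do not see the rest
       of A. *)
    have -> : lm (W A) = lm (W (Rp `&` A)).
      congr (lim _); congr (_ @ \oo); apply/funext => n; apply: eq_pairing => v v0.
      by rewrite /W !indicE in_setI [v \in Rp]mem_set// RplusE.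
    apply: EFin_inj; rewrite -nuE// hk// integral_mkcondr -(pairing_fin_num ah (tW mA)).
    apply: eq_integral => v /set_mem; rewrite RplusE => v0.
    rewrite patchE /W indicE; case: ifPn => Av; last by rewrite !mul0r.
    by rewrite mul1r hW// fineK.
  - move=> z1 z2 b1 b2 h1 h2.
    have e w : adm al w -> pairing (fun v => (z1 v + z2 v) * (1 + v `^ al)) w =
      pairing (fun v => z1 v * (1 + v `^ al)) w + pairing (fun v => z2 v * (1 + v `^ al)) w.
      move=> aw; rewrite -(pairingD aw (tZ _ b1) (tZ _ b2)).
      by apply: eq_pairing => v _; rewrite mulrDl.
    rewrite e//; under eq_fun do rewrite e//.
    exact: cvgD.
  - move=> c z b hz.
    have e w : adm al w -> pairing (fun v => c * z v * (1 + v `^ al)) w = c * pairing (fun v => z v * (1 + v `^ al)) w.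
      by move=> aw; rewrite -(pairingZ aw c (tZ _ b)); apply: eq_pairing => v _; rewrite mulrA.
    rewrite e//; under eq_fun do rewrite e//.
    exact: cvgMl_tmp.
  - move=> z bz hz; have tW1 := @tame_weight R al.
    have [M M0 hM] : exists2 M, 0 <= M & forall w, (exists n, w = g n) \/ w = h -> pairing (fun v => 1 + v `^ al) w <= M.
      have aF w : (exists n, w = g n) -> adm al w by move=> [n ->].
      have [M1 M10 hM1] := equi_weight al_gt0 aF eg.
      exists (M1 + `|pairing (fun v => 1 + v `^ al) h|); first by rewrite addr_ge0.
      move=> w [[n ->]|->]; first by rewrite (le_trans (hM1 _ _)) ?lerDl//; exists n.
      by rewrite (le_trans (ler_norm _))// lerDr.
    apply/cvgrPdist_le => e e0; have M1 : 0 < M + 1 by rewrite ltr_wpDl.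
    have e30 : 0 < e / 3 by rewrite divr_gt0.
    have [z' [bz' hz' dz]] := hz _ (divr_gt0 e30 M1).
    have close w : (exists n, w = g n) \/ w = h ->
      `|pairing (fun v => z v * (1 + v `^ al)) w - pairing (fun v => z' v * (1 + v `^ al)) w| <= e / 3.
      move=> hw; have aw : adm al w by case: hw => [[n ->]|->].
      rewrite -(pairingB aw (tZ _ bz) (tZ _ bz')).
      apply: (@le_trans _ _ (pairing (fun v => e / 3 / (M + 1) * (1 + v `^ al)) w)).
        apply: (pairing_norm_le aw); [by apply: tameB; exact: tZ|exact: tameZ|].
        move=> v v0; rewrite -mulrBl normrM (ger0_norm (weight_ge0 _ _)).
        by rewrite ler_wpM2r ?weight_ge0// dz.
      rewrite (pairingZ aw _ tW1) mulrAC ler_pdivrMr// ler_wpM2l ?(ltW e30)//.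
      by have := hM w hw; lra.
    have /cvgrPdist_le/(_ _ e30) hz'' := hz'.
    near=> n.
    have k1 := close h (or_intror erefl).
    have k2 : `|pairing (fun v => z' v * (1 + v `^ al)) h - pairing (fun v => z' v * (1 + v `^ al)) (g n)| <= e / 3 by near: n.
    have k3 := close (g n) (or_introl (ex_intro _ n erefl)).
    move: k1 k2 k3; rewrite !ler_norml => /andP[? ?] /andP[? ?] /andP[? ?].
    by apply/andP; split; lra.
have hT zeta : tame al zeta -> pairing zeta (g n) @[n --> \oo] --> pairing zeta h.
  move=> tz; have [C C0 hC] := tame_bound tz.
  have := hlim (fun v => zeta v / (1 + v `^ al)) _.
  rewrite (_ : (fun v => zeta v / (1 + v `^ al) * (1 + v `^ al)) = zeta); last first.
    by apply/funext => v; rewrite divfK.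
  apply; split; last first.
    exists C => v v0; rewrite normrM normfV (ger0_norm (weight_ge0 _ _)).
    by rewrite ler_pdivrMr ?hC// lt_neqAle eq_sym W0 weight_ge0.
  by apply: measurable_funM; [exact: tame_measurable tz|exact: measurable_weightV].
exists h => //; split => //.
  by move=> v v0; rewrite /h indicE memNset ?mul0r// RplusE leNgt v0.
rewrite -(cvg_lim (@Rhausdorff R) (hT _ (tame_cst al 1))).
have -> : (fun n => pairing (fun=> 1) (g n)) = fun=> 1 by apply/funext => n; case: (dg n).
exact: lim_cst.
Unshelve. all: by end_near. Qed.

End limit_density.

(** Tychonoff's theorem replaces nested subsequences. The columns n -> (x i n)_i lie in a product of
    segments and have a cluster point p; e(k) is chosen so that the first k coordinates are within
    1/(k + 1) of p. *)
Lemma diagonal_extraction {R : realType} (x : nat -> nat -> R) (M : nat -> R) :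
  (forall i n, `|x i n| <= M i) ->
  exists2 e : nat -> nat, {homo e : i j / (i < j)%N} &
    forall i, cvg (x i (e k) @[k --> \oo]).
Proof.
move=> xM.
pose T := prod_topology (fun _ : nat => R : topologicalType).
pose s (n : nat) : T := fun i => x i n.
pose F := s n @[n --> \oo].
have FF : ProperFilter F by exact: fmap_proper_filter.
have cA : compact [set f : T | forall i, `[- M i, M i]%classic (f i)].
  by apply: (@tychonoff nat (fun _ => R) (fun i => `[- M i, M i]%classic)) => i; exact: segment_compact.
have [p [_ clp]] : [set f : T | forall i, `[- M i, M i]%classic (f i)] `&` cluster F !=set0.
  apply: cA; exists 0%N => // n _ i /=; rewrite in_itv /=; have := xM i n.
  by rewrite ler_norml.
have FT : Filter (nbhs p) by exact: nbhs_filter.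
have nb (k : nat) (d : R) : 0 < d -> nbhs p [set f : T | forall i, (i < k)%N -> `|f i - p i| < d].
  move=> d0; elim: k => [|k IH]; first by apply: filterS filterT => f _ i.
  have h : nbhs p [set f : T | `|f k - p k| < d].
    have h2 : nbhs p (@proj nat (fun _ => R) k @^-1` ball (p k) d).
      exact: (@proj_continuous nat (fun _ => R : topologicalType) k p _ (nbhsx_ballx (p k) d d0)).
    by apply: (@filterS _ _ _ _ _ _ h2) => f; rewrite /proj /ball /= distrC.
  apply: filterS (filterI h IH) => f [h1 h2] i; rewrite ltnS leq_eqVlt => /predU1P[->//|].
  exact: h2.
(* The second component bounds the index from below, which makes e increasing. *)
have ex (kN : nat * nat) : exists n, (kN.2 <= n)%N /\ forall i, (i < kN.1)%N -> `|x i n - p i| < kN.1.+1%:R^-1.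
  case: kN => k N /=.
  have FN : F [set f : T | exists2 n, (N <= n)%N & f = s n].
    by exists N => // n Nn; exists n.
  have k0 : 0 < k.+1%:R^-1 :> R by rewrite invr_gt0.
  have [f [[n Nn ->] h]] := clp _ _ FN (nb k _ k0).
  by exists n.
have [E hE] := choice ex.
pose e := fix e (k : nat) : nat := if k is j.+1 then E (k, (e j).+1) else E (0, 0)%N.
have e_lt k : (e k < e k.+1)%N by have [] := hE (k.+1, (e k).+1).
have e_homo : {homo e : i j / (i < j)%N} by apply: homo_ltn => //; exact: ltn_trans.
exists e => // i; apply/cvg_ex; exists (p i); apply/cvgrPdist_le => d d0.
have cz : k.+1%:R^-1 @[k --> \oo] --> (0 : R) by exact: cvg_harmonic.
have /cvgrPdist_le/(_ d d0) hz := cz.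
have close k : (i < k)%N -> `|x i (e k) - p i| < k.+1%:R^-1.
  by case: k => // k ik; have [_] := hE (k.+1, (e k).+1); apply.
near=> k; have ik : (i < k)%N by near: k; exact: nbhs_infty_gt.
have : `|0 - k.+1%:R^-1| <= d by near: k.
rewrite sub0r normrN ger0_norm ?invr_ge0// distrC; apply: le_trans; apply: ltW.
exact: close.
Unshelve. all: by end_near. Qed.

Lemma MVT_pos {R : realType} (f df : R -> R) s t : 0 < s -> 0 < t ->
  (forall x : R, 0 < x -> is_derive x 1 f (df x)) ->
  exists c, [/\ 0 < c, Num.min s t <= c <= Num.max s t & f t - f s = df c * (t - s)].
Proof.
move=> s0 t0 hf; wlog st : s t s0 t0 / s <= t => [hw|].
  have [st|ts] : s <= t \/ t <= s by apply/orP; exact: le_total.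
    exact: hw.
  have [c [c0 hc E]] := hw _ _ t0 s0 ts.
  exists c; split => //; first by rewrite minC maxC.
  by rewrite -opprB E -mulrN opprB.
have pos x : x \in `[s, t] -> 0 < x by rewrite in_itv /= => /andP[sx _]; exact: lt_le_trans sx.
have [c cst E] := @MVT_segment R f df s t st
  (fun x xst => hf x (pos x (subset_itv_oo_cc xst)))
  (derivable_within_continuous (fun x xst => is_derive_derivable (hf x (pos x xst)))).
exists c; split => //; first exact: pos.
by rewrite min_l// max_r//; move: cst; rewrite in_itv.
Qed.

Lemma pairing_expoly {R : realType} (al : R) (g : R -> R) (P : {poly R}) : adm al g ->
  pairing (expoly P) g = \sum_(i < size P) P`_i * pairing (ec i%:R) g.
Proof.
move=> ag.
have h n : pairing (fun v => \sum_(i < n) P`_i * ec i%:R v) g = \sum_(i < n) P`_i * pairing (ec i%:R) g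
  /\ tame al (fun v => \sum_(i < n) P`_i * ec i%:R v).
  elim: n => [|n [IH tn]].
    under eq_pairing do rewrite big_ord0; under [X in tame al X]eq_fun do rewrite big_ord0.
    by rewrite (pairing0 ag) big_ord0; split => //; exact: tame_cst.
  have te : tame al (ec n%:R) by apply: tame_ec.
  under eq_pairing do rewrite big_ord_recr /=.
  under [X in tame al X]eq_fun do rewrite big_ord_recr /=.
  rewrite (pairingD ag tn (tameZ _ te)) (pairingZ ag _ te) IH big_ord_recr /=; split => //.
  by apply: tameD => //; exact: tameZ.
have [<- _] := h (size P); apply: eq_pairing => v _.
rewrite /expoly horner_coef; apply: eq_bigr => i _.
by rewrite -expRM_natl mulrN.
Qed.

(** A Cauchy criterion: l may change with e, being the limit of an approximating sequence. *)
Lemma cvg_of_close {R : realType} (y : nat -> R) :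
  (forall e, 0 < e -> exists l, \forall k \near \oo, `|l - y k| <= e) -> cvg (y k @[k --> \oo]).
Proof.
move=> h; apply/cauchy_cvgP; apply: cauchy_exP => e e0.
have [l hl] := h (e / 2) (divr_gt0 e0 (ltr0n _ 2)).
exists l; change (\forall k \near \oo, ball l e (y k)); near=> k; rewrite /ball /=.
have : `|l - y k| <= e / 2 by near: k.
by move=> /le_lt_trans; apply; rewrite ltr_pdivrMr// ltr_pMr// ltr1n.
Unshelve. all: by end_near. Qed.

(** * Compactness of the flow in time *)

Section limit_flow.
Context {R : realType} {al lambda : R}.
Variables (u : nat -> R -> R -> R) (du : nat -> nat -> R -> R).
Hypothesis al_gt0 : 0 < al.
Hypothesis dens_u : forall n t, 0 < t -> dens al (u n t).
Hypothesis equi_u : forall T, equi al (fun g => exists n t, 0 < t <= T /\ g = u n t).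
Hypothesis derive_u : forall n j (t : R), 0 < t ->
  is_derive t 1 (fun t : R => pairing (ec j%:R) (u n t)) (du n j t).
Hypothesis consistent_u : forall T j e, 0 < e -> exists N, forall n, (N <= n)%N ->
  forall t, 0 < t <= T -> `|du n j t - pairing (fp lambda (ec j%:R)) (u n t)| <= e.
Implicit Types (s t T e : R) (zeta : R -> R).

Let family T g := exists n t, 0 < t <= T /\ g = u n t.
Let adm_family T g : family T g -> adm al g.
Proof. by move=> [n [t [/andP[t0 _] ->]]]; exact: dens_adm (dens_u n t0). Qed.

(** For large n the derivative is close to a pairing with a tame function, which the uniform moment
    bounds. Small n are left out because consistency is asymptotic. *)
Let lipschitz_ec T j : exists L N, 0 <= L /\ forall n, (N <= n)%N -> forall s t,
  0 < s <= T -> 0 < t <= T ->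
  `|pairing (ec j%:R) (u n s) - pairing (ec j%:R) (u n t)| <= L * `|s - t|.
Proof.
have [N hN] := consistent_u T j ltr01.
have tf := @tame_fp_ec R al lambda j%:R (ler0n _ _); have [C C0 hC] := tame_bound tf.
have [M M0 hM] := equi_weight al_gt0 (@adm_family T) (equi_u T).
exists (C * M + 1), N; split; first by rewrite addr_ge0// mulr_ge0.
move=> n Nn s t /andP[s0 sT] /andP[t0 tT].
have [c [c0 hc ->]] := MVT_pos t0 s0 (fun x => @derive_u n j x).
have cT : 0 < c <= T.
  rewrite c0 /=; have /andP[_ h] := hc; apply: (le_trans h).
  by rewrite ge_max tT.
rewrite normrM ler_wpM2r//.
have ac := adm_family (ex_intro _ n (ex_intro _ c (conj cT erefl))) : adm al (u n c).
have h1 : `|pairing (fp lambda (ec j%:R)) (u n c)| <= C * M.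
  have tW := @tame_weight R al.
  apply: (@le_trans _ _ (pairing (fun v => C * (1 + v `^ al)) (u n c))).
    by apply: (pairing_norm_le ac) => //; exact: tameZ.
  by rewrite (pairingZ ac _ tW) ler_wpM2l// hM//; exists n, c.
have := hN n Nn c cT; have := ler_normD (du n j c - pairing (fp lambda (ec j%:R)) (u n c)) (pairing (fp lambda (ec j%:R)) (u n c)).
by rewrite subrK; lra.
Qed.

Let lipschitz_expoly T (P : {poly R}) : exists L N, 0 <= L /\ forall n, (N <= n)%N -> forall s t,
  0 < s <= T -> 0 < t <= T ->
  `|pairing (expoly P) (u n s) - pairing (expoly P) (u n t)| <= L * `|s - t|.
Proof.
have h m : exists L N, 0 <= L /\ forall n, (N <= n)%N -> forall s t, 0 < s <= T -> 0 < t <= T ->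
  `|\sum_(i < m) P`_i * pairing (ec i%:R) (u n s) - \sum_(i < m) P`_i * pairing (ec i%:R) (u n t)| <= L * `|s - t|.
  elim: m => [|m [L1 [N1 [L10 h1]]]].
    by exists 0, 0%N; split => // n _ s t _ _; rewrite !big_ord0 subrr normr0 mul0r.
  have [L2 [N2 [L20 h2]]] := lipschitz_ec T m.
  exists (L1 + `|P`_m| * L2), (maxn N1 N2); split; first by rewrite addr_ge0// mulr_ge0.
  move=> n; rewrite geq_max => /andP[Nn1 Nn2] s t hs ht; rewrite !big_ord_recr /=.
  have := h1 n Nn1 s t hs ht; have := h2 n Nn2 s t hs ht.
  set A := \sum_(i < m) _; set B := \sum_(i < m) _; set a := pairing _ _; set b := pairing _ _.
  move=> k2 k1; rewrite (_ : _ - _ = (A - B) + P`_m * (a - b)); last by ring.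
  apply: (le_trans (ler_normD _ _)); rewrite mulrDl lerD// normrM -mulrA ler_wpM2l//.
have [L [N [L0 hL]]] := h (size P); exists L, N; split => // n Nn s t hs ht.
have /andP[s0 _] := hs; have /andP[t0 _] := ht.
rewrite (pairing_expoly P (dens_adm (dens_u n s0))) (pairing_expoly P (dens_adm (dens_u n t0))).
exact: hL.
Qed.

Let equicontinuous T zeta e : tame al zeta -> 0 < e -> exists2 d, 0 < d & exists N,
  forall n, (N <= n)%N -> forall s t, 0 < s <= T -> 0 < t <= T -> `|s - t| <= d ->
  `|pairing zeta (u n s) - pairing zeta (u n t)| <= e.
Proof.
move=> tz e0; have e30 : 0 < e / 3 by rewrite divr_gt0.
have [P hP] := equi_approx al_gt0 (@adm_family T) (equi_u T) tz e30.
have [L [N [L0 hL]]] := lipschitz_expoly T P.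
have L1 : 0 < L + 1 by rewrite ltr_wpDl.
exists (e / 3 / (L + 1)); first by rewrite divr_gt0.
exists N => n Nn s t hs ht st.
have close r : 0 < r <= T -> `|pairing zeta (u n r) - pairing (expoly P) (u n r)| <= e / 3.
  move=> hr; have fr : family T (u n r) by exists n, r.
  have ar := adm_family fr; have tP := @tame_expoly R al P.
  rewrite -(pairingB ar tz tP); apply: le_trans (hP _ fr).
  by apply: (pairing_norm ar); exact: tameB.
have k1 := close s hs; have k2 := close t ht.
have k3 : `|pairing (expoly P) (u n s) - pairing (expoly P) (u n t)| <= e / 3.
  apply: (le_trans (hL n Nn s t hs ht)).
  apply: (@le_trans _ _ ((L + 1) * (e / 3 / (L + 1)))); last by rewrite mulrC divfK ?gt_eqF.
  by apply: ler_pM => //; rewrite lerDl.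
move: k1 k2 k3; rewrite !ler_norml => /andP[? ?] /andP[? ?] /andP[? ?].
by apply/andP; split; lra.
Qed.

Let subsequence : exists2 e : nat -> nat, {homo e : i j / (i < j)%N} &
  forall j (r : rat), 0 < (ratr r : R) -> cvg (pairing (ec j%:R) (u (e k) (ratr r)) @[k --> \oo]).
Proof.
(* A pair of an exponent and a rational time is encoded as one index; other indices and nonpositive
   times get the value 0. *)
pose x m n : R := if unpickle m is Some (j, r) then
  (if (0 : R) < ratr r then pairing (ec j%:R) (u n (ratr r)) else 0) else 0.
have xM m n : `|x m n| <= 1.
  rewrite /x; case: unpickle => [[j r]|]; last by rewrite normr0.
  case: ifPn => [r0|_]; last by rewrite normr0.
  have df := dens_u n r0; have af := dens_adm df.
  rewrite -[leRHS](dens_cst 1 df); apply: (pairing_norm_le af).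
  - exact: tame_ec.
  - exact: tame_cst.
  by move=> v v0; rewrite ger0_norm ?expR_ge0// ec_le1.
have [e e_homo he] := diagonal_extraction (fun m n => xM m n).
exists e => // j r r0; have := he (pickle (j, r)).
by rewrite /x pickleK r0.
Qed.

Let subsequence_cvg (e : nat -> nat) : {homo e : i j / (i < j)%N} ->
  (forall j (r : rat), 0 < (ratr r : R) -> cvg (pairing (ec j%:R) (u (e k) (ratr r)) @[k --> \oo])) ->
  forall t zeta, 0 < t -> tame al zeta -> cvg (pairing zeta (u (e k) t) @[k --> \oo]).
Proof.
move=> e_homo he t zeta t0 tz; apply: cvg_of_close => d d0; have d30 : 0 < d / 3 by rewrite divr_gt0.
(* Leaves room for a rational time slightly later than t. *)
pose T := t + 1.
have [dl dl0 [N hN]] := equicontinuous T tz d30.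
have [P hP] := equi_approx al_gt0 (@adm_family T) (equi_u T) tz d30.
have [r tr rt] : exists2 r : rat, t < ratr r & ratr r < t + Num.min dl 1.
  have : t < t + Num.min dl 1 by rewrite ltrDl lt_min dl0 ltr01.
  by move=> /rat_in_itvoo[r]; rewrite in_itv /= => /andP[? ?]; exists r.
have r0 : 0 < (ratr r : R) by exact: lt_trans tr.
have rT : 0 < (ratr r : R) <= T.
  by rewrite r0 (le_trans (ltW rt))// lerD2l ge_min lexx orbT.
have tT : 0 < t <= T by rewrite t0 /T lerDl ler01.
have cP : cvg (pairing (expoly P) (u (e k) (ratr r)) @[k --> \oo]).
  have -> : (fun k => pairing (expoly P) (u (e k) (ratr r))) =
    (fun k => \sum_(i < size P) P`_i * pairing (ec i%:R) (u (e k) (ratr r))).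
    by apply/funext => k; rewrite (pairing_expoly P (dens_adm (dens_u (e k) r0))).
  elim: (size P) => [|m IH].
    under eq_fun do rewrite big_ord0; exact: is_cvg_cst.
  under eq_fun do rewrite big_ord_recr /=.
  by apply: is_cvgD => //; apply: is_cvgMr; exact: he.
exists (lim (pairing (expoly P) (u (e k) (ratr r)) @[k --> \oo])).
have /cvgrPdist_le/(_ _ d30) h1 := cP.
have e_ge k : (k <= e k)%N.
  by elim: k => // k IH; exact: leq_ltn_trans IH (e_homo _ _ (ltnSn k)).
near=> k.
have k1 : `|lim (pairing (expoly P) (u (e k) (ratr r)) @[k --> \oo]) - pairing (expoly P) (u (e k) (ratr r))| <= d / 3 by near: k.
have Nk : (N <= e k)%N by apply: leq_trans (e_ge k); near: k; exact: nbhs_infty_ge.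
have k2 : `|pairing zeta (u (e k) (ratr r)) - pairing zeta (u (e k) t)| <= d / 3.
  apply: hN => //; rewrite ger0_norm ?subr_ge0 ?(ltW tr)// lerBlDl (le_trans (ltW rt))//.
  by rewrite lerD2l ge_min lexx.
have fr : family T (u (e k) (ratr r)) by exists (e k), (ratr r).
have k3 : `|pairing zeta (u (e k) (ratr r)) - pairing (expoly P) (u (e k) (ratr r))| <= d / 3.
  have ar := adm_family fr; have tP := @tame_expoly R al P.
  rewrite -(pairingB ar tz tP); apply: le_trans (hP _ fr).
  by apply: (pairing_norm ar); exact: tameB.
move: k1 k2 k3; rewrite !ler_norml => /andP[? ?] /andP[? ?] /andP[? ?].
by apply/andP; split; lra.
Unshelve. all: by end_near. Qed.

(** The time derivative does not come from convergence of derivatives. At a fixed index the mean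
    value theorem expresses the increment by [du] at an intermediate time; consistency and
    equicontinuity compare this with the operator [fp] at time t, and only then the index tends to
    infinity. *)
Lemma limit_flow : exists (e : nat -> nat) (h : R -> R -> R),
  [/\ {homo e : i j / (i < j)%N},
      forall t, 0 < t -> dens al (h t),
      forall t zeta, 0 < t -> tame al zeta ->
        pairing zeta (u (e k) t) @[k --> \oo] --> pairing zeta (h t),
      forall T, equi al (fun g => exists2 t, 0 < t <= T & g = h t) &
      (forall T zeta d, tame al zeta -> 0 < d -> exists2 r, 0 < r &
        forall s t, 0 < s <= T -> 0 < t <= T -> `|s - t| <= r ->
          `|pairing zeta (h s) - pairing zeta (h t)| <= d) /\
      forall j (t : R), 0 < t -> is_derive t 1 (fun t : R => pairing (ec j%:R) (h t))
        (pairing (fp lambda (ec j%:R)) (h t))].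
Proof.
have [e e_homo he] := subsequence; have cu := subsequence_cvg e_homo he.
have e_ge k : (k <= e k)%N.
  by elim: k => // k IH; exact: leq_ltn_trans IH (e_homo _ _ (ltnSn k)).
have ex (t : R) : exists ht : R -> R, 0 < t -> dens al ht /\ forall zeta, tame al zeta ->
    pairing zeta (u (e k) t) @[k --> \oo] --> pairing zeta ht.
  have [t0|t0] := ltP 0 t; last by exists (fun=> 0).
  have eqk : equi al (fun g => exists k, g = u (e k) t).
    by apply: equi_sub (equi_u t) => _ [k ->]; exists (e k), t; rewrite t0 lexx.
  have [ht dh hh] := limit_density al_gt0 (fun k => dens_u (e k) t0) eqk (fun z tz => cu t z t0 tz).
  by exists ht.
have [h hh] := choice ex; exists e, h.
have dh t : 0 < t -> dens al (h t) by move=> /hh[].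
have ch t zeta : 0 < t -> tame al zeta -> pairing zeta (u (e k) t) @[k --> \oo] --> pairing zeta (h t).
  by move=> /hh[_]; exact.
have eqc T zeta d : tame al zeta -> 0 < d -> exists2 r, 0 < r &
    forall s t, 0 < s <= T -> 0 < t <= T -> `|s - t| <= r ->
      `|pairing zeta (h s) - pairing zeta (h t)| <= d.
  move=> tz d0; have [r r0 [N hN]] := equicontinuous T tz d0.
  exists r => // s t hs ht st.
  have /andP[s0 _] := hs; have /andP[t0 _] := ht.
  apply: (cvgr_to_le (cvg_norm (cvgB (ch s zeta s0 tz) (ch t zeta t0 tz)))).
  near=> k; apply: hN => //; apply: leq_trans (e_ge k); near: k; exact: nbhs_infty_ge.
split; [exact: e_homo|exact: dh|exact: ch| |split; [exact: eqc|]].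
  move=> T d d0; have [K K0 hK] := equi_u T d0; exists K => // _ [t /[dup] htT /andP[t0 tT] ->] psi mpsi psi01.
  have tp : tame al (fun v => psi v * (1 + v `^ al)).
    apply: (tame_bM (M := 1) (tame_weight al)) => // v /psi01/andP[? ?].
    by rewrite ger0_norm.
  apply: (cvgr_to_le (ch t _ t0 tp)); near=> k.
  by apply: hK => //; exists (e k), t.
move=> j t t0; apply/is_derive1P => d d0.
pose T := t + 1; have d20 : 0 < d / 2 by rewrite divr_gt0.
have tf := @tame_fp_ec R al lambda j%:R (ler0n _ _).
have tec := @tame_ec R al j%:R (ler0n _ _).
have [r r0 [N hN]] := equicontinuous T tf d20.
have [N' hN'] := consistent_u T j d20.
have m0 : 0 < Num.min r (Num.min 1 t) by rewrite !lt_min r0 ltr01 t0.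
exists (Num.min r (Num.min 1 t)) => // y; rewrite !lt_min => /andP[yr /andP[y1 yt]].
have y0 : 0 < y by move: yt; rewrite ltr_norml; lra.
have yT : y <= T by move: y1; rewrite ltr_norml /T; lra.
have tT : 0 < t <= T by rewrite t0 /T lerDl ler01.
have c2 : (y - t) * pairing (fp lambda (ec j%:R)) (u (e k) t) @[k --> \oo] --> (y - t) * pairing (fp lambda (ec j%:R)) (h t).
  by apply: cvgMl_tmp; exact: ch.
have c1 : `|pairing (ec j%:R) (u (e k) y) - pairing (ec j%:R) (u (e k) t)
    - (y - t) * pairing (fp lambda (ec j%:R)) (u (e k) t)| @[k --> \oo] -->
    `|pairing (ec j%:R) (h y) - pairing (ec j%:R) (h t) - (y - t) * pairing (fp lambda (ec j%:R)) (h t)|.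
  by apply: cvg_norm; apply: cvgB c2; apply: cvgB; exact: ch.
apply: (cvgr_to_le c1); near=> k.
have [c [c0 hc ->]] := MVT_pos t0 y0 (fun x => @derive_u (e k) j x).
have cT : 0 < c <= T.
  by rewrite c0 /=; have /andP[_ h'] := hc; apply: (le_trans h'); rewrite ge_max yT andbT; have /andP[] := tT.
have ct : `|c - t| <= r.
  exact: le_trans (between_dist hc) (ltW yr).
rewrite mulrC -mulrBr normrM mulrC ler_wpM2r//.
have k1 : `|du (e k) j c - pairing (fp lambda (ec j%:R)) (u (e k) c)| <= d / 2.
  by apply: hN' => //; apply: leq_trans (e_ge k); near: k; exact: nbhs_infty_ge.
have k2 : `|pairing (fp lambda (ec j%:R)) (u (e k) c) - pairing (fp lambda (ec j%:R)) (u (e k) t)| <= d / 2.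
  by apply: hN => //; apply: leq_trans (e_ge k); near: k; exact: nbhs_infty_ge.
rewrite [leRHS](splitr d) -(subrK (pairing (fp lambda (ec j%:R)) (u (e k) c)) (du (e k) j c)) -addrA.
by apply: le_trans (ler_normD _ _) _; exact: lerD.
Unshelve. all: by end_near. Qed.

End limit_flow.

(** * Lipschitz functions and the test class *)

Section integral_ae.
Context d (T : measurableType d) (R : realType).
Variables (mu : {measure set T -> \bar R}) (N : set T).
Hypotheses (mN : measurable N) (muN : mu N = 0%E).
Import HBNNSimple.
Local Open Scope ereal_scope.
Implicit Types (f g : T -> \bar R) (D : set T).

(* The integral is defined as a supremum of integrals of simple functions, so
   changing a function on a null set does not matter even if the function is
   not measurable. *)
Let ge0_integral_ae_le f g : (forall x, 0 <= f x) -> (forall x, 0 <= g x) ->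
  (forall x, ~ N x -> f x = g x) -> \int[mu]_x f x <= \int[mu]_x g x.
Proof.
move=> f0 g0 fg; rewrite ge0_integralTE// [leRHS]ge0_integralTE//.
apply: ge_ereal_sup => _ [h /= hf <-]; apply: ereal_sup_ubound.
exists (proj_nnsfun h (measurableC mN)).
  move=> x /=; rewrite mindicE; case: (pselect (N x)) => Nx.
    by rewrite memNset ?mulr0// => /(_ Nx).
  by rewrite mem_set// mulr1 -fg.
rewrite -mrestrict -integral_nnsfun; last exact: measurableC.
transitivity (sintegral mu (h \_ setT)); last by rewrite patch_setT.
rewrite -integral_nnsfun//; apply/esym.
rewrite (@ge0_negligible_integral _ _ _ mu setT N) ?setTD//.
  by apply/measurable_EFinP.
by move=> x _; rewrite lee_fin.
Qed.

Lemma ge0_integral_ae D f g : (forall x, 0 <= f x) -> (forall x, 0 <= g x) ->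
  (forall x, D x -> ~ N x -> f x = g x) -> \int[mu]_(x in D) f x = \int[mu]_(x in D) g x.
Proof.
move=> f0 g0 fg; rewrite integral_mkcond [RHS]integral_mkcond.
have p0 h : (forall x, 0 <= h x) -> forall x, 0 <= (h \_ D) x.
  by move=> h0 x; rewrite patchE; case: ifP.
have fgD x : ~ N x -> (f \_ D) x = (g \_ D) x.
  by move=> Nx; rewrite !patchE; case: ifPn => // /set_mem Dx; exact: fg.
apply/eqP; rewrite eq_le; apply/andP; split; apply: ge0_integral_ae_le; try exact: p0.
  exact: fgD.
by move=> x Nx; rewrite fgD.
Qed.

Lemma integral_ae D f g : (forall x, D x -> ~ N x -> f x = g x) ->
  \int[mu]_(x in D) f x = \int[mu]_(x in D) g x.
Proof.
move=> fg; rewrite integralE [RHS]integralE; congr (_ - _); apply: ge0_integral_ae => //.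
  by move=> x Dx Nx; rewrite !funeposE fg.
by move=> x Dx Nx; rewrite !funenegE fg.
Qed.

End integral_ae.

(** * Fundamental theorem of calculus for Lipschitz functions *)

Section lipschitz_ftc.
Context {R : realType}.
Local Notation mu := (@lebesgue_measure R).
Variables (psi : R -> R) (M : R).
Hypotheses (M_gt0 : 0 < M) (psi_lip : forall x y, `|psi x - psi y| <= M * `|x - y|).
Implicit Types (a b x y : R).

Let c := (2 * M)^-1.
Let c_gt0 : 0 < c. Proof. by rewrite invr_gt0 mulr_gt0. Qed.

(* [F1] and [F2] are nondecreasing with sum [x], so their Stieltjes measures are
   absolutely continuous, and [psi] is a combination of [F1] and the identity. *)
Let F1 x := c * (psi x + M * x).
Let F2 x := c * (M * x - psi x).

Let F12 x : F1 x + F2 x = x.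
Proof. by rewrite /F1 /F2 /c; field; rewrite gt_eqF. Qed.

Let continuous_psi : continuous psi.
Proof.
move=> x; apply/cvgrPdist_le => e e0; near=> y.
apply: (le_trans (psi_lip x y)); rewrite mulrC -ler_pdivlMr//.
near: y; apply: cvgr_dist_le; last exact: divr_gt0.
exact: cvg_id.
Unshelve. all: by end_near. Qed.

Let nd1 : {homo F1 : x y / x <= y}.
Proof.
move=> x y xy; rewrite ler_pM2l//; have := psi_lip x y.
rewrite distrC ler_norml (distrC x) ger0_norm ?subr_ge0// => /andP[h _]; lra.
Qed.

Let nd2 : {homo F2 : x y / x <= y}.
Proof.
move=> x y xy; rewrite ler_pM2l//; have := psi_lip x y.
rewrite distrC ler_norml (distrC x) ger0_norm ?subr_ge0// => /andP[_ h]; lra.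
Qed.

Let cM x : {for x, continuous (fun y : R => M * y)}.
Proof. exact: mulrl_continuous. Qed.

Let rc1 : right_continuous F1.
Proof.
apply: right_continuousW => x; apply: cvgMl_tmp; apply: cvgD; [exact: continuous_psi|exact: cM].
Qed.

Let rc2 : right_continuous F2.
Proof.
apply: right_continuousW => x; apply: cvgMl_tmp; apply: cvgB; [exact: cM|exact: continuous_psi].
Qed.

HB.instance Definition _ := isCumulative.Build R _ R F1 nd1 rc1.
HB.instance Definition _ := isCumulative.Build R _ R F2 nd2 rc2.

Let m1 := lebesgue_stieltjes_measure F1.
Let m2 := lebesgue_stieltjes_measure F2.

Let stieltjes_itvoc (F : cumulative R R) a b : a <= b ->
  lebesgue_stieltjes_measure F `]a, b]%classic = (F b - F a)%:E.
Proof.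
move=> ab; rewrite /lebesgue_stieltjes_measure /measure_extension /=.
by rewrite measurable_mu_extE/= ?wlength_itv_bnd//; exact: is_ocitv.
Qed.

Let lebesgue_itvoc a b : a <= b -> mu `]a, b]%classic = (b - a)%:E.
Proof. by move=> ab; rewrite /lebesgue_measure stieltjes_itvoc. Qed.

(** The two Stieltjes measures sum to Lebesgue measure on half-open intervals, hence everywhere, so
    each is dominated by it. *)
Let m12 A : measurable A -> mu A = (m1 A + m2 A)%E.
Proof.
move=> mA; rewrite -measure_addE; apply: lebesgue_measure_unique => // X /ocitvP[->|[[a b] /= ab ->]].
  by rewrite !measure0.
apply/esym/(etrans (measure_addE _ _ _)).
transitivity ((F1 b - F1 a)%:E + (F2 b - F2 a)%:E)%E.
  by congr (_ + _)%E; [exact: (stieltjes_itvoc F1 (ltW ab))|exact: (stieltjes_itvoc F2 (ltW ab))].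
rewrite lebesgue_itvoc ?(ltW ab)//; apply/esym.
by rewrite -EFinD; congr EFin; transitivity (F1 b + F2 b - (F1 a + F2 a)); [rewrite !F12|ring].
Qed.

Section density.
Variables (a b : R).
Hypothesis ab : a < b.
Let I := `]a, b]%classic : set (measurableTypeR R).
Let mI : measurable I. Proof. exact: measurable_itv. Qed.
Let m1I : (m1 I < +oo)%E.
Proof. by rewrite /I /m1 stieltjes_itvoc ?ltry// ltW. Qed.
Let nu := mfrestr mI m1I.

Let nu_dom : nu `<< mu.
Proof.
move=> A nA B mB BA; have := nA B mB BA; rewrite m12// => /eqP.
rewrite padde_eq0// => /andP[/eqP m1B _].
rewrite /nu /mfrestr /mrestr; apply/eqP; rewrite -measure_le0 -m1B.
by apply: le_measure => //; rewrite inE//; exact: measurableI.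
Qed.

Lemma lipschitz_ftc : exists k : R -> R, [/\ measurable_fun setT k,
  mu.-integrable `]a, b]%classic (EFin \o k),
  forall x y, a <= x -> x <= y -> y <= b ->
    psi y - psi x = \int[mu]_(t in `]x, y]%classic) k t &
  {ae mu, forall x, a < x -> x < b -> is_derive x 1 psi (k x)}].
Proof.
have [f [f0 ffin iff hf]] := radon_nikodym_sigma_finite nu_dom.
pose k0 x := fine (f x).
have fk0 : f = EFin \o k0 by apply/funext => x; rewrite /k0 /= fineK.
have ik0 : mu.-integrable setT (EFin \o k0) by rewrite -fk0.
have mk0 : measurable_fun setT k0 by apply/measurable_EFinP; exact: measurable_int ik0.
have ik0S D : measurable (D : set (measurableTypeR R)) -> mu.-integrable D (EFin \o k0).
  by move=> mD; exact: (integrableS measurableT mD (@subsetT _ _) ik0).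
have F1E x y : a <= x -> x <= y -> y <= b -> F1 y - F1 x = \int[mu]_(t in `]x, y]%classic) k0 t.
  move=> ax xy yb; apply: EFin_inj; rewrite -stieltjes_itvoc// -/m1.
  have mJ : measurable (`]x, y]%classic : set (measurableTypeR R)) by exact: measurable_itv.
  have -> : m1 `]x, y]%classic = nu `]x, y]%classic.
    rewrite /nu /mfrestr /mrestr setIidl// => t /=; rewrite !in_itv /= => /andP[xt ty].
    by rewrite /I /= in_itv /= (le_lt_trans ax xt) (le_trans ty yb).
  transitivity (\int[mu]_(t in `]x, y]%classic) f t)%E; first exact: hf.
  rewrite fk0 /Rintegral fineK//; apply: integrable_fin_num => //; exact: ik0S.
(* This is the derivative because psi = 2M F1 - M x. *)
pose k x := 2 * M * k0 x - M.
have mk : measurable_fun setT k by apply: measurable_funB => //; exact: measurable_funM.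
have cint x y : x <= y -> mu.-integrable `]x, y]%classic (EFin \o (fun=> M)).
  move=> xy; apply: measurable_bounded_integrable => //.
    have h : (mu `]x, y]%classic < +oo)%E by rewrite lebesgue_itvoc// ltry.
    exact: h.
  by exists `|M|; split => // K MK z _; exact: ltW.
have mJ x y : measurable (`]x, y]%classic : set (measurableTypeR R)) by exact: measurable_itv.
have ik2 x y : mu.-integrable `]x, y]%classic (EFin \o (fun t => 2 * M * k0 t)).
  have := integrableZl (mJ x y) (2 * M) (ik0S _ (mJ x y)).
  by apply: eq_integrable => //; exact: mJ.
exists k; split => //.
- have := integrableB (mJ a b) (ik2 a b) (cint a b (ltW ab)).
  by apply: eq_integrable => //; exact: mJ.
- move=> x y ax xy yb; rewrite /k RintegralB; [|exact: mJ|exact: ik2|exact: cint].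
  rewrite RintegralZl; [|exact: mJ|exact: ik0S (mJ _ _)].
  rewrite -F1E// Rintegral_cst; last exact: mJ.
  rewrite -[fine _]/(fine (mu `]x, y]%classic)) lebesgue_itvoc//= /F1 /c.
  by field; rewrite gt_eqF.
have lk0 : locally_integrable [set: R] k0.
  by have := integrable_locally measurableT ik0; rewrite patch_setT.
(* Differentiates the primitive of k0 almost everywhere. *)
have := @FTC1 R k0 (BRight a) (fun y => ik0S _ (measurable_itv _)) lk0.
move=> /= [N [mN N0 hN]]; exists N; split => // x nx; apply: hN => hx; apply: nx => /= ax xb.
have [dF FE] := hx ax.
have h1 : is_derive x 1 F1 (k0 x).
  have h2 := derivable_is_derive dF; rewrite FE in h2.
  have := is_deriveD1 h2 (is_derive_cst (F1 a) x 1); rewrite addr0.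
  apply: is_derive_near; near=> y.
  have : y \in `]a, b[ by near: y; apply: near_in_itvoo; rewrite in_itv /= ax xb.
  by rewrite in_itv /= => /andP[ya yb]; rewrite -F1E ?subrK// ltW.
have := is_deriveD1 (is_deriveM1 (is_derive_cst (2 * M) x 1) h1) (is_deriveM1 (is_derive_cst (- M) x 1) (is_derive_id x 1)).
rewrite /cst !mul0r !add0r mulr1 -/(k x).
have -> // : (fun y => 2 * M * F1 y + - M * y) = psi.
by apply/funext => y; rewrite /F1 /c; field; rewrite gt_eqF.
Unshelve. all: by end_near. Qed.

End density.

End lipschitz_ftc.

(** * Growth and second derivatives of the test functions *)

Section holder.
Context {R : realType}.
Local Notation mu := (@lebesgue_measure R).
Implicit Types (phi psi F : R -> R) (s r d C v w : R).

Lemma growth_antiderivative F r C : 0 <= r -> 0 <= C -> (forall x, derivable F x 1) ->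
  (forall v, 0 <= v -> `|derive1 F v| <= C * (1 + v `^ r)) ->
  exists2 C', 0 <= C' & forall v, 0 <= v -> `|F v| <= C' * (1 + v `^ (r + 1)).
Proof.
move=> r0 C0 dF hF; exists (`|F 0| + 2 * C); first by rewrite addr_ge0// mulr_ge0.
move=> v v0; have [c] := MVT_eq dF 0 v; rewrite min_l// max_r// subr0 => /andP[c0 cv] E.
have r1 : 0 < r + 1 by rewrite ltr_wpDl.
have e : v * v `^ r = v `^ (r + 1) by rewrite -(mulr_powRB1 v0 r1) addrK.
have p0 := powR_ge0 v (r + 1).
have vle : v <= 1 + v `^ (r + 1).
  have [v1|v1] := leP v 1; first by rewrite (le_trans v1)// lerDl.
  apply: (@le_trans _ _ (v `^ (r + 1))); last by rewrite lerDr.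
  by rewrite -{1}(powRr1 v0) ler_powR ?(ltW v1)// lerDr.
have cr : c `^ r <= v `^ r by apply: ge0_ler_powR; rewrite ?nnegrE.
have h : `|derive1 F c * v| <= C * (1 + 2 * v `^ (r + 1)).
  rewrite normrM (ger0_norm v0); apply: (@le_trans _ _ (C * (1 + c `^ r) * v)).
    by rewrite ler_wpM2r// hF.
  rewrite -mulrA ler_wpM2l// mulrDl mul1r mulrC.
  have := ler_wpM2l v0 cr; rewrite e mulrC; lra.
have FE : F v = F 0 + derive1 F c * v by rewrite -E addrC subrK.
rewrite FE; apply: (le_trans (ler_normD _ _)).
have n0 := normr_ge0 (F 0); have := mulr_ge0 n0 p0; nra.
Qed.

(** Induction downwards from the Hölder continuous derivative, whose growth exponent is d; each of
    the k integrations raises the exponent by 1. *)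
Lemma holder_derive_bound phi (m : nat) d C : 0 < d <= 1 ->
  (forall k : nat, (k < m)%N -> forall x, derivable (derive1n k phi) x 1) ->
  (forall v w, v != w -> `|derive1n m phi v - derive1n m phi w| / (`|v - w| `^ d) <= C) ->
  forall k : nat, (k <= m)%N -> exists2 C', 0 <= C' &
    forall v, 0 <= v -> `|derive1n (m - k) phi v| <= C' * (1 + v `^ (k%:R + d)).
Proof.
move=> /andP[d0 d1] dphi hC; elim=> [_|k IH km].
  rewrite subn0 add0r; exists (`|derive1n m phi 0| + `|C|); first by rewrite addr_ge0.
  move=> v; rewrite le_eqVlt => /predU1P[<-|v0].
    by rewrite powR0 ?gt_eqF// addr0 mulr1 lerDl.
  have := hC v 0; rewrite gt_eqF// subr0 (gtr0_norm v0) => /(_ isT).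
  rewrite ler_pdivrMr ?powR_gt0// => h.
  have p0 := powR_ge0 v d; have C1 := ler_wpM2r p0 (ler_norm C).
  have := ler_normD (derive1n m phi v - derive1n m phi 0) (derive1n m phi 0); rewrite subrK.
  have n0 := normr_ge0 (derive1n m phi 0); have := mulr_ge0 n0 p0; have := normr_ge0 C; nra.
have [C' C'0 hC'] := IH (ltnW km).
have lt : (m - k.+1 < m)%N by rewrite ltn_subrL /= (leq_ltn_trans _ km).
have := growth_antiderivative (F := derive1n (m - k.+1) phi) (r := k%:R + d) _ C'0 (dphi _ lt).
rewrite -natr1 addrAC; apply; first by rewrite addr_ge0// ltW.
move=> v v0; rewrite -derive1nS -subSn// subSS; exact: hC'.
Qed.

Lemma holder_growth s phi : 1 < s -> holder_class s phi ->
  [/\ forall x, derivable phi x 1,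
      exists2 C, 0 <= C & forall v, 0 <= v -> `|phi v| <= C * (1 + v `^ s) &
      exists2 C, 0 <= C & forall v, 0 <= v -> `|derive1 phi v| <= C * (1 + v `^ (s - 1))].
Proof.
move=> s1 [m [d [d01 sE dphi [C hC]]]]; have /andP[d0 d1] := d01.
have m0 : (0 < m)%N by rewrite lt0n; apply/eqP => m0; move: s1; rewrite sE m0 add0r; lra.
have hb := holder_derive_bound d01 dphi hC.
split.
- by move=> x; exact: (dphi 0%N m0 x).
- by have := hb m (leqnn m); rewrite subnn -sE.
- have := hb m.-1 (leq_pred m); rewrite -{1}(prednK m0) subSnn derive1n1.
  rewrite (_ : m.-1%:R + d = s - 1)// sE -{2}(prednK m0) -natr1; ring.
Qed.

Lemma derivable_lipschitz_bound psi v C : 0 < v ->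
  (exists2 r, 0 < r & forall w, `|w - v| < r -> `|psi w - psi v| <= C * `|w - v|) ->
  derivable psi v 1 -> `|derive1 psi v| <= C.
Proof.
move=> v0 [r r0 hr] dpsi; apply/ler_addgt0Pl => e e0.
have [r' r'0 hr'] := (is_derive1P _ _ _).1 (derivable_is_derive dpsi) _ e0.
pose h := Num.min r r' / 2.
have m0 : 0 < Num.min r r' by rewrite lt_min r0.
have h0 : 0 < h by rewrite divr_gt0.
have hm : h < Num.min r r' by rewrite /h; lra.
move: (hm); rewrite lt_min => /andP[hr1 hr2].
have := hr (v + h); have := hr' (v + h); rewrite addrAC subrr add0r gtr0_norm// => /(_ hr2) k1 /(_ hr1) k2.
rewrite -(ler_pM2r h0) -{1}(gtr0_norm h0) -normrM.
rewrite (_ : derive1 psi v * h = (psi (v + h) - psi v) - (psi (v + h) - psi v - h * derive1 psi v)); last by ring.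
by apply: (le_trans (ler_normB _ _)); rewrite mulrDl addrC lerD.
Qed.

Lemma fokker_planck_test_derivative s phi : 1 < s -> fokker_planck_test s phi ->
  (forall a b, 0 < a -> exists2 M, 0 < M & forall x y, a <= x <= b -> a <= y <= b ->
     `|derive1 phi x - derive1 phi y| <= M * `|x - y|) /\
  exists2 C, 0 <= C & forall v, 0 < v -> derivable (derive1 phi) v 1 ->
     `|v ^+ 2 * derive1 (derive1 phi) v| <= C * (1 + v `^ s).
Proof.
move=> s1 [[m [d [d01 sE dphi [C hC]]]] hs]; have /andP[d0 d1] := d01.
have [s2|s2] := ltP s 2.
  have [lip [C' gr]] := hs s2; split; last first.
    exists (Num.max C' 0); first by rewrite le_max lexx orbT.
    move=> v v0 _; apply: (le_trans (gr v v0)); rewrite ler_wpM2r ?addr_ge0 ?powR_ge0//.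
    by rewrite le_max lexx.
  move=> a b a0; have [K [_ hK]] := lip a b a0.
  exists (`|K| + 1); first by rewrite ltr_wpDl.
  move=> x y xab yab; apply: (hK (`|K| + 1) _ (x, y)).
    by rewrite (le_lt_trans (ler_norm K))// ltrDl.
  by split; rewrite /= in_itv.
(* For s >= 2, m = 0 is excluded; m = 1 forces d = 1, so that s = 2 and phi' is Lipschitz; for m >=
   2 the second derivative exists everywhere and grows like v^(s - 2). *)
case: m sE dphi hC => [|[|m]] sE dphi hC.
- by move: s2; rewrite sE add0r; lra.
- have dE : d = 1 by move: s2; rewrite sE; lra.
  have lip x y : `|derive1 phi x - derive1 phi y| <= (`|C| + 1) * `|x - y|.
    have [->|xy] := eqVneq x y; first by rewrite !subrr normr0 mulr0.
    have := hC x y xy; rewrite dE powRr1// derive1n1 ler_pdivrMr ?normr_gt0 ?subr_eq0//.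
    move=> /le_trans; apply; rewrite ler_wpM2r//; apply: (le_trans (ler_norm C)).
    by rewrite lerDl.
  split; first by move=> a b _; exists (`|C| + 1) => //; rewrite ltr_wpDl.
  exists (`|C| + 1); first by rewrite addr_ge0.
  move=> v v0 dv; have := @derivable_lipschitz_bound (derive1 phi) v (`|C| + 1) v0 _ dv.
  move=> /(_ _)/le_trans hb; rewrite normrM (ger0_norm (sqr_ge0 v)).
  have h1 : `|derive1 (derive1 phi) v| <= `|C| + 1.
    by apply: (derivable_lipschitz_bound v0 _ dv); exists 1 => // w _; exact: lip.
  have sE2 : s = 2 by rewrite sE dE; ring.
  rewrite sE2 (powR_mulrn 2 (ltW v0)) mulrC.
  apply: ler_pM => //; rewrite ?sqr_ge0// lerDr ler01//.
- have dphi1 := dphi 1%N isT.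
  have mm : (m <= m.+2)%N by rewrite -addn2 leq_addr.
  have [C' C'0] := holder_derive_bound d01 dphi hC mm.
  rewrite -addn2 addKn => hC'; pose r : R := m%:R + d.
  have r0 : 0 <= r by rewrite addr_ge0// ltW.
  have sE2 : s = 2 + r by rewrite sE /r -natr1 -natr1; ring.
  split.
    move=> a b a0; exists (C' * (1 + b `^ r) + 1).
      by rewrite ltr_wpDl// mulr_ge0// weight_ge0.
    move=> x y /andP[ax xb] /andP[ay yb]; have [c hc ->] := MVT_eq dphi1 y x.
    have [c0 cb] : 0 <= c /\ c <= b.
      move: hc; rewrite ge_min le_max => /andP[h1 h2]; split.
        by case/orP: h1 => h1; apply: le_trans h1; exact: le_trans (ltW a0) _.
      by case/orP: h2 => h2; apply: (le_trans h2).
    rewrite normrM ler_wpM2r//; apply: (@le_trans _ _ (C' * (1 + b `^ r))); last by rewrite lerDl.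
    apply: (le_trans (hC' c c0)); rewrite ler_wpM2l// lerD2l.
    by apply: ge0_ler_powR; rewrite ?nnegrE// (le_trans c0).
  exists (2 * C'); first by rewrite mulr_ge0.
  move=> v v0 _; have v20 := sqr_ge0 v.
  rewrite normrM (ger0_norm v20); apply: (@le_trans _ _ (v ^+ 2 * (C' * (1 + v `^ r)))).
    by rewrite ler_wpM2l// hC'// ltW.
  have e : v ^+ 2 * v `^ r = v `^ s.
    rewrite sE2 [in RHS]powRD; last by rewrite (gt_eqF v0) implybT.
    by rewrite (powR_mulrn 2 (ltW v0)).
  have vle : v ^+ 2 <= 1 + v `^ s.
    have p0 := powR_ge0 v s.
    have [v1|v1] := leP v 1; first by rewrite (le_trans (exprn_ile1 2 (ltW v0) v1))// lerDl.
    apply: (@le_trans _ _ (v `^ s)); last by rewrite lerDr.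
    by rewrite -(powR_mulrn 2 (ltW v0)) ler_powR ?(ltW v1).
  rewrite (_ : v ^+ 2 * (C' * (1 + v `^ r)) = C' * (v ^+ 2 + v ^+ 2 * v `^ r)); last by ring.
  rewrite e -mulrA mulrCA ler_wpM2l//; have := powR_ge0 v s; lra.
Qed.

(** A derivative is the pointwise limit of continuous difference quotients. *)
Lemma measurable_derive1 phi : (forall x, derivable phi x 1) -> measurable_fun setT (derive1 phi).
Proof.
move=> dphi.
have cphi : continuous phi by move=> x; exact: is_derive_continuous (derivable_is_derive (dphi x)).
pose h (n : nat) x := n.+1%:R * (phi (x + n.+1%:R^-1) - phi x).
apply: (@measurable_fun_cvg _ _ _ _ h).
  move=> n; apply: continuous_measurable_fun => x; apply: cvgMl_tmp; apply: cvgB; last exact: cphi.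
  apply: (@continuous_comp R R R (fun x => x + n.+1%:R^-1) phi); last exact: cphi.
  by apply: cvgD; [exact: cvg_id|exact: cvg_cst].
move=> x _; apply/cvgrPdist_le => e e0.
have [r r0 hr] := (is_derive1P _ _ _).1 (derivable_is_derive (dphi x)) _ e0.
have cz : n.+1%:R^-1 @[n --> \oo] --> (0 : R) by exact: cvg_harmonic.
have /cvgrPdist_lt/(_ r r0) hz := cz.
near=> n; have n0 : 0 < n.+1%:R :> R by rewrite ltr0n.
have ni : 0 < n.+1%:R^-1 :> R by rewrite invr_gt0.
have : `|0 - n.+1%:R^-1| < r by near: n.
rewrite sub0r normrN (gtr0_norm ni) => nr.
have := hr (x + n.+1%:R^-1); rewrite addrAC subrr add0r (gtr0_norm ni) => /(_ nr) hh.
rewrite distrC (_ : h n x - _ = n.+1%:R * (phi (x + n.+1%:R^-1) - phi x - n.+1%:R^-1 * derive1 phi x)); last first.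
  by rewrite /h; field; rewrite gt_eqF.
by rewrite normrM (gtr0_norm n0) mulrC -ler_pdivlMr.
Unshelve. all: by end_near. Qed.

Section second_derivative.
Variables (psi : R -> R) (s C : R).
Hypothesis C_ge0 : 0 <= C.
Hypothesis lip : forall a b, 0 < a -> exists2 M, 0 < M & forall x y, a <= x <= b -> a <= y <= b ->
     `|psi x - psi y| <= M * `|x - y|.
Hypothesis gr : forall v, 0 < v -> derivable psi v 1 -> `|v ^+ 2 * derive1 psi v| <= C * (1 + v `^ s).

(** Composition with the projection onto [a, b] gives a globally Lipschitz function that agrees with
    psi inside. *)
Let local_ftc a b : 0 < a -> a < b -> exists kN : (R -> R) * set (measurableTypeR R),
  [/\ measurable_fun setT kN.1, measurable kN.2, mu kN.2 = 0%E,
    forall x y, a <= x -> x <= y -> y <= b -> psi y - psi x = \int[mu]_(t in `]x, y]%classic) kN.1 t &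
    forall x, a < x -> x < b -> ~ kN.2 x -> is_derive x 1 psi (kN.1 x)].
Proof.
move=> a0 ab; have [M M0 hM] := lip b a0.
pose cl (x : R) := Num.max a (Num.min b x).
have cl_in x : a <= cl x <= b by rewrite /cl le_max lexx /= ge_max (ltW ab) ge_min lexx.
have clE x : a <= x -> x <= b -> cl x = x by move=> ax xb; rewrite /cl min_r// max_r.
have cl_lip x y : `|cl x - cl y| <= `|x - y|.
  wlog xy : x y / x <= y => [hw|].
    have [xy|yx] : x <= y \/ y <= x by apply/orP; exact: le_total.
      exact: hw.
    by rewrite distrC [leRHS]distrC; exact: hw.
  have clC z : cl z = if z <= a then a else if b <= z then b else z.
    rewrite /cl; case: (leP b z) => bz; case: (leP z a) => za; rewrite ?max_r ?max_l ?(ltW ab) ?(ltW za)//.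
    by have := lt_le_trans ab (le_trans bz za); rewrite ltxx.
  have h : 0 <= cl y - cl x <= y - x.
    rewrite !clC; case: (leP x a) => xa; case: (leP y a) => ya; case: (leP b x) => bx; case: (leP b y) => yb; apply/andP; split; lra.
  have /andP[h1 h2] := h.
  by rewrite distrC [leRHS]distrC !ger0_norm// subr_ge0.
have lipcl x y : `|psi (cl x) - psi (cl y)| <= M * `|x - y|.
  by apply: (le_trans (hM _ _ (cl_in x) (cl_in y))); rewrite ler_wpM2l// ltW.
have [k [mk _ hk [N [mN N0 hN]]]] := lipschitz_ftc M0 lipcl ab.
exists (k, N); split => //=.
  move=> x y ax xy yb; by rewrite -hk// (clE y (le_trans ax xy) yb) (clE x ax (le_trans xy yb)).
move=> x ax xb Nx.
have h : is_derive x 1 (psi \o cl) (k x).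
  by apply: contrapT => h; apply: Nx; apply: hN => /= h'; apply: h; exact: h'.
apply: is_derive_near h; near=> y.
have : y \in `]a, b[ by near: y; apply: near_in_itvoo; rewrite in_itv /= ax xb.
by rewrite in_itv /= => /andP[ya yb]; rewrite clE// ltW.
Unshelve. all: by end_near. Qed.

(** D is psi' set to 0 on an exceptional set. Measurability and the growth bound then hold at every
    point of R_+, and later estimates can be pointwise. *)
Lemma second_derivative : exists (D : R -> R) (N : set (measurableTypeR R)),
  [/\ measurable_fun setT D, measurable N /\ mu N = 0%E,
    forall v, 0 < v -> ~ N v -> derive1 psi v = D v,
    forall v, 0 <= v -> `|v ^+ 2 * D v| <= C * (1 + v `^ s) &
    forall x y, 0 < x -> x <= y -> psi y - psi x = \int[mu]_(t in `]x, y]%classic) D t].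
Proof.
(* The intervals exhaust ]0, +oo[; the added 1 keeps a n < b n at n = 0. *)
pose a (n : nat) : R := n.+1%:R^-1; pose b (n : nat) : R := n.+1%:R + 1.
have a0 n : 0 < a n by rewrite invr_gt0.
have ab n : a n < b n.
  rewrite /a /b (@le_lt_trans _ _ 1)//; first by rewrite invf_le1// ler1n.
  by rewrite ltrDr ltr0n.
have [kN hkN] := choice (fun n => local_ftc (a0 n) (ab n)).
pose k n := (kN n).1; pose N := \bigcup_n (kN n).2.
have mN : measurable (N : set (measurableTypeR R)) by apply: bigcup_measurable => n _; have [] := hkN n.
have N0 : mu N = 0%E.
  apply: measure_negligible => //; apply: negligible_bigcup => n.
  by exists (kN n).2; have [_ m1 n1 _ _] := hkN n; split.
pose D v := derive1 psi v * \1_(`]0, +oo[%classic `\` N) v.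
have large v : 0 < v -> exists m, forall n, (m <= n)%N -> a n < v /\ v < b n.
  move=> v0; exists (maxn (Num.truncn v^-1) (Num.truncn v)).+1 => n.
  rewrite gtn_max => /andP[n1 n2]; split.
    rewrite /a -[ltRHS]invrK ltf_pV2 ?posrE ?invr_gt0//.
    by rewrite (lt_le_trans (truncnS_gt _))// ler_nat ltnW.
  by rewrite /b (lt_le_trans (truncnS_gt _))// (@le_trans _ _ n.+1%:R) ?ler_nat ?lerDl// ltnW.
have kD n v : a n < v -> v < b n -> ~ N v -> is_derive v 1 psi (k n v) /\ k n v = D v.
  move=> av vb Nv; have [_ _ _ _ h] := hkN n.
  have hd : is_derive v 1 psi (k n v) by apply: h => // kNv; apply: Nv; exists n.
  split => //; rewrite /D (is_derive_derive1 hd) indicE mem_set ?mulr1//; split => //=.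
  by rewrite in_itv /= andbT (lt_trans _ av).
exists D, N; split => //.
- pose h n v := k n v * \1_(`]a n, b n[%classic `\` N) v.
  apply: (@measurable_fun_cvg _ _ _ _ h).
    move=> n; apply: measurable_funM; first by have [] := hkN n.
    by apply: measurable_ind; apply: measurableD => //; exact: measurable_itv.
  move=> v _; have [v0|v0] := ltP 0 v; last first.
    rewrite /D indicE memNset; last by move=> [] /=; rewrite in_itv /= andbT ltNge v0.
    rewrite mulr0; apply: cvg_near_cst; near=> n.
    rewrite /h indicE memNset ?mulr0// => -[] /=; rewrite in_itv /= => /andP[av _].
    by have := lt_trans (a0 n) av; rewrite ltNge v0.
  have [m hm] := large v v0; apply: cvg_near_cst; exists m => // n /= mn.
  have [av vb] := hm n mn; rewrite /h indicE; case: (pselect (N v)) => Nv.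
    rewrite memNset; last by move=> [].
    by rewrite /D indicE memNset ?mulr0// => -[].
  rewrite mem_set; last by split => //=; rewrite in_itv /= av.
  by rewrite mulr1; have [_ ->] := kD n v av vb Nv.
- move=> v v0 Nv; rewrite /D indicE mem_set ?mulr1//; split => //=.
  by rewrite in_itv /= andbT.
- move=> v v0; rewrite /D indicE; case: (pselect ((`]0, +oo[%classic `\` N) v)) => [h|h]; last first.
    by rewrite memNset// !mulr0 normr0 mulr_ge0 ?weight_ge0.
  rewrite mem_set// mulr1; case: h => /=; rewrite in_itv /= andbT => v1 Nv.
  have [m hm] := large v v1; have [av vb] := hm m (leqnn m).
  by have [hd _] := kD m v av vb Nv; apply: gr => //; exact: is_derive_derivable hd.
- move=> x y x0 xy; have [m1 h1] := large x x0; have [m2 h2] := large y (lt_le_trans x0 xy).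
  pose n := maxn m1 m2.
  have [ax _] := h1 n (leq_maxl _ _); have [_ yb] := h2 n (leq_maxr _ _).
  have [_ _ _ h _] := hkN n; rewrite (h x y (ltW ax) xy (ltW yb)).
  congr fine; apply: (integral_ae mN N0) => t /=; rewrite in_itv /= => /andP[xt ty] Nt.
  have [_ e] := kD n t (lt_trans ax xt) (le_lt_trans ty yb) Nt; exact: (congr1 EFin e).
Unshelve. all: by end_near. Qed.

End second_derivative.

End holder.

(** * The limit equation for general tests *)

Section generator.
Context {R : realType}.
Local Notation mu := (@lebesgue_measure R).
Local Notation Rp := (@Rplus R).
Implicit Types (v x y : R).

(** The derivatives are arguments because for a general test the second one is only a version of
    phi'' almost everywhere. *)
Definition generator (lambda : R) (d1 d2 : R -> R) v :=
  lambda / 2 * (v ^+ 2 * d2 v) - (v - 1) * d1 v.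

Definition flow_test (al lambda : R) (h : R -> R -> R) (phi d1 d2 : R -> R) :=
  [/\ tame al phi, tame al (generator lambda d1 d2),
      forall v : R, is_derive v 1 phi (d1 v), forall v : R, is_derive v 1 d1 (d2 v) &
      forall t : R, 0 < t -> is_derive t 1 (fun t : R => pairing phi (h t))
        (pairing (generator lambda d1 d2) (h t))].

Lemma expoly_expw (P : {poly R}) v :
  expoly P v * expw v = \sum_(i < size P) P`_i * ec i.+1%:R v.
Proof.
rewrite /expoly horner_coef mulr_suml; apply: eq_bigr => i _.
rewrite -mulrA; congr (_ * _); rewrite /expw /ec -expRM_natl -expRD; congr expR.
by rewrite mulrN -opprD -natr1 mulrDl mul1r.
Qed.

Section tests.
Variables (al lambda : R) (h : R -> R -> R).
Hypothesis al_ge1 : 1 <= al.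
Hypothesis dh : forall t : R, 0 < t -> dens al (h t).
Local Notation flow_test := (flow_test al lambda h).

Lemma flow_testD phi d1 d2 psi e1 e2 : flow_test phi d1 d2 -> flow_test psi e1 e2 ->
  flow_test (fun v => phi v + psi v) (fun v => d1 v + e1 v) (fun v => d2 v + e2 v).
Proof.
move=> [tp tg p1 p2 p3] [tq th q1 q2 q3].
have E : generator lambda (fun v => d1 v + e1 v) (fun v => d2 v + e2 v) =
    fun v => generator lambda d1 d2 v + generator lambda e1 e2 v.
  by apply/funext => v; rewrite /generator; ring.
split; [exact: tameD|by rewrite E; exact: tameD|move=> v; exact: is_deriveD1|move=> v; exact: is_deriveD1|].
move=> t t0; rewrite E (pairingD (dens_adm (dh t0)) tg th).
have := is_deriveD1 (p3 t t0) (q3 t t0).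
apply: is_derive_near; exists t => //= s; rewrite /ball /= => st.
have s0 : 0 < s by move: st; rewrite distrC ltr_norml; lra.
by rewrite (pairingD (dens_adm (dh s0)) tp tq).
Qed.

Lemma flow_testZ c phi d1 d2 : flow_test phi d1 d2 ->
  flow_test (fun v => c * phi v) (fun v => c * d1 v) (fun v => c * d2 v).
Proof.
move=> [tp tg p1 p2 p3].
have E : generator lambda (fun v => c * d1 v) (fun v => c * d2 v) =
    fun v => c * generator lambda d1 d2 v.
  by apply/funext => v; rewrite /generator; ring.
have dc (f : R -> R) (x d : R) : is_derive x 1 f d -> is_derive x 1 (fun y => c * f y) (c * d).
  move=> hf; have := is_deriveM1 (is_derive_cst c x 1) hf.
  by rewrite mul0r add0r.
split; [exact: tameZ|by rewrite E; exact: tameZ|move=> v; exact: dc|move=> v; exact: dc|].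
move=> t t0; rewrite E (pairingZ (dens_adm (dh t0)) _ tg).
have := dc _ _ _ (p3 t t0).
apply: is_derive_near; exists t => //= s; rewrite /ball /= => st.
have s0 : 0 < s by move: st; rewrite distrC ltr_norml; lra.
by rewrite (pairingZ (dens_adm (dh s0)) _ tp).
Qed.

Hypothesis mh : forall t : R, 0 < t -> pairing idfun (h t) = 1.

Lemma flow_test_affine A B : flow_test (fun v => A + B * v) (fun=> B) (fun=> 0).
Proof.
have tid := tame_id al_ge1; have tc c := tame_cst al c.
have ta : tame al (fun v => A + B * v) by apply: tameD; [exact: tc|exact: tameZ].
have E : generator lambda (fun=> B) (fun=> 0) = fun v => B + (- B) * v.
  by apply/funext => v; rewrite /generator; ring.
have pa a b (t : R) : 0 < t -> pairing (fun v => a + b * v) (h t) = a + b.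
  move=> t0; have ah := dens_adm (dh t0).
  rewrite (pairingD ah (tc a) (tameZ _ tid)) (pairingZ ah _ tid) mh//.
  by rewrite (dens_cst a (dh t0)) mulr1.
split.
- exact: ta.
- by rewrite E; apply: tameD; [exact: tc|exact: tameZ].
- move=> v; have := is_deriveD1 (is_derive_cst A v 1) (is_deriveM1 (is_derive_cst B v 1) (is_derive_id v 1)).
  by rewrite mul0r !add0r mulr1.
- by move=> v; exact: is_derive_cst.
- move=> t t0; rewrite E pa// subrr.
  have := is_derive_cst (A + B) t 1.
  apply: is_derive_near; exists t => //= s; rewrite /ball /= => st.
  have s0 : 0 < s by move: st; rewrite distrC ltr_norml; lra.
  by rewrite pa.
Qed.

Hypothesis deh : forall j (t : R), 0 < t -> is_derive t 1 (fun t : R => pairing (ec j%:R) (h t))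
        (pairing (fp lambda (ec j%:R)) (h t)).

Lemma flow_test_ec j : flow_test (ec j%:R) (fun v => - j%:R * ec j%:R v)
  (fun v => j%:R ^+ 2 * ec j%:R v).
Proof.
have E : generator lambda (fun v => - j%:R * ec j%:R v) (fun v => j%:R ^+ 2 * ec j%:R v) =
    fp lambda (ec j%:R).
  by apply/funext => v; rewrite /fp derive2_ec derive_ec.
split; rewrite ?E.
- exact: tame_ec.
- exact: tame_fp_ec.
- by move=> v; exact: is_derive_ec.
- move=> v; have := is_deriveM1 (is_derive_cst (- j%:R : R) v 1) (is_derive_ec j%:R v).
  by rewrite mul0r add0r mulrA mulNr mulrN opprK -expr2.
- by move=> t t0; exact: deh.
Qed.

(** The factor exp(-v) makes every exponent i + 1 positive, so each term is integrated twice by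
    dividing by (i + 1)^2. An affine test then adjusts the values at v = 1. *)
Lemma flow_test_second_derivative (P : {poly R}) A B : exists phi d1,
  [/\ flow_test phi d1 (fun v => expoly P v * expw v), phi 1 = A & d1 1 = B].
Proof.
have base m : exists phi d1, flow_test phi d1 (fun v => \sum_(i < m) P`_i * ec i.+1%:R v).
  elim: m => [|m [phi [d1 H]]].
    exists (fun v => 0 + 0 * v), (fun=> 0).
    rewrite (_ : (fun v : R => \sum_(i < 0) _) = fun=> 0); first exact: flow_test_affine.
    by apply/funext => v; rewrite big_ord0.
  have K := flow_testD H (flow_testZ (P`_m / m.+1%:R ^+ 2) (flow_test_ec m.+1)).
  eexists; eexists; move: K; rewrite (_ : (fun v => _ + _ * (m.+1%:R ^+ 2 * _)) =
    fun v => \sum_(i < m.+1) P`_i * ec i.+1%:R v); first by apply.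
  apply/funext => v; rewrite big_ord_recr /= mulrA mulfVK.
    by [].
  by rewrite expf_neq0// pnatr_eq0.
have [phi [d1 H]] := base (size P).
have := flow_testD H (flow_test_affine (A - phi 1 - (B - d1 1)) (B - d1 1)).
rewrite (_ : (fun v => _ + 0) = fun v => expoly P v * expw v); last first.
  by apply/funext => v; rewrite expoly_expw addr0.
move=> K; do 2 eexists; split; [exact: K| |]; cbn; ring.
Qed.

End tests.
End generator.

(** * Truncation of the second derivative *)

Section clamp.
Context {R : realType}.
Local Notation mu := (@lebesgue_measure R).
Local Notation Rp := (@Rplus R).
Implicit Types (v x y : R).

Lemma continuous_ftc (d1 d2 : R -> R) x y : (forall v, is_derive v 1 d1 (d2 v)) ->
  continuous d2 -> x <= y -> d1 y - d1 x = \int[mu]_(t in `]x, y]%classic) d2 t.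
Proof.
move=> h cd; rewrite le_eqVlt => /predU1P[->|xy].
  by rewrite subrr set_itvoc0 Rintegral_set0.
have c1 : continuous d1 by move=> v; exact: is_derive_continuous (h v).
have w : {within `[x, y], continuous d2} by apply: continuous_subspaceT.
have D : derivable_oo_LRcontinuous d1 x y.
  split; first by move=> v _; exact: is_derive_derivable (h v).
    exact: cvg_at_right_filter (c1 x).
  exact: cvg_at_left_filter (c1 y).
have E : {in `]x, y[, derive1 d1 =1 d2} by move=> v _; exact: is_derive_derive1 (h v).
have mJ : measurable (`]x, y]%classic : set (measurableTypeR R)) by exact: measurable_itv.
rewrite Rintegral_itv_obnd_cbnd.
  by rewrite /Rintegral (continuous_FTC2 xy w D E).
have := continuous_compact_integrable (@segment_compact _ x y) w.
by apply: (@integrableS _ _ _ mu `[x, y]) => //; exact: subset_itv_oc_cc.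
Qed.

Definition clamp (a b v : R) := Num.max a (Num.min v b).

Lemma clamp_itv a b v : a <= b -> a <= clamp a b v <= b.
Proof. by move=> ab; rewrite /clamp le_max lexx/= ge_max ab ge_min lexx orbT. Qed.

Lemma clamp_id a b v : a <= v -> v <= b -> clamp a b v = v.
Proof. by move=> av vb; rewrite /clamp (min_idPl vb) (max_idPr av). Qed.

Lemma clampE a b v : a <= b ->
  [\/ v <= a /\ clamp a b v = a, b <= v /\ clamp a b v = b | a < v < b /\ clamp a b v = v].
Proof.
move=> ab; rewrite /clamp; have [va|va] := leP v a.
  by apply: Or31; split => //; rewrite (min_idPl (le_trans va ab)) (max_idPl va).
have [bv|vb] := leP b v; last by apply: Or33; split => //; rewrite (max_idPr (ltW va)).
by apply: Or32; split => //; rewrite (max_idPr ab).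
Qed.

Lemma clamp_le a b x y : x <= y -> clamp a b x <= clamp a b y.
Proof. by move=> xy; rewrite /clamp le_max2// le_min2. Qed.

Lemma setI_itv_clamp a b x y : a <= b ->
  `]x, y] `&` `]a, b] = `](clamp a b x), (clamp a b y)]%classic :> set R.
Proof.
move=> ab; apply/seteqP; split => v /=; rewrite !in_itv /=.
  move=> [/andP[xv vy] /andP[av vb]]; rewrite /clamp gt_max av/= gt_min xv/=.
  by rewrite le_max le_min vy vb orbT.
move=> /andP[]; have [[h ->]|[h ->]|[/andP[h h'] ->]] := clampE x ab;
 have [[k ->]|[k ->]|[/andP[k k'] ->]] := clampE y ab => p1 p2; split; apply/andP; split; lra.
Qed.

Section derivative_clamp.
Variables (f1 D : R -> R) (a b : R).
Hypotheses (a_gt0 : 0 < a) (a_le1 : a < 1) (b_ge1 : 1 <= b).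
Hypothesis ftcD : forall x y, 0 < x -> x <= y -> f1 y - f1 x = \int[mu]_(t in `]x, y]%classic) D t.

(* Density of phi'' 1_]a, b] dv with respect to exp(-v) dv. *)
Definition truncated_density v := \1_(`]a, b]%classic) v * (D v * expR v).

Let ab : a <= b. Proof. exact: le_trans (ltW a_le1) b_ge1. Qed.

Lemma derivative_clampE x y : x <= y ->
  f1 (clamp a b y) - f1 (clamp a b x) =
  \int[mu]_(t in `]x, y]%classic) (truncated_density t * expw t).
Proof.
move=> xy; have /andP[cx _] := clamp_itv x ab.
rewrite (ftcD (lt_le_trans a_gt0 cx) (clamp_le _ _ xy)) -(setI_itv_clamp _ _ ab).
rewrite Rintegral_mkcondr; apply: eq_Rintegral => v _.
rewrite /truncated_density /expw patchE indicE; case: (v \in _); last by rewrite !mul0r.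
by rewrite mul1r -mulrA -expRD subrr expR0 mulr1.
Qed.

(** Both derivatives agree at 1, which the clamp fixes because a < 1 <= b. Integration from 1 bounds
    their uniform distance by the L^1 distance of the densities with respect to exp(-v) dv. *)
Lemma derivative_approx (P : {poly R}) (d1 : R -> R) (eta al : R) : 0 < al ->
  tame al truncated_density ->
  (forall v, is_derive v 1 d1 (expoly P v * expw v)) -> d1 1 = f1 1 ->
  pairing (fun v => `|truncated_density v - expoly P v|) expw <= eta ->
  forall v, 0 <= v -> `|f1 (clamp a b v) - d1 v| <= eta.
Proof.
move=> al0 tQ hd d1E hP.
have aw := adm_expw al0; have tP := tame_expoly al P.
have cont : continuous (fun v : R => expoly P v * expw v : R).
  suff h (v : R) : {for v, continuous (fun v : R => expoly P v * expw v : R)} by move=> v; exact: h.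
  have h1 : is_derive v 1 (expoly P) (derive1 (expoly P) v).
    by apply: derivable_is_derive; exact: (@smooth_expoly R P 0%N v).
  have h2 : is_derive v 1 (@expw R) (derive1 (@expw R) v).
    by apply: derivable_is_derive; exact: (@smooth_expw R 0%N v).
  exact: is_derive_continuous (is_deriveM1 h1 h2).
have key x y : 0 <= x -> x <= y ->
    `|(f1 (clamp a b y) - d1 y) - (f1 (clamp a b x) - d1 x)| <= eta.
  move=> x0 xy; apply: le_trans hP.
  have mJ : measurable (`]x, y]%classic : set (measurableTypeR R)) by exact: measurable_itv.
  have sub : `]x, y]%classic `<=` Rp.
    by move=> v /=; rewrite in_itv /= RplusE => /andP[/ltW xv _]; exact: le_trans xv.
  have i1 := integrableS measurable_Rplus mJ sub (tame_integrable aw tQ).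
  have i2 := integrableS measurable_Rplus mJ sub (tame_integrable aw tP).
  have i3 := tame_integrable aw (tame_norm (tameB tQ tP)).
  rewrite (_ : _ - _ = (f1 (clamp a b y) - f1 (clamp a b x)) - (d1 y - d1 x)); last by ring.
  rewrite derivative_clampE// (continuous_ftc hd cont xy) -RintegralB//.
  apply: (le_trans (le_normr_Rintegral _ _)) => //.
    exact: (integrableB mJ i1 i2).
  rewrite /pairing.
  rewrite (_ : Rintegral _ _ _ = \int[mu]_(v in `]x, y]%classic) (`|truncated_density v - expoly P v| * expw v)); last first.
    by apply: eq_Rintegral => v _; rewrite -mulrBl normrM (gtr0_norm (expR_gt0 _)).
  have i4 := integrableS measurable_Rplus mJ sub i3.
  rewrite /Rintegral fine_le ?integrable_fin_num//; last apply: ge0_subset_integral => //.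
  - exact: measurable_Rplus.
  - exact: measurable_Rplus.
  - by case/integrableP: i3.
  - by move=> v _; rewrite lee_fin mulr_ge0 ?expR_ge0.
move=> v v0; have e1 : f1 (clamp a b 1) - d1 1 = 0.
  by rewrite clamp_id ?(ltW a_le1)// d1E subrr.
have [v1|v1] := leP v 1.
  by have := key v 1 v0 v1; rewrite e1 sub0r normrN.
by have := key 1 v ler01 (ltW v1); rewrite e1 subr0.
Qed.

End derivative_clamp.
End clamp.

(** * Pointwise errors of the approximating tests *)

Section test_errors.
Context {R : realType} {al : R}.
Local Notation mu := (@lebesgue_measure R).
Local Notation Rp := (@Rplus R).
Implicit Types (v x y : R).
Hypothesis al_gt1 : 1 < al.
Let al_gt0 : 0 < al. Proof. exact: lt_trans al_gt1. Qed.

Lemma le_weight v : 0 <= v -> v <= 1 + v `^ al.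
Proof.
move=> v0; have [v1|v1] := leP v 1; first by rewrite (le_trans v1)// weight_ge1.
have h : v <= v `^ al by rewrite -{1}(powRr1 v0) ler_powR// ltW.
by rewrite (le_trans h)// lerDr.
Qed.

Lemma powR_pred_le_weight v : 0 <= v -> v `^ (al - 1) <= 1 + v `^ al.
Proof.
move=> v0; have [v1|v1] := leP v 1; last first.
  have h : v `^ (al - 1) <= v `^ al by rewrite ler_powR ?ltW//; lra.
  by rewrite (le_trans h)// lerDr.
apply: (@le_trans _ _ 1); last exact: weight_ge1.
have := @ge0_ler_powR R (al - 1) _ v 1; rewrite powR1; apply => //; rewrite ?nnegrE//.
by rewrite subr_ge0 ltW.
Qed.

Lemma weight_predM v : 0 <= v -> (v + 1) * (1 + v `^ (al - 1)) <= 3 * (1 + v `^ al).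
Proof.
move=> v0; have e : v * v `^ (al - 1) = v `^ al.
  have [->|vn] := eqVneq v 0; first by rewrite mul0r powR0// gt_eqF.
  by rewrite -{1}(powRr1 v0) -powRD ?vn ?implybT// addrC subrK.
have := le_weight v0; have := powR_pred_le_weight v0.
rewrite mulrDl mul1r mulrDr mulr1 e; lra.
Qed.

Variables (phi f1 D : R -> R) (C1 C2 : R).
Hypotheses (C1_ge0 : 0 <= C1) (C2_ge0 : 0 <= C2).
Hypothesis dphi : forall v, is_derive v 1 phi (f1 v).
Hypothesis f1_growth : forall v, 0 <= v -> `|f1 v| <= C1 * (1 + v `^ (al - 1)).
Hypothesis D_growth : forall v, 0 <= v -> `|v ^+ 2 * D v| <= C2 * (1 + v `^ al).

Section errors.
Variables (a b eta lambda : R) (P : {poly R}) (psi d1 : R -> R).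
Hypotheses (a_gt0 : 0 < a) (a_lt1 : a < 1) (b_ge1 : 1 <= b) (eta_ge0 : 0 <= eta).
Hypothesis lambda_gt0 : 0 < lambda.
Hypothesis dpsi : forall v, is_derive v 1 psi (d1 v).
Hypothesis psi1 : psi 1 = phi 1.
Hypothesis approx : forall v, 0 <= v -> `|f1 (clamp a b v) - d1 v| <= eta.
Let A : set R := ~` `]a, b]%classic.
Let ab : a <= b. Proof. exact: le_trans (ltW a_lt1) b_ge1. Qed.

Let powR_le v w : 0 <= v -> v <= w -> v `^ (al - 1) <= w `^ (al - 1).
Proof.
move=> v0 vw; apply: ge0_ler_powR => //; rewrite ?nnegrE ?subr_ge0 ?(ltW al_gt1)//.
exact: le_trans vw.
Qed.

Let AE v : A v <-> v <= a \/ b < v.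
Proof.
rewrite /A /= in_itv /=; split.
  by move=> /negP; rewrite negb_and -leNgt -ltNge => /orP.
by move=> h /andP[av vb]; case: h => h; lra.
Qed.

(** Outside ]a, b] both values obey the growth bound of f1, and the clamped point is either below 1
    or at most v. *)
Let clamp_error v : 0 <= v -> `|f1 v - f1 (clamp a b v)| <= 4 * C1 * (1 + v `^ (al - 1)) * \1_A v.
Proof.
move=> v0; have hv := f1_growth v0; have p0 := powR_ge0 v (al - 1).
have C1p : 0 <= C1 * v `^ (al - 1) by rewrite mulr_ge0.
have nn : 0 <= 4 * C1 * (1 + v `^ (al - 1)) * (v \in A)%:R by rewrite !mulr_ge0// addr_ge0.
have [[va e]|[bv e]|[/andP[av vb] e]] := clampE v ab; rewrite e indicE.
- rewrite mem_set; last by apply/AE; left.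
  have ha := f1_growth (ltW a_gt0).
  have ha1 := powR_le (ltW a_gt0) (ltW a_lt1); rewrite powR1 in ha1.
  have h2 : C1 * a `^ (al - 1) <= C1 * 1 by rewrite ler_wpM2l.
  rewrite mulr1; apply: (le_trans (ler_normB _ _)).
  by have := C1_ge0; move: hv ha; rewrite !mulrDr; lra.
- have [e2|nbv] := eqVneq v b; first by rewrite [in f1 v]e2 subrr normr0.
  rewrite mem_set; last by apply/AE; right; rewrite lt_neqAle eq_sym nbv.
  have b0 : 0 <= b by exact: le_trans b_ge1.
  have hb := f1_growth b0.
  have h2 : C1 * b `^ (al - 1) <= C1 * v `^ (al - 1) by rewrite ler_wpM2l// powR_le.
  rewrite mulr1; apply: (le_trans (ler_normB _ _)).
  by have := C1_ge0; move: hv hb; rewrite !mulrDr; lra.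
- by rewrite subrr normr0.
Qed.

Let derivative_error v : 0 <= v ->
  `|f1 v - d1 v| <= eta + 4 * C1 * (1 + v `^ (al - 1)) * \1_A v.
Proof.
move=> v0; have := approx v0; have := clamp_error v0.
have := ler_normD (f1 v - f1 (clamp a b v)) (f1 (clamp a b v) - d1 v).
rewrite (_ : f1 v - _ + _ = f1 v - d1 v); last by ring.
lra.
Qed.

(** The factor v + 1 raises the growth from al - 1 to al at the cost of 3, whence 24 = 8 * 3. *)
Let error_le v delta : 0 <= v -> `|delta| <= eta + 8 * C1 * (1 + v `^ (al - 1)) * \1_A v ->
  `|delta * (v - 1)| <= 2 * eta * (1 + v `^ al) + 24 * C1 * (\1_A v * (1 + v `^ al)).
Proof.
move=> v0 hd; have /andP[i0 _] := ind_itv A v.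
have v1 : `|v - 1| <= v + 1 by rewrite ler_norml; apply/andP; split; lra.
have w1 := le_weight v0; have w2 := weight_ge1 al v; have w3 := weight_predM v0.
have v10 : 0 <= v + 1 by lra.
rewrite normrM; apply: (le_trans (ler_pM _ _ hd v1)) => //.
rewrite mulrDl; apply: lerD.
  rewrite (_ : 2 * eta * _ = eta * (2 * (1 + v `^ al))); last by ring.
  by rewrite ler_wpM2l//; lra.
have h : C1 * \1_A v * ((v + 1) * (1 + v `^ (al - 1))) <= C1 * \1_A v * (3 * (1 + v `^ al)).
  by rewrite ler_wpM2l// mulr_ge0.
rewrite (_ : _ * _ * _ * (v + 1) = 8 * (C1 * \1_A v * ((v + 1) * (1 + v `^ (al - 1))))); last by ring.
rewrite (_ : 24 * _ * _ = 8 * (C1 * \1_A v * (3 * (1 + v `^ al)))); last by ring.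
by rewrite ler_wpM2l.
Qed.

(** The difference phi - psi vanishes at 1, so it equals v - 1 times its derivative at some c
    between 1 and v. As 1 lies in ]a, b], c outside this interval forces v outside it. *)
Lemma test_error v : 0 <= v ->
  `|phi v - psi v| <= 2 * eta * (1 + v `^ al) + 24 * C1 * (\1_A v * (1 + v `^ al)).
Proof.
move=> v0.
have dd x : is_derive x 1 (fun x => phi x + (- 1) * psi x) (f1 x + (0 * psi x + (-1) * d1 x)).
  have h1 := is_deriveM1 (is_derive_cst (-1 : R) x 1) (dpsi x).
  exact: (is_deriveD1 (dphi x) h1).
have [c /andP[c1 c2]] := MVT_eq (fun x => is_derive_derivable (dd x)) 1 v.
rewrite (is_derive_derive1 (dd c)) psi1 mul0r add0r !mulN1r subrr subr0 => ->.
have c0 : 0 <= c by apply: le_trans c1; rewrite le_min ler01.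
apply: error_le => //; apply: (le_trans (derivative_error c0)); rewrite lerD2l.
have hc : c `^ (al - 1) <= 1 + v `^ (al - 1).
  have [v1|v1] := leP v 1.
    have c3 : c <= 1 by move: c2; rewrite le_max => /orP[//|/le_trans]; apply.
    by have := powR_le c0 c3; rewrite powR1; have := powR_ge0 v (al - 1); lra.
  have c3 : c <= v by move: c2; rewrite le_max => /orP[/le_trans|//]; apply; exact: ltW.
  by have := powR_le c0 c3; lra.
have hA : (\1_A c : R) <= \1_A v.
  rewrite !indicE; case: (pselect (A c)) => Ac; last by rewrite memNset// ler0n.
  rewrite !mem_set//; apply/AE; case/AE: Ac => Ac.
    left; move: c1; rewrite ge_min => /orP[c3|vc]; last exact: le_trans Ac.
    by have := lt_le_trans a_lt1 (le_trans c3 Ac); rewrite ltxx.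
  right; move: c2; rewrite le_max => /orP[c3|cv]; last exact: lt_le_trans cv.
  by have := lt_le_trans Ac (le_trans c3 b_ge1); rewrite ltxx.
have /andP[i0 _] := ind_itv A c; have pv := powR_ge0 v (al - 1); have pc := powR_ge0 c (al - 1).
apply: ler_pM => //; first by rewrite !mulr_ge0// addr_ge0.
rewrite (_ : 8 * C1 * _ = 4 * C1 * (2 + 2 * v `^ (al - 1))); last by ring.
by rewrite ler_wpM2l ?mulr_ge0//; lra.
Qed.

Lemma generator_error v : 0 <= v ->
  `|generator lambda f1 D v - generator lambda d1 (fun v => expoly P v * expw v) v| <=
  lambda / 2 * (C2 * (\1_A v * (1 + v `^ al)) +
    16 * `|truncated_density D a b v - expoly P v|) +
  (2 * eta * (1 + v `^ al) + 24 * C1 * (\1_A v * (1 + v `^ al))).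
Proof.
move=> v0; have l0 : 0 <= lambda / 2 by rewrite divr_ge0// ltW.
have e1 : `|(f1 v - d1 v) * (v - 1)| <= 2 * eta * (1 + v `^ al) + 24 * C1 * (\1_A v * (1 + v `^ al)).
  apply: error_le => //; apply: (le_trans (derivative_error v0)); rewrite lerD2l.
  have /andP[i0 _] := ind_itv A v; have pv := powR_ge0 v (al - 1).
  by rewrite !ler_wpM2r// ?addr_ge0//; lra.
have e2 : `|v ^+ 2 * D v - v ^+ 2 * (expoly P v * expw v)| <=
    C2 * (\1_A v * (1 + v `^ al)) + 16 * `|truncated_density D a b v - expoly P v|.
  (* The error of the density is measured with respect to exp(-v) dv, so the factor v^2 of the
     generator meets exp(-v) and stays bounded. *)
  have x16 : 0 <= v ^+ 2 * expw v <= 16.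
    have := @ec_moment_bounded R 2 1 v ler01 v0; rewrite /ec /expw !mul1r.
    by rewrite (_ : (2 * 2%:R) ^+ 2 = 16 :> R)//; ring.
  rewrite (_ : _ - _ = \1_A v * (v ^+ 2 * D v) +
    v ^+ 2 * expw v * (truncated_density D a b v - expoly P v)); last first.
    have ee : expR v * expw v = 1 by rewrite /expw -expRD subrr expR0.
    have i1 : \1_A v + \1_(`]a, b]%classic) v = 1 :> R.
      rewrite !indicE /A in_setC; case: (_ \in _); rewrite /=; lra.
    rewrite /truncated_density -[X in X - _]mul1r -{1}i1.
    have -> : v ^+ 2 * expw v * (\1_(`]a, b]%classic) v * (D v * expR v) - expoly P v) =
      (expR v * expw v) * (\1_(`]a, b]%classic) v * (v ^+ 2 * D v)) - v ^+ 2 * (expoly P v * expw v).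
      by ring.
    by rewrite ee; ring.
  have /andP[i0 i1] := ind_itv A v.
  apply: (le_trans (ler_normD _ _)); apply: lerD.
    rewrite normrM (ger0_norm i0) mulrCA ler_wpM2l//; exact: D_growth.
  case/andP: x16 => x0 x16.
  by rewrite normrM (ger0_norm x0) ler_wpM2r.
rewrite (_ : _ - _ = lambda / 2 * (v ^+ 2 * D v - v ^+ 2 * (expoly P v * expw v))
   - (f1 v - d1 v) * (v - 1)); last by rewrite /generator; ring.
apply: (le_trans (ler_normB _ _)); apply: lerD => //.
by rewrite normrM (ger0_norm l0) ler_wpM2l.
Qed.

End errors.
End test_errors.

(** * Time derivative of the limit along general tests *)

Section flow_derivative.
Context {R : realType} {al lambda : R} {h : R -> R -> R}.
Implicit Types (v x y t s T : R).
Hypotheses (al_gt1 : 1 < al) (lambda_gt0 : 0 < lambda).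
Hypothesis dh : forall t : R, 0 < t -> dens al (h t).
Hypothesis mh : forall t : R, 0 < t -> pairing idfun (h t) = 1.
Hypothesis eh : forall T, equi al (fun g => exists2 t, 0 < t <= T & g = h t).
Hypothesis qh : forall T zeta (d : R), tame al zeta -> 0 < d -> exists2 r, 0 < r &
  forall s t, 0 < s <= T -> 0 < t <= T -> `|s - t| <= r ->
    `|pairing zeta (h s) - pairing zeta (h t)| <= d.
Hypothesis deh : forall j (t : R), 0 < t ->
  is_derive t 1 (fun t : R => pairing (ec j%:R) (h t)) (pairing (fp lambda (ec j%:R)) (h t)).

Let al_gt0 : 0 < al. Proof. exact: lt_trans al_gt1. Qed.

(** The mean value theorem is applied to the approximating test. Its generator at the intermediate
    time c is close to chi at c, and equicontinuity of the pairing with chi returns from c to t. *)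
Lemma approximable_flow (phi chi : R -> R) : tame al phi -> tame al chi ->
  (forall T (e : R), 0 < e -> exists psi d1 d2, flow_test al lambda h psi d1 d2 /\
    forall t, 0 < t <= T -> `|pairing phi (h t) - pairing psi (h t)| <= e /\
      `|pairing chi (h t) - pairing (generator lambda d1 d2) (h t)| <= e) ->
  forall t : R, 0 < t -> is_derive t 1 (fun t : R => pairing phi (h t)) (pairing chi (h t)).
Proof.
move=> tphi tchi appr t t0; apply/is_derive1P => d d0.
pose T : R := t + 1; have d20 : 0 < d / 2 by rewrite divr_gt0.
have [r r0 hr] := qh T tchi d20.
have m0 : 0 < Num.min r (Num.min 1 t) by rewrite !lt_min r0 ltr01 t0.
exists (Num.min r (Num.min 1 t)) => // y; rewrite !lt_min => /andP[yr /andP[y1 yt]].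
have y0 : 0 < y by move: yt; rewrite ltr_norml; lra.
have yT : 0 < y <= T by rewrite y0 /T; move: y1; rewrite ltr_norml; lra.
have tT : 0 < t <= T by rewrite t0 /T lerDl ler01.
(* The errors at the two end times are not proportional to |y - t|. They go into an extra e, which
   is sent to 0 with y fixed. *)
apply/ler_addgt0Pl => e e0.
have n0 : 0 <= `|y - t| by [].
pose e1 := Num.min (d / 4) (e / 2).
have e10 : 0 < e1 by rewrite lt_min !divr_gt0.
have ed : e1 <= d / 4 by rewrite ge_min lexx.
have ee : e1 <= e / 2 by rewrite ge_min lexx orbT.
have [psi [d1 [d2 [[tpsi tg _ _ dpsi] ha]]]] := appr T e1 e10.
have [c [c0 /andP[hc1 hc2] hc]] := MVT_pos t0 y0 dpsi.
have cT : 0 < c <= T.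
  rewrite c0 /=; apply: (le_trans hc2); rewrite ge_max.
  by move/andP: yT => [_ ->]; move/andP: tT => [_ ->].
have ct : `|c - t| <= r.
  by apply: le_trans (between_dist _) (ltW yr); rewrite hc1.
have [a1 _] := ha y yT; have [a2 _] := ha t tT; have [_ a3] := ha c cT.
have a4 := hr c t cT tT ct.
set G := pairing (generator lambda d1 d2) (h c) in hc a3.
rewrite (_ : _ - _ - _ = (pairing phi (h y) - pairing psi (h y)) -
  (pairing phi (h t) - pairing psi (h t)) + (G - pairing chi (h t)) * (y - t)); last first.
  by rewrite (_ : pairing psi (h y) = pairing psi (h t) + G * (y - t)); [ring|rewrite -hc addrC subrK].
have k1 : `|G - pairing chi (h t)| <= d.
  rewrite (_ : G - _ = (pairing chi (h c) - pairing chi (h t)) - (pairing chi (h c) - G)); last by ring.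
  by apply: (le_trans (ler_normB _ _)); lra.
apply: (le_trans (ler_normD _ _)); apply: lerD.
  by apply: (le_trans (ler_normB _ _)); lra.
by rewrite normrM ler_wpM2r.
Qed.

Section test.
Variables (phi f1 D : R -> R) (C1 C2 : R).
Hypotheses (C1_ge0 : 0 <= C1) (C2_ge0 : 0 <= C2).
Hypothesis tphi : tame al phi.
Hypothesis dphi : forall v, is_derive v 1 phi (f1 v).
Hypothesis mf1 : measurable_fun setT f1.
Hypothesis f1_growth : forall v, 0 <= v -> `|f1 v| <= C1 * (1 + v `^ (al - 1)).
Hypothesis mD : measurable_fun setT D.
Hypothesis D_growth : forall v, 0 <= v -> `|v ^+ 2 * D v| <= C2 * (1 + v `^ al).
Hypothesis ftcD : forall x y, 0 < x -> x <= y ->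
  f1 y - f1 x = \int[lebesgue_measure]_(t in `]x, y]%classic) D t.

Lemma tame_second_order : tame al (fun v => v ^+ 2 * D v).
Proof. by split; [apply: measurable_funM => //; exact: exprn_measurable|exists C2]. Qed.

Lemma tame_drift : tame al (fun v => (v - 1) * f1 v).
Proof.
split; first by apply: measurable_funM => //; exact: measurable_funB.
exists (C1 * 3) => v v0.
have v1 : `|v - 1| <= v + 1 by rewrite ler_norml; apply/andP; split; lra.
rewrite normrM; apply: (le_trans (ler_pM _ _ v1 (f1_growth v0))) => //.
by rewrite mulrCA -mulrA ler_wpM2l// weight_predM.
Qed.

Lemma tame_generator : tame al (generator lambda f1 D).
Proof. apply: tameB; [exact: tameZ tame_second_order|exact: tame_drift]. Qed.

Lemma tame_truncated_density (a b : R) : 0 < a -> tame al (truncated_density D a b).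
Proof.
move=> a0.
have mI : measurable (`]a, b]%classic : set (measurableTypeR R)) by exact: measurable_itv.
apply: (@tame_bounded _ _ _ (C2 * (1 + b `^ al) / a ^+ 2 * expR b)).
  apply: measurable_funM; first exact: measurable_ind.
  by apply: measurable_funM => //; exact: measurable_expR.
move=> v v0; rewrite /truncated_density indicE.
have b0 : 0 <= C2 * (1 + b `^ al) / a ^+ 2.
  by rewrite divr_ge0 ?sqr_ge0// mulr_ge0// weight_ge0.
case: (pselect (`]a, b]%classic v)) => hv; last first.
  by rewrite memNset// mul0r normr0 mulr_ge0 ?expR_ge0.
rewrite mem_set// mul1r normrM; move: hv; rewrite /= in_itv /= => /andP[av vb].
have v20 : 0 < v ^+ 2 by rewrite exprn_gt0// (lt_trans a0).
apply: ler_pM => //; last by rewrite (gtr0_norm (expR_gt0 _)) ler_expR.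
rewrite ler_pdivlMr ?exprn_gt0//.
have h1 : `|D v| * a ^+ 2 <= `|v ^+ 2 * D v|.
  rewrite normrM (gtr0_norm v20) [leRHS]mulrC ler_wpM2l//.
  by rewrite ler_pXn2r ?nnegrE// ltW.
apply: (le_trans h1); apply: (le_trans (D_growth v0)).
rewrite ler_wpM2l// lerD2l ge0_ler_powR ?nnegrE// ?ltW//.
exact: lt_le_trans (lt_trans a0 av) vb.
Qed.

Lemma test_approximable T (e : R) : 0 < e -> exists psi d1 d2, flow_test al lambda h psi d1 d2 /\
  forall t, 0 < t <= T -> `|pairing phi (h t) - pairing psi (h t)| <= e /\
    `|pairing (generator lambda f1 D) (h t) - pairing (generator lambda d1 d2) (h t)| <= e.
Proof.
move=> e0; have ew := equi_expw al_gt0 : equi al (fun g => g = @expw R).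
(* exp(-v) joins the solutions so that one P serves both the uniform bound on derivatives, in L^1 of
   exp(-v) dv, and the pairings with every h(., t). *)
pose F g := (exists2 t, 0 < t <= T & g = h t) \/ g = expw.
have eF : equi al F by exact: equi_union (eh T) ew.
have aF g : F g -> adm al g.
  by case=> [[t /andP[t0 _] ->]|->]; [exact: dens_adm (dh t0)|exact: adm_expw].
have [M M0 hM] := equi_weight al_gt0 aF eF.
(* K collects the coefficients of eta in the bounds [p1] and [p2] below. *)
pose K := lambda / 2 * (C2 + 16) + (2 * M + 24 * C1).
have K1 : 0 < K + 1.
  have l0 : 0 <= lambda / 2 * (C2 + 16) by apply: mulr_ge0; [rewrite divr_ge0// ltW|rewrite addr_ge0].
  by rewrite ltr_wpDl// !addr_ge0// ?mulr_ge0.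
pose eta := e / (K + 1); have eta0 : 0 < eta by rewrite divr_gt0.
have Keta : K * eta <= e.
  by rewrite /eta mulrCA ler_piMr ?(ltW e0)// ler_pdivrMr// mul1r lerDl.
(* Starting from 2 keeps a n strictly below 1. *)
pose a n : R := n.+2%:R^-1; pose b n : R := n.+2%:R.
have a0 n : 0 < a n by rewrite invr_gt0 ltr0n.
have a1 n : a n < 1 by rewrite invf_lt1 ?ltr0n// ltr1n.
have b1 n : 1 <= b n by rewrite ler1n.
pose A n : set (measurableTypeR R) := ~` `]a n, b n]%classic.
have mA n : measurable (A n) by apply: measurableC; exact: measurable_itv.
have hA v : 0 < v -> exists N, forall n, (N <= n)%N -> ~ A n v.
  move=> v0; exists (maxn (Num.truncn v^-1) (Num.truncn v)) => n; rewrite geq_max => /andP[n1 n2].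
  have k1 : v^-1 < n.+1%:R by rewrite (lt_le_trans (truncnS_gt _))// ler_nat ltnS.
  have k2 : v < n.+1%:R by rewrite (lt_le_trans (truncnS_gt _))// ler_nat ltnS.
  have k3 : n.+1%:R <= n.+2%:R :> R by rewrite ler_nat.
  suff nA : `]a n, b n]%classic v by move=> An; exact: An nA.
  rewrite /= in_itv /= (ltW (lt_le_trans k2 k3)) andbT /a invf_plt ?posrE ?ltr0n//.
  exact: lt_le_trans k3.
have [N hN] := equi_vanish al_gt0 eF mA eta0 hA.
have tQ := tame_truncated_density (b N) (a0 N).
have [P hP] := equi_approx al_gt0 aF eF tQ eta0.
have [psi [d1 [tpsi psi1 d11]]] :=
  flow_test_second_derivative (ltW al_gt1) dh mh deh P (phi 1) (f1 1).
have [tps tg dpsi dd1 _] := tpsi.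
have ap := derivative_approx (a0 N) (a1 N) (b1 N) ftcD al_gt0 tQ dd1 d11 (hP _ (or_intror erefl)).
exists psi, d1, (fun v => expoly P v * expw v); split => // t tT.
have /andP[t0 _] := tT; have Ft : F (h t) by left; exists t.
have ah := aF _ Ft; have hMt := hM _ Ft; have hNt := hN N (leqnn N) _ Ft; have hPt := hP _ Ft.
have tW := @tame_weight R al.
have tA : tame al (fun v => \1_(A N) v * (1 + v `^ al)).
  apply: (tame_bM (M := 1) tW (measurable_ind (mA N))) => v _.
  by have /andP[i0 i1] := ind_itv (A N) v; rewrite ger0_norm.
have tQP := tame_norm (tameB tQ (tame_expoly al P)).
have e1 := test_error al_gt1 C1_ge0 dphi f1_growth (a0 N) (a1 N) (b1 N) (ltW eta0) dpsi psi1 ap.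
have e2 := generator_error al_gt1 C1_ge0 f1_growth D_growth P (a0 N) (a1 N) (b1 N) (ltW eta0) lambda_gt0 ap.
have t1 : tame al (fun v => 2 * eta * (1 + v `^ al) + 24 * C1 * (\1_(A N) v * (1 + v `^ al))).
  by apply: tameD; exact: tameZ.
have l0 : 0 <= lambda / 2 by rewrite divr_ge0// ltW.
have p1 : pairing (fun v => 2 * eta * (1 + v `^ al) + 24 * C1 * (\1_(A N) v * (1 + v `^ al))) (h t)
    <= (2 * M + 24 * C1) * eta.
  rewrite (pairingD ah (tameZ _ tW) (tameZ _ tA)) (pairingZ ah _ tW) (pairingZ ah _ tA) [leRHS]mulrDl.
  by apply: lerD; [rewrite mulrAC ler_wpM2r ?(ltW eta0)// ler_wpM2l|rewrite ler_wpM2l// mulr_ge0].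
have t2 : tame al (fun v => lambda / 2 * (C2 * (\1_(A N) v * (1 + v `^ al)) +
    16 * `|truncated_density D (a N) (b N) v - expoly P v|)).
  by apply: tameZ; apply: tameD; exact: tameZ.
have p2 : pairing (fun v => lambda / 2 * (C2 * (\1_(A N) v * (1 + v `^ al)) +
    16 * `|truncated_density D (a N) (b N) v - expoly P v|)) (h t) <= lambda / 2 * (C2 + 16) * eta.
  rewrite (pairingZ ah _ (tameD (tameZ _ tA) (tameZ _ tQP))) -[leRHS]mulrA ler_wpM2l//.
  rewrite (pairingD ah (tameZ _ tA) (tameZ _ tQP)) (pairingZ ah _ tA) (pairingZ ah _ tQP) [leRHS]mulrDl.
  by apply: lerD; rewrite ler_wpM2l.
have Ke : K * eta = lambda / 2 * (C2 + 16) * eta + (2 * M + 24 * C1) * eta by rewrite /K mulrDl.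
split.
  rewrite -(pairingB ah tphi tps).
  apply: (le_trans (pairing_norm_le ah (tameB tphi tps) t1 e1)).
  apply: (le_trans p1); apply: le_trans Keta; rewrite Ke lerDr.
  by rewrite mulr_ge0 ?ltW// mulr_gt0 ?divr_gt0// ltr_wpDl.
rewrite -(pairingB ah tame_generator tg).
apply: (le_trans (pairing_norm_le ah (tameB tame_generator tg) (tameD t2 t1) e2)).
rewrite (pairingD ah t2 t1); apply: le_trans Keta; rewrite Ke.
exact: lerD.
Qed.

Lemma flow_derivative t : 0 < t ->
  is_derive t 1 (fun t => pairing phi (h t)) (pairing (generator lambda f1 D) (h t)).
Proof. exact: (approximable_flow tphi tame_generator test_approximable). Qed.

End test.
End flow_derivative.

Section fokker_planck.
Context {R : realType} {al lambda : R} {h : R -> R -> R}.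
Implicit Types (v x y t s T : R).
Hypotheses (al_gt1 : 1 < al) (lambda_gt0 : 0 < lambda).

Lemma tame_holder (phi : R -> R) : holder_class al phi -> tame al phi.
Proof.
move=> hphi; have [dphi [C C0 hC] _] := holder_growth al_gt1 hphi.
split; last by exists C.
by apply: continuous_measurable_fun => x; exact: is_derive_continuous (derivable_is_derive (dphi x)).
Qed.

Hypothesis dh : forall t : R, 0 < t -> dens al (h t).
Hypothesis mh : forall t : R, 0 < t -> pairing idfun (h t) = 1.
Hypothesis eh : forall T, equi al (fun g => exists2 t, 0 < t <= T & g = h t).
Hypothesis qh : forall T zeta (d : R), tame al zeta -> 0 < d -> exists2 r, 0 < r &
  forall s t, 0 < s <= T -> 0 < t <= T -> `|s - t| <= r ->
    `|pairing zeta (h s) - pairing zeta (h t)| <= d.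
Hypothesis deh : forall j (t : R), 0 < t ->
  is_derive t 1 (fun t : R => pairing (ec j%:R) (h t)) (pairing (fp lambda (ec j%:R)) (h t)).

Lemma fokker_planck_flow : fokker_planck_weak_solution lambda al h.
Proof.
move=> phi test tau tau0.
have [dphi _ [C1 C10 hC1]] := holder_growth al_gt1 (proj1 test).
have [lip [C2 C20 hC2]] := fokker_planck_test_derivative al_gt1 test.
have [D [N [mD [mN N0] hD D_gr ftcD]]] := second_derivative C20 lip hC2.
have mf1 := measurable_derive1 dphi.
have tphi := tame_holder (proj1 test).
have K := flow_derivative al_gt1 lambda_gt0 dh mh eh qh deh C10 C20 tphi
  (fun v => derivable_is_derive (dphi v)) mf1 hC1 mD D_gr ftcD tau0.
split; first exact: is_derive_derivable K.
have ah := dens_adm (dh tau0).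
have t2 := tame_second_order mD D_gr; have t1 := tame_drift al_gt1 C10 mf1 hC1.
rewrite (is_derive_derive1 K) (pairingB ah (tameZ _ t2) t1) (pairingZ ah _ t2).
have -> : \int[lebesgue_measure]_(v in @Rplus R) (derive1 phi v * (v - 1) * h tau v) =
    pairing (fun v => (v - 1) * derive1 phi v) (h tau).
  by apply: eq_Rintegral => v _; rewrite [in RHS](mulrC (v - 1)).
(* Off N the second derivative equals D; at v = 0 the factor v^2 removes any difference. *)
rewrite subrK; congr (_ * _); congr fine; apply: (integral_ae mN N0) => v.
rewrite RplusE le_eqVlt => /predU1P[<-|v0] Nv.
  by rewrite expr0n/= !(mul0r, mulr0).
by congr EFin; rewrite -(hD v v0 Nv); rewrite /derive1n/=; ring.
Qed.

End fokker_planck.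

Theorem theorem3p13 (R : realType) (delta lambda : R) (f0 : R -> R)
    (p q : nat -> R) (g : nat -> R -> R -> R)
    (hdelta : 0 < delta) (hlambda : 0 < lambda)
    (hf0 : density_in_M (1 + delta) f0)
    (hmean : mean f0 = 1)
    (hpq : forall n, 0 < q n < p n)
    (hlim : forall n, (p n - 1) ^+ 2 / q n = lambda)
    (hq0 : q n @[n --> \oo] --> (0 : R))
    (hg : forall n, scaled_weak_solution (p n) (q n) (1 + delta) f0 (g n)) :
  exists (e : nat -> nat) (h : R -> R -> R),
    [/\ {homo e : i j / (i < j)%N},
        forall tau : R, 0 < tau -> density_in_M (1 + delta) (h tau),
        forall phi : R -> R, holder_class (1 + delta) phi ->
          forall tau : R, 0 < tau ->
            pairing phi (slow_time (q (e k)) (g (e k)) tau) @[k --> \oo]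
              --> pairing phi (h tau) &
        fokker_planck_weak_solution lambda (1 + delta) h].
Proof.
set al := 1 + delta.
have al_gt1 : 1 < al by rewrite ltrDl.
have al_ge1 := ltW al_gt1; have al_gt0 := lt_trans ltr01 al_gt1.
have df0 := (density_in_M_dens al f0).1 hf0.
have q0 n : 0 < q n by case/andP: (hpq n).
have p0 n : 0 < p n by case/andP: (hpq n) => /lt_trans; exact.
have pqE n : (p n - 1) ^+ 2 = lambda * q n by rewrite -(hlim n) divfK// gt_eqF.
have [f hf] : {f : nat -> R -> R -> R | forall n, boltzmann_weak_solution (p n) (q n) al f0 (f n) /\
    forall t v : R, 0 < t -> g n t v = mean (f n t) * f n t (mean (f n t) * v)}.
  have /choice[f hf] : forall n, exists f, boltzmann_weak_solution (p n) (q n) al f0 f /\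
    forall t v : R, 0 < t -> g n t v = mean (f t) * f t (mean (f t) * v).
    by move=> n; have [f hf1 hf2] := hg n; exists f.
  by exists f.
have sol n := (hf n).1.
(* p tends to 1 together with q tending to 0, since (p - 1)^2 = lambda q. *)
have small (e : R) : 0 < e -> exists N, forall n, (N <= n)%N -> `|p n - 1| <= e /\ q n <= e.
  move=> e0; have m0 : 0 < Num.min e (e ^+ 2 / lambda).
    by rewrite lt_min e0 divr_gt0// exprn_gt0.
  have /cvgrPdist_lt/(_ _ m0)[N _ hN] := hq0; exists N => n /hN /=.
  rewrite sub0r normrN gtr0_norm// lt_min => /andP[q1 q2]; split; last exact: ltW.
  rewrite -(@ler_pXn2r _ 2) ?nnegrE ?(ltW e0)// real_normK ?num_real// pqE.
  by rewrite mulrC -ler_pdivlMr// ltW.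
(* Finitely many indices are dropped to enter the range |p - 1| <= 1/2, q <= 1 of the uniform
   estimates; the final subsequence is shifted by [N0] accordingly. *)
have [N0 hN0] := small 2^-1 (ltac:(by rewrite invr_gt0)).
have pn n : `|p (n + N0)%N - 1| <= 2^-1 by have [] := hN0 (n + N0)%N (leq_addl _ _).
have tq n (t : R) : 0 < t -> 0 < t / q (n + N0)%N by move=> t0; rewrite divr_gt0.
pose u n t := scaled (f := f (n + N0)%N) (t / q (n + N0)%N).
have uE n (t : R) : 0 < t -> slow_time (q (n + N0)%N) (g (n + N0)%N) t = u n t.
  by move=> t0; apply/funext => v; rewrite /slow_time (hf _).2// tq.
have dens_u n (t : R) : 0 < t -> dens al (u n t).
  by move=> t0; exact: (scaled_dens (q0 _) (p0 _) al_ge1 hmean (sol (n + N0)%N) (tq n t t0)).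
have equi_u (T : R) : equi al (fun g => exists n t, 0 < t <= T /\ g = u n t).
  apply: equi_sub (scaled_family_equi al_ge1 hlambda df0 hmean T) => _ [n [t [tT ->]]].
  have [h1 h2] := hN0 (n + N0)%N (leq_addl _ _).
  exists (p (n + N0)%N), (q (n + N0)%N), (f (n + N0)%N), t; split => //.
    by move: h1; rewrite ler_norml; lra.
  by rewrite q0 /=; lra.
pose du n j t := scaled_collision (p := p (n + N0)%N) (q := q (n + N0)%N) (f := f (n + N0)%N)
  (ec j%:R) (t / q (n + N0)%N) / q (n + N0)%N.
have derive_u n j (t : R) : 0 < t ->
    is_derive t 1 (fun t : R => pairing (ec j%:R) (u n t)) (du n j t).
  move=> t0.
  have h1 := scaled_derive (q0 _) (p0 _) al_ge1 hmean (sol (n + N0)%N) (tq n t t0)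
    (@test2_ec R al j%:R (ler0n _ _)).
  have h2 : is_derive t 1 (fun s : R => s / q (n + N0)%N) (q (n + N0)%N)^-1.
    have := is_deriveM1 (is_derive_id t (1 : R)) (is_derive_cst ((q (n + N0)%N)^-1) t (1 : R)).
    by rewrite mul1r mulr0 addr0.
  exact: (@is_derive1_comp R (fun s => pairing (ec j%:R) (scaled (f := f (n + N0)%N) s))
    (fun s => s / q (n + N0)%N) t _ _ h1 h2).
have consistent_u (T : R) j e : 0 < e -> exists N, forall n, (N <= n)%N ->
    forall t, 0 < t <= T -> `|du n j t - pairing (fp lambda (ec j%:R)) (u n t)| <= e.
  move=> e0.
  have aF (w : R -> R) : (exists n t, 0 < t <= T /\ w = u n t) -> adm al w.
    by move=> [n [t [/andP[t0 _] ->]]]; exact: dens_adm (dens_u n t t0).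
  have [M M0 hM] := equi_weight al_gt0 aF (equi_u T).
  pose A : R := 216 * lambda + 2 * j%:R.
  pose B : R := expR 1 * j%:R `^ (Num.min al 2) * M.
  have Age0 : 0 <= A.
    apply: addr_ge0; last by rewrite mulr_ge0.
    exact: mulr_ge0 (ler0n _ _) (ltW hlambda).
  have Bge0 : 0 <= B by rewrite mulr_ge0// mulr_ge0 ?expR_ge0 ?powR_ge0.
  have A0 : 0 < A + 1 by rewrite ltr_wpDl.
  have B0 : 0 < B + 1 by rewrite ltr_wpDl.
  have m0 := min_gt1 al_gt1.
  (* [r2] solves (B + 1) r^(min(al, 2) - 1) = e/2, where the exponent is positive because al > 1. *)
  pose r1 := e / 2 / (A + 1); pose r2 := (e / 2 / (B + 1)) `^ (Num.min al 2 - 1)^-1.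
  have e20 : 0 < e / 2 by rewrite divr_gt0.
  have r10 : 0 < r1 by rewrite divr_gt0.
  have eB0 : 0 < e / 2 / (B + 1) by rewrite divr_gt0.
  have r20 : 0 < r2 by rewrite powR_gt0.
  have r12 : 0 < Num.min r1 r2 by rewrite lt_min r10.
  have [N hN] := small _ r12; exists N => n Nn t /andP[t0 tT].
  have [] := hN (n + N0)%N (leq_trans Nn (leq_addr _ _)).
  rewrite !le_min => /andP[k1 _] /andP[_ k2].
  apply: (le_trans (ec_consistency (q0 _) (p0 _) al_ge1 hmean (sol _) (pn n) (pqE _)
    (ler0n _ j) (tq n t t0) (hM _ (ex_intro _ n (ex_intro _ t (conj _ erefl)))))).
    by rewrite t0.
  rewrite -mulrDl -/A (_ : _ * q _ `^ _ * M = B * q (n + N0)%N `^ (Num.min al 2 - 1)); last by rewrite /B; ring.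
  have k3 : A * `|p (n + N0)%N - 1| <= e / 2.
    apply: (@le_trans _ _ ((A + 1) * r1)); last by rewrite /r1 mulrC divfK// gt_eqF.
    by apply: ler_pM => //; rewrite lerDl.
  have k4 : B * q (n + N0)%N `^ (Num.min al 2 - 1) <= e / 2.
    have k5 : q (n + N0)%N `^ (Num.min al 2 - 1) <= e / 2 / (B + 1).
      apply: (@le_trans _ _ (r2 `^ (Num.min al 2 - 1))).
        by apply: ge0_ler_powR; rewrite ?nnegrE// ltW.
      by rewrite /r2 -powRrM mulVf ?powRr1// ?ltW// gt_eqF.
    apply: (@le_trans _ _ ((B + 1) * (e / 2 / (B + 1)))); last by rewrite mulrC divfK// gt_eqF.
    by apply: ler_pM => //; rewrite ?powR_ge0// lerDl.
  by rewrite [leRHS](splitr e); exact: lerD.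
have [e [h [he dh cvh eqh [qh deh]]]] := limit_flow al_gt0 dens_u equi_u derive_u consistent_u.
(* The mean passes to the limit because v is among the functions of growth v^al. *)
have mh (t : R) : 0 < t -> pairing idfun (h t) = 1.
  move=> t0; apply: (cvg_unique _ (cvh t _ t0 (tame_id al_ge1))) => //.
  rewrite (_ : (fun k => _) = fun=> 1); first exact: cvg_cst.
  by apply/funext => k; exact: (scaled_mean (q0 _) (p0 _) al_ge1 hmean (sol _) (tq _ t t0)).
exists (fun k => (e k + N0)%N), h; split.
- by move=> i j ij; rewrite ltn_add2r he.
- by move=> t t0; apply/density_in_M_dens; exact: dh.
- move=> phi hphi t t0; under eq_fun do rewrite uE//.
  exact: (cvh t phi t0 (tame_holder al_gt1 hphi)).
- exact: fokker_planck_flow al_gt1 hlambda dh mh eqh qh deh.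
Qed.
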